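(* Let $X=(X_t)_{t\ge 0}$ be a real L\'evy process with no Gaussian component ($\sigma^2=0$) and L\'evy measure $\Pi$. Put $$I(a)=\int_0^1 x^{-1}\exp\left(-\frac{a^2}{2V(x)}\right)dx,\quad a>0,\qquad \lambda_I^*:=\inf\{a>0: I(a)<\infty\}\in[0,\infty],$$ where the infimum of the empty set is $+\infty$. Then, almost surely, $$-\liminf_{t\downarrow 0}\frac{X_t}{\sqrt t}=\limsup_{t\downarrow 0}\frac{X_t}{\sqrt t}=\limsup_{t\downarrow 0}\frac{|X_t|}{\sqrt t}=\lambda_I^*.$$
   Context: The L\'evy process $X$ ($X_0=0$) has characteristic triplet $(\gamma,\sigma^2,\Pi)$ with $\sigma^2=0$, $\gamma\in\mathbb{R}$, and the L\'evy measure $\Pi$ is carried by $[-1,1]\setminus\{0\}$ with $\int x^2\,\Pi(dx)<\infty$; that is, $E[e^{i\theta X_t}]=e^{t\Psi(\theta)}$ with $$\Psi(\theta)=i\gamma\theta+\int_{[-1,1]}(e^{i\theta x}-1-i\theta x)\,\Pi(dx),\quad \theta\in\mathbb{R}.$$ For $x>0$, $V(x)=\int_{|y|\le x}y^2\,\Pi(dy)$. The integrand $\exp(-a^2/(2V(x)))$ is read as $0$ when $V(x)=0$. *)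

(* Defs.v *)
From HB Require Import structures.
From mathcomp Require Import all_boot all_order all_algebra.
From mathcomp Require Import complex.
From mathcomp Require Import all_classical all_reals all_analysis.
Set Implicit Arguments.
Unset Strict Implicit.
Unset Printing Implicit Defensive.
Import Order.TTheory GRing.Theory Num.Theory.
Import numFieldNormedType.Exports.
Local Open Scope classical_set_scope.
Local Open Scope ring_scope.
Local Open Scope complex_scope.

Definition cexp (R : realType) (z : R[i]) : R[i] :=
  (expR (complex.Re z))%:C * (cos (complex.Im z) +i* sin (complex.Im z)).

(* Componentwise, with the junk value 0 for a component that is not
   integrable. *)
Definition cintegral (d : measure_display) (T : measurableType d)
    (R : realType) (mu : {measure set T -> \bar R}) (D : set T)
    (f : T -> R[i]) : R[i] :=
  (\int[mu]_(x in D) complex.Re (f x)) +i* (\int[mu]_(x in D) complex.Im (f x)).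

Definition char_fun (d : measure_display) (T : measurableType d)
    (R : realType) (P : probability T R) (Y : T -> R) (theta : R) : R[i] :=
  cintegral P setT (fun w => cexp ('i * (theta * Y w)%:C)).

(* The index set is R, but only the times t >= 0 are constrained.  In
   [levy_indep], the product rule over all n increments also covers
   subfamilies, by taking some of the B i equal to setT. *)
Record levy_process (d : measure_display) (T : measurableType d)
    (R : realType) (P : probability T R) (X : R -> {RV P >-> R}) : Prop := {
  levy_start : {ae P, forall w, X 0 w = 0};
  levy_indep : forall (n : nat) (t : nat -> R) (B : nat -> set R),
    0 <= t 0%N -> {homo t : i j / (i <= j)%N >-> i <= j} ->
    (forall i, measurable (B i)) ->
    P [set w | forall i, (i < n)%N -> B i (X (t i.+1) w - X (t i) w)] =
    (\prod_(i < n) P [set w | B i (X (t i.+1) w - X (t i) w)%R])%E;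
  levy_stationary : forall (s h : R) (B : set R),
    0 <= s -> 0 <= h -> measurable B ->
    P [set w | B (X (s + h) w - X s w)] = P [set w | B (X h w - X 0 w)];
  levy_cadlag : {ae P, forall w,
    (forall t, 0 <= t -> X s w @[s --> t^'+] --> X t w) /\
    (forall t, 0 < t -> cvg (X s w @[s --> t^'-]))}
}.

(* No truncation function: the Levy measures considered here are carried by
   [-1, 1] and integrate x ^ 2. *)
Definition levy_exponent (R : realType) (gamma sigma2 : R)
    (Pi : {measure set R -> \bar R}) (theta : R) : R[i] :=
  'i * (gamma * theta)%:C - (sigma2 * theta ^+ 2 / 2)%:C
  + cintegral Pi `[-1, 1]
      (fun x => cexp ('i * (theta * x)%:C) - 1 - 'i * (theta * x)%:C).

Definition has_triplet (d : measure_display) (T : measurableType d)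
    (R : realType) (P : probability T R) (X : R -> {RV P >-> R})
    (gamma sigma2 : R) (Pi : {measure set R -> \bar R}) : Prop :=
  forall t theta : R, 0 <= t ->
    char_fun P (X t) theta = cexp (t%:C * levy_exponent gamma sigma2 Pi theta).

Definition Vfun (R : realType) (Pi : {measure set R -> \bar R}) (x : R) : R :=
  \int[Pi]_(y in [set y | `|y| <= x]) (y ^+ 2).

Definition Ifun (R : realType) (Pi : {measure set R -> \bar R}) (a : R)
    : \bar R :=
  (\int[lebesgue_measure]_(x in `]0%R, 1%R])
     (x^-1 * (if Vfun Pi x == 0 then 0
              else expR (- (a ^+ 2 / (2 * Vfun Pi x)))))%:E)%E.

Definition lambdaI (R : realType) (Pi : {measure set R -> \bar R}) : \bar R :=
  ereal_inf [set a%:E | a in [set a : R | 0 < a /\ (Ifun Pi a < +oo)%E]].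

(* Main.v *)
Require Import Defs.
From HB Require Import structures.
From mathcomp Require Import all_boot all_order all_algebra.
From mathcomp Require Import ring lra zify complex.
From mathcomp Require Import all_classical all_reals all_analysis.
From mathcomp Require Import measurable_realfun.
Import Order.TTheory GRing.Theory Num.Theory.
Import numFieldNormedType.Exports.
Local Open Scope classical_set_scope.
Local Open Scope ring_scope.
Set Implicit Arguments.
Unset Strict Implicit.
Unset Printing Implicit Defensive.

(* With G_a(s) = exp(-a^2 / (2 V(s))), the law of X_{s^2} / s is compared with
   the centred Gaussian law of variance V(s).  The characteristic functions
   differ by at most C (1 + |u|)^3 Verr(s), where
   Verr(s) = |gamma| s + \int y^2 w(|y| / s) Pi(dy) with w(u) = min(u, 1/u);
   testing against smoothed indicators, whose Fourier transforms decay fast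
   enough, gives
     P(|X_{s^2}| >= (a + delta) s) <= 2 G_a(s) + C Verr(s),
     P(+-X_{s^2} >= b s) >= c G_{b + delta}(s) - C Verr(s).
   The error is summable along any geometric sequence s = k q^n (Fubini: each
   y contributes boundedly many scales), and I(a) < oo if and only if
   \sum_n G_a(q^n) < oo.  When I(a) < oo, Ottaviani's inequality on dyadic
   grids and Borel-Cantelli bound |X_t| / sqrt t by a.  When I(a) = oo, the
   increments of X over the intervals [q^{2n+2}, q^{2n}] are independent and
   a converse Borel-Cantelli argument produces infinitely many n for which
   +-X_{q^{2n}} is of size a q^n. *)

(** [X t] need not have a density, and the Fourier transform of an indicator decays too slowly to be
    paired with an error growing like |u|^3. Tail events are therefore sandwiched between test
    functions; the loss [delta] in the level is free, because [lambdaI] is an infimum over levels.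
    The test functions are trapezoids, whose cosine transform follows from that of |x| without an
    inversion theorem, averaged three times to pay for the cubic growth. The error is then linear in
    Verr(s), with no extra factor depending on s, which is what keeps it summable over geometric
    scales. Both halves also use that X_{s^2} / s tends to 0 in probability, a consequence of V(s)
    -> 0 and Verr(s) -> 0. This supplies the probability 1/2 that Ottaviani's inequality asks for.
    In the divergent case it keeps the value at time q^{2n+2} below delta q^n, so that a large
    increment does produce a large value of X. The increments there have scale k q^n with k = sqrt(1
    - q^2); a small q brings k close to 1. *)

Lemma ge0_derive_le (R : realType) (f df : R -> R) :
  (forall x : R, is_derive x 1 f (df x)) -> (forall x, 0 <= x -> 0 <= df x) ->
  forall x, 0 <= x -> f 0 <= f x.
Proof.
move=> fdf df0 x x0.
have cf : {within `[0, x], continuous f}.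
  by apply: derivable_within_continuous => y _; have [] := fdf y.
have [c c0 fE] := MVT_segment x0 (fun y _ => fdf y) cf.
rewrite -subr_ge0 fE subr0 mulr_ge0// df0//.
by move: c0; rewrite in_itv/= => /andP[].
Qed.

(** * Taylor bounds for sine and cosine, each from the sign of a derivative *)

Section trig_ineq.
Context {R : realType}.
Implicit Types x : R.

Lemma sin_le_id x : 0 <= x -> sin x <= x.
Proof.
move=> x0; rewrite -subr_ge0.
have := @ge0_derive_le R (fun y => y - sin y) (fun y => 1 - cos y) _ _ x x0.
rewrite sin0 !subr0; apply=> y _.
by rewrite subr_ge0 cos_le1.
Qed.

Lemma onem_cos_le_id x : 0 <= x -> 1 - cos x <= x.
Proof.
move=> x0; rewrite -subr_ge0.
have := @ge0_derive_le R (fun y => y - (1 - cos y)) (fun y => 1 - sin y) _ _ x x0.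
rewrite cos0 !subrr; apply=> [y|y _].
  by apply: is_derive_eq; ring.
by rewrite subr_ge0 sin_le1.
Qed.

Lemma onem_cos_le_sqr x : 0 <= x -> 1 - cos x <= x ^+ 2 / 2.
Proof.
move=> x0; rewrite -subr_ge0.
have := @ge0_derive_le R (fun y => y ^+ 2 / 2 - (1 - cos y)) (fun y => y - sin y) _ _ x x0.
rewrite cos0 expr0n/= mul0r !subrr; apply=> [y|y y0].
  by apply: is_derive_eq; rewrite !scaler0/= /GRing.scale/=; field.
by rewrite subr_ge0 sin_le_id.
Qed.

Lemma id_sub_sin_le x : 0 <= x -> x - sin x <= x ^+ 2 / 2.
Proof.
move=> x0; rewrite -subr_ge0.
have := @ge0_derive_le R (fun y => y ^+ 2 / 2 - (y - sin y)) (fun y => y - (1 - cos y)) _ _ x x0.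
rewrite sin0 expr0n/= mul0r !subrr; apply=> [y|y y0].
  by apply: is_derive_eq; rewrite !scaler0/= /GRing.scale/=; field.
by rewrite subr_ge0 onem_cos_le_id.
Qed.

Lemma cos_taylor2_le x : 0 <= x -> cos x - 1 + x ^+ 2 / 2 <= x ^+ 3 / 6.
Proof.
move=> x0; rewrite -subr_ge0.
have := @ge0_derive_le R (fun y => y ^+ 3 / 6 - (cos y - 1 + y ^+ 2 / 2))
  (fun y => y ^+ 2 / 2 - (y - sin y)) _ _ x x0.
rewrite cos0 !expr0n/= !mul0r subrr addr0 !subrr; apply=> [y|y y0].
  by apply: is_derive_eq; rewrite !scaler0/= /GRing.scale/=; field.
by rewrite subr_ge0 id_sub_sin_le.
Qed.

Lemma id_sub_sin_le3 x : 0 <= x -> x - sin x <= x ^+ 3 / 6.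
Proof.
move=> x0; rewrite -subr_ge0.
have := @ge0_derive_le R (fun y => y ^+ 3 / 6 - (y - sin y)) (fun y => y ^+ 2 / 2 - (1 - cos y)) _ _ x x0.
rewrite sin0 !expr0n/= !mul0r !subrr; apply=> [y|y y0].
  by apply: is_derive_eq; rewrite !scaler0/= /GRing.scale/=; field.
by rewrite subr_ge0 onem_cos_le_sqr.
Qed.

Lemma cos_norm x : cos `|x| = cos x.
Proof. by case: (ler0P x) => // _; rewrite cosN. Qed.

Lemma sin_norm x : `|sin x| <= `|x|.
Proof.
wlog x0 : x / 0 <= x => [hw|].
  have [/hw//|/ltW x0] := leP 0 x.
  by rewrite -normrN -sinN -[leRHS]normrN hw// oppr_ge0.
rewrite (ger0_norm x0) ler_norml sin_le_id//.
have [x1|x1] := leP 1 x; first by have := sin_geN1 x; lra.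
rewrite lerNl (@le_trans _ _ 0)// oppr_le0 sin_ge0_pi// x0/=.
by have := @pi_ge2 R; lra.
Qed.

Lemma norm_cos_sub1_le x : `|cos x - 1| <= `|x|.
Proof.
rewrite -cos_norm distrC ger0_norm ?subr_ge0 ?cos_le1//.
exact: onem_cos_le_id.
Qed.

Lemma norm_cos_sub1_le_sqr x : `|cos x - 1| <= x ^+ 2 / 2.
Proof.
rewrite -cos_norm distrC ger0_norm ?subr_ge0 ?cos_le1//.
by rewrite -(real_normK (num_real x)) onem_cos_le_sqr.
Qed.

(** Serves the jumps of size at most s; the first-order bound [norm_cos_sub1_le] serves the larger
    ones, where a cubic remainder would be too big. For the sine, [norm_sin_sub_le3] and
    [norm_sin_sub_le] share the work in the same way. *)
Lemma norm_cos_taylor2_le x : `|cos x - 1 + x ^+ 2 / 2| <= `|x| ^+ 3.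
Proof.
rewrite -cos_norm -(real_normK (num_real x)).
move: `|x| (normr_ge0 x) => {}x x0.
rewrite ger0_norm; last by have := onem_cos_le_sqr x0; lra.
apply: le_trans (cos_taylor2_le x0) _.
by rewrite ler_piMr ?exprn_ge0//; lra.
Qed.

Lemma norm_sin_sub_le x : `|sin x - x| <= 2 * `|x|.
Proof.
rewrite (le_trans (ler_normB _ _))//.
by have := sin_norm x; lra.
Qed.

Lemma norm_sin_sub_le3 x : `|sin x - x| <= `|x| ^+ 3.
Proof.
wlog x0 : x / 0 <= x => [hw|].
  have [/hw//|/ltW x0] := leP 0 x.
  have := hw (- x); rewrite oppr_ge0 => /(_ x0).
  by rewrite sinN normrN -opprD normrN.
rewrite distrC (ger0_norm x0) ger0_norm ?subr_ge0 ?sin_le_id//.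
apply: le_trans (id_sub_sin_le3 x0) _.
by rewrite ler_piMr ?exprn_ge0//; lra.
Qed.

End trig_ineq.

Lemma measurable_fun_inv (R : realType) :
  measurable_fun setT (fun x : R => x^-1).
Proof.
have -> : [set: R] = [set x | x != 0] `|` [set 0].
  by apply/esym/seteqP; split => x // _; have [->|x0] := eqVneq x 0; [right|left].
have o0 : open [set x : R | x != 0] by exact: open_neq.
apply/measurable_funU => //; first exact: open_measurable.
split; last exact: measurable_fun_set1.
apply: open_continuous_measurable_fun => // x.
by rewrite inE /= => x0; exact: inv_continuous.
Qed.

(** * Dilation of Lebesgue measure *)

Section scaling.
Context {R : realType}.
Notation mu := (@lebesgue_measure R).

(** Uniqueness of Lebesgue measure: the rescaled push-forward is a measure that gives half-open
    intervals their length. *)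
Lemma lebesgue_measure_scale (x : R) (A : set R) : 0 < x -> measurable A ->
  mu A = (x%:E * pushforward mu (( *%R x) : _ -> measurableTypeR R) A)%E.
Proof.
move=> x0 mA.
have mx : measurable_fun setT (( *%R x) : _ -> measurableTypeR R).
  exact: measurable_funM.
pose nu := measure_function_pushforward__canonical__measure_function_Measure mu mx.
have x0' : 0 <= x by exact: ltW.
transitivity (mscale (NngNum x0') nu A); last by [].
apply: lebesgue_measure_unique => // _ [[a b]] _ <-.
rewrite /mscale/= /pushforward.
rewrite /mscale/= /pushforward (_ : _ @^-1` _ = `]x^-1 * a, x^-1 * b]%classic); last first.
  apply/seteqP; split => y /=; rewrite !in_itv/= !(ler_pdivlMl, ltr_pdivrMl)//.
rewrite !lebesgue_measure_itv/= !lte_fin ltr_pM2l ?invr_gt0//.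
case: ifPn => _; last by rewrite mule0.
by rewrite -!EFinB -EFinM -mulrBr mulVKf// gt_eqF.
Qed.

Lemma ge0_integral_scale (f : R -> \bar R) (x : R) : 0 < x ->
  measurable_fun setT f -> (forall y, 0 <= f y)%E ->
  (\int[mu]_y f y = x%:E * \int[mu]_y f (x * y)%R)%E.
Proof.
move=> x0 mf f0.
have mx : measurable_fun setT (( *%R x) : _ -> measurableTypeR R).
  exact: measurable_funM.
pose nu := measure_function_pushforward__canonical__measure_function_Measure mu mx.
have x0' : 0 <= x by exact: ltW.
rewrite (eq_measure_integral (mscale (NngNum x0') nu)); last first.
  by move=> A mA _; rewrite /mscale/= (lebesgue_measure_scale x0).
rewrite ge0_integral_mscale//=.
congr (_ * _)%E.
by rewrite ge0_integral_pushforward.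
Qed.

End scaling.

Lemma measurable_cos (R : realType) : measurable_fun setT (@cos R).
Proof. by apply: continuous_measurable_fun; exact: continuous_cos. Qed.

Lemma measurable_sin (R : realType) : measurable_fun setT (@sin R).
Proof. by apply: continuous_measurable_fun; exact: continuous_sin. Qed.

(** * Domination by the weight 1 / (1 + x^2) *)

Section cauchy_weight.
Context {R : realType}.
Notation mu := (@lebesgue_measure R).

Lemma measurable_oneDsqrV : measurable_fun setT (fun x : R => (1 + x ^+ 2)^-1).
Proof.
by apply: continuous_measurable_fun; exact: continuous_oneDsqrV.
Qed.

Lemma integrable_oneDsqrV : mu.-integrable setT (fun x : R => ((1 + x ^+ 2)^-1)%:E).
Proof.
apply/integrableP; split; first by apply/measurable_EFinP; exact: measurable_oneDsqrV.
under eq_integral.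
  move=> x _; rewrite gee0_abs ?lee_fin ?invr_ge0 ?addr_ge0 ?sqr_ge0//.
  over.
rewrite (ge0_symfun_integralT (f := fun x => (1 + x ^+ 2)^-1)).
- by rewrite -set_itvcy integral0y_oneDsqr ltry.
- by move=> x; rewrite invr_ge0 addr_ge0 ?sqr_ge0.
- exact: continuous_oneDsqrV.
- by move=> x /=; rewrite sqrrN.
Qed.

(** The constant pi, kept abstract: it enters only as a factor of error bounds. *)
Definition cauchy_mass : R := \int[mu]_x (1 + x ^+ 2)^-1.

Lemma integrable_cauchy_dom (h : R -> R) (C : R) : measurable_fun setT h ->
  (forall x, `|h x| <= C / (1 + x ^+ 2)) -> mu.-integrable setT (EFin \o h).
Proof.
move=> mh hC.
apply: (@le_integrable _ _ _ mu setT _ _ (fun x => (C%:E * ((1 + x ^+ 2)^-1)%:E)%E)) => //.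
- exact/measurable_EFinP.
- by move=> x _; rewrite -EFinM !abse_EFin lee_fin (le_trans (hC x))// ler_norm.
- exact/integrableZl/integrable_oneDsqrV.
Qed.

Lemma norm_Rintegral_cauchy_dom (h : R -> R) (C : R) : measurable_fun setT h ->
  (forall x, `|h x| <= C / (1 + x ^+ 2)) ->
  `|\int[mu]_x h x| <= C * cauchy_mass.
Proof.
move=> mh hC; have ih := integrable_cauchy_dom mh hC.
rewrite (le_trans (le_normr_Rintegral _ ih))// /cauchy_mass -RintegralZl//.
  apply: le_Rintegral => //; first exact: integrable_norm.
  exact: (integrableZl measurableT C integrable_oneDsqrV).
exact: integrable_oneDsqrV.
Qed.

End cauchy_weight.

(** * The absolute value as a superposition of cosines *)

Section abs_rep.
Context {R : realType}.
Notation mu := (@lebesgue_measure R).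

(* |x| is, up to the factor [abs_mass], the integral of (1 - cos (t x)) / t^2;
   the value of the constant is never needed. *)
Definition abs_kernel (x t : R) := (1 - cos (t * x)) / t ^+ 2.

Lemma measurable_abs_kernel x : measurable_fun setT (abs_kernel x).
Proof.
apply: measurable_funM.
  apply: measurable_funB => //; apply: measurableT_comp => //; last exact: measurable_funM.
  exact: measurable_cos.
by apply: (measurableT_comp (@measurable_fun_inv R)); exact: measurable_funX.
Qed.

Lemma abs_kernel_ge0 x t : 0 <= abs_kernel x t.
Proof. by rewrite divr_ge0 ?sqr_ge0// subr_ge0 cos_le1. Qed.

(** The two summands of the constant bound the two parts of (1 + t^2) times the kernel: [x ^+ 2 / 2]
    bounds the kernel itself, and 2 bounds 1 - cos, which is t^2 times the kernel. *)
Lemma abs_kernel_dom x t : `|abs_kernel x t| <= (2 + x ^+ 2 / 2) / (1 + t ^+ 2).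
Proof.
rewrite ger0_norm ?abs_kernel_ge0// ler_pdivlMr ?ltr_pwDl ?sqr_ge0//.
(* At t = 0 the kernel has the value 0, since the inverse of 0 is 0, and not its limit x^2 / 2. *)
have [->|t0] := eqVneq t 0.
  by rewrite /abs_kernel expr0n/= invr0 mulr0 mul0r addr_ge0// divr_ge0// sqr_ge0.
rewrite mulrDr mulr1 /abs_kernel mulfVK ?sqrf_eq0// addrC lerD//.
  by have := cos_geN1 (t * x); lra.
rewrite ler_pdivrMr ?exprn_even_gt0//.
have := norm_cos_sub1_le_sqr (t * x).
rewrite distrC => /(le_trans (ler_norm _)) /le_trans; apply.
by rewrite le_eqVlt; apply/orP; left; apply/eqP; field.
Qed.

Lemma integrable_abs_kernel x : mu.-integrable setT (EFin \o abs_kernel x).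
Proof.
apply: (integrable_cauchy_dom (C := 2 + x ^+ 2 / 2)).
  exact: measurable_abs_kernel.
exact: abs_kernel_dom.
Qed.

Definition abs_mass : R := \int[mu]_t abs_kernel 1 t.

(** On [pi/2, pi] the cosine is nonpositive, so the nonnegative integrand is at least 1 / pi^2
    there. *)
Lemma abs_mass_gt0 : 0 < abs_mass.
Proof.
rewrite /abs_mass -lte_fin /Rintegral fineK; last first.
  exact: integrable_fin_num (integrable_abs_kernel 1).
have p0 := @pi_gt0 R.
apply: (@lt_le_trans _ _ (\int[mu]_(t in `[(pi / 2)%R, (pi : R)%R]) ((pi ^-2 : R)%:E))%E).
  rewrite integral_cst//= lebesgue_measure_itv/= lte_fin.
  rewrite (_ : pi / 2 < pi) ?ltr_pdivrMr ?ltr_pMr ?ltr1n//.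
  rewrite -EFinB -EFinM lte_fin mulr_gt0// ?invr_gt0 ?exprn_gt0//.
  by rewrite subr_gt0 ltr_pdivrMr ?ltr_pMr ?ltr1n.
rewrite [leLHS]integral_mkcond.
apply: ge0_le_integral.
- by [].
- by move=> t _; apply: erestrict_ge0 => s _; rewrite lee_fin invr_ge0 exprn_ge0// ltW.
- apply/(measurable_restrictT _ _).1 => //.
- by apply/measurable_EFinP; exact: measurable_abs_kernel.
move=> t _; rewrite patchE; case: ifPn => [|_]; last by rewrite lee_fin abs_kernel_ge0.
rewrite inE/= in_itv/= => /andP[t1 t2]; rewrite lee_fin /abs_kernel mulr1.
have t0 : 0 < t by rewrite (lt_le_trans _ t1)// divr_gt0.
rewrite -[leLHS]mul1r ler_pM ?invr_ge0 ?exprn_ge0 ?(ltW p0)//.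
  rewrite lerBrDr -lerBrDl subrr.
  rewrite -(subrK (pi / 2) t) cosD cos_pihalf sin_pihalf mulr0 mulr1 add0r -sinN opprB.
  have -> : pi / 2 - t = - (t - pi / 2) by lra.
  rewrite sinN oppr_le0 sin_ge0_pi//; apply/andP; split; lra.
rewrite lef_pV2 ?posrE ?exprn_gt0// lerXn2r// nnegrE ltW//.
Qed.

(** The kernel is even in x, and for x > 0 it equals x^2 times [abs_kernel 1] at the point x t; the
    dilation t -> x t takes back one factor x. *)
Lemma integral_abs_kernel (x : R) : \int[mu]_t abs_kernel x t = `|x| * abs_mass.
Proof.
have -> : abs_kernel x = abs_kernel `|x|.
  by apply/funext => t; rewrite /abs_kernel -[in LHS]cos_norm -[in RHS]cos_norm !normrM normr_id.
have [->|x0] := eqVneq x 0.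
  rewrite normr0 mul0r /abs_kernel.
  under eq_Rintegral do rewrite mulr0 cos0 subrr mul0r.
  by rewrite /Rintegral integral0.
have {}x0 : 0 < `|x| by rewrite normr_gt0.
move: `|x| x0 => {}x x0.
have := @ge0_integral_scale R (EFin \o abs_kernel 1) x x0.
have mk : measurable_fun setT (EFin \o abs_kernel 1).
  by apply/measurable_EFinP; exact: measurable_abs_kernel.
move=> /(_ mk (fun t => abs_kernel_ge0 1 t)) /= H.
rewrite /abs_mass /Rintegral H.
rewrite [X in (x%:E * X)%E](_ : _ = ((x ^-2)%:E * \int[mu]_t (abs_kernel x t)%:E)%E); last first.
  rewrite -integralZl//; last exact: integrable_abs_kernel.
  apply: eq_integral => t _; rewrite -EFinM; congr EFin.
  rewrite /abs_kernel mulr1 [t * x]mulrC exprMn invfM; ring.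
have /fineK <- := integrable_fin_num measurableT (integrable_abs_kernel x).
rewrite -!EFinM/=; field.
by rewrite gt_eqF.
Qed.

End abs_rep.

Lemma Rintegral_prob_cst {R : realType} {d : measure_display}
  {T : measurableType d} (m : probability T R) (r : R) : \int[m]_w r = r.
Proof. by rewrite Rintegral_cst//= probability_setT/= mulr1. Qed.

(** * Exchanging an expectation with a cosine integral *)

Section fubini_cos.
Context {R : realType} {d : measure_display} {T : measurableType d}.
Notation mu := (@lebesgue_measure R).
Variables (m : probability T R) (Y : T -> R) (g : R -> R).
Hypothesis mY : measurable_fun setT Y.
Hypothesis mg : measurable_fun setT g.
Hypothesis ig : mu.-integrable setT (EFin \o g).

Lemma integrable_prob_bounded (h : T -> R) (C : R) : measurable_fun setT h ->
  (forall w, `|h w| <= C) -> m.-integrable setT (EFin \o h).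
Proof.
move=> mh hC; apply: (@le_integrable _ _ _ m setT _ _ (cst C%:E)) => //.
- exact/measurable_EFinP.
- by move=> w _; rewrite /= lee_fin (le_trans (hC w))// ler_norm.
- apply/integrableP; split; first exact: measurable_cst.
  by rewrite integral_cst//= probability_setT mule1 ltry.
Qed.

Lemma norm_Rintegral_prob (h : T -> R) (C : R) : measurable_fun setT h ->
  (forall w, `|h w| <= C) -> `|\int[m]_w h w| <= C.
Proof.
move=> mh hC; have ih := integrable_prob_bounded mh hC.
rewrite (le_trans (le_normr_Rintegral _ ih))//.
rewrite -[leRHS]mulr1 -[X in _ * X](_ : fine (m setT) = 1); last by rewrite probability_setT.
rewrite -Rintegral_cst//; apply: le_Rintegral => //; first exact: integrable_norm.
by apply: integrable_prob_bounded => // w; exact: (ler_norm C).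
Qed.

Lemma measurable_cos_comp (t : R) : measurable_fun setT (fun w => cos (t * Y w)).
Proof.
apply: (measurableT_comp (@measurable_cos R)); exact: measurable_funM.
Qed.

Lemma measurable_sin_comp (t : R) : measurable_fun setT (fun w => sin (t * Y w)).
Proof.
apply: (measurableT_comp (@measurable_sin R)); exact: measurable_funM.
Qed.

Let F (z : T * measurableTypeR R) : \bar R := (g z.2 * cos (z.2 * Y z.1))%:E.

Let mF : measurable_fun setT F.
Proof.
apply/measurable_EFinP; apply: measurable_funM.
  exact: (measurableT_comp mg).
apply: (measurableT_comp (@measurable_cos R)); apply: measurable_funM => //.
exact: (measurableT_comp mY).
Qed.

Let iF : (m \x mu)%E.-integrable setT F.
Proof.
apply/integrable12ltyP => //.
apply: (@le_lt_trans _ _ (\int[m]_x \int[mu]_y `|(g y)%:E|)%E).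
  apply: ge0_le_integral => //.
  - by move=> x _; exact: integral_ge0.
  - have := @measurable_fun_fubini_tonelli_F _ _ _ _ R mu (abse \o F).
    apply; first exact: measurableT_comp.
    by move=> ?; exact: abse_ge0.
  - move=> x _; apply: ge0_le_integral => //.
    + apply: measurableT_comp => //.
      exact: (measurableT_comp mF (measurable_pair1 x)).
    + apply: measurableT_comp => //; exact/measurable_EFinP.
    + move=> y _; rewrite lee_fin normrM ler_piMr//; exact: cos_max.
rewrite integral_cst//= probability_setT mule1.
by case/integrableP : ig.
Qed.

Lemma measurable_char_cos : measurable_fun setT (fun t : R => \int[m]_w cos (t * Y w)).
Proof.
(* Adding 1 makes the integrand nonnegative, as Tonelli measurability requires; since [m] has mass
   1, the addition is undone by subtracting 1. *)
pose G (z : T * measurableTypeR R) : \bar R := (1 + cos (z.2 * Y z.1))%:E.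
have mG : measurable_fun setT G.
  apply/measurable_EFinP; apply: measurable_funD => //.
  apply: (measurableT_comp (@measurable_cos R)); apply: measurable_funM => //.
  exact: (measurableT_comp mY).
have G0 z : (0 <= G z)%E.
  by rewrite lee_fin; have := cos_geN1 (z.2 * Y z.1); lra.
have := @measurable_fun_fubini_tonelli_G _ _ _ _ _ m G mG G0.
move=> mG'.
have : measurable_fun setT (fun t => fine (fubini_G m G t) - 1).
  by apply: measurable_funB => //; exact: (measurableT_comp (fine_measurable _) mG').
apply: eq_measurable_fun => t _.
rewrite /= /fubini_G /G/= -/(Rintegral _ _ _) RintegralD//.
- by rewrite Rintegral_prob_cst addrC addKr.
- by apply: (integrable_prob_bounded (C := 1)) => // w; rewrite normr1.
- by apply: integrable_prob_bounded => [|w]; [exact: measurable_cos_comp|exact: cos_max].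
Qed.

(** This is how the expectation of a test function comes to depend on the law of [Y] only through
    its characteristic function. *)
Lemma fubini_cos : \int[m]_w \int[mu]_t (g t * cos (t * Y w)) =
  \int[mu]_t (g t * \int[m]_w cos (t * Y w)).
Proof.
rewrite /Rintegral; congr fine.
transitivity (\int[m]_w \int[mu]_t F (w, t))%E.
  apply: eq_integral => w _; rewrite fineK//.
  apply: (integrable_fin_num measurableT).
  apply: (le_integrable measurableT _ _ ig).
    exact: (measurableT_comp mF (measurable_pair1 w)).
  by move=> t _; rewrite lee_fin normrM ler_piMr//; exact: cos_max.
rewrite (Fubini iF); apply: eq_integral => t _.
rewrite /F /= EFinM fineK; last first.
  apply: (integrable_fin_num measurableT).
  by apply: integrable_prob_bounded => [|w]; [exact: measurable_cos_comp|exact: cos_max].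
under eq_integral do rewrite EFinM.
rewrite integralZl//.
by apply: integrable_prob_bounded => [|w]; [exact: measurable_cos_comp|exact: cos_max].
Qed.

End fubini_cos.

Lemma is_derive_sin_affine (R : realType) (a b u : R) :
  is_derive u 1 (fun v : R => sin (a + b * v)) (b * cos (a + b * u)).
Proof.
have H : is_derive u 1 (fun v : R => a + b * v) b.
  by apply: is_derive_eq; rewrite /GRing.scale/=; ring.
have := @is_derive1_comp R (@sin R) (fun v : R => a + b * v) u _ _ (is_derive_sin _) H.
by rewrite mulrC.
Qed.

Lemma continuous_affine (R : realType) (a b : R) : continuous (fun v : R => a + b * v).
Proof. by move=> v; apply: cvgD; [exact: cvg_cst|apply: cvgMr]. Qed.

(** * Functions given by a decaying cosine transform *)

Section cos_rep.
Context {R : realType}.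
Notation mu := (@lebesgue_measure R).

(* g decays like |t|^(- k - 2); averaging f over a uniform law ([avg]) gains one
   power of t. *)
Definition cos_rep (k : nat) (f g : R -> R) (C : R) :=
  [/\ measurable_fun setT g,
      forall t, `|g t| * (1 + `|t|) ^+ k <= C / (1 + t ^+ 2) &
      forall x, f x = \int[mu]_t (g t * cos (t * x))].

Lemma cos_rep_dom k f g C : cos_rep k f g C -> forall t, `|g t| <= C / (1 + t ^+ 2).
Proof.
move=> [_ gC _] t; apply: le_trans (gC t); rewrite ler_peMr//.
by rewrite exprn_ege1// lerDl.
Qed.

Lemma cos_rep_integrable k f g C : cos_rep k f g C -> mu.-integrable setT (EFin \o g).
Proof.
move=> fg; have [mg _ _] := fg.
exact: (integrable_cauchy_dom mg (cos_rep_dom fg)).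
Qed.

Definition avg (h : R) (f : R -> R) (x : R) : R :=
  \int[uniform_prob (@gtrN R 1 ltr01)]_u f (x + h * u).

Definition sinc (x : R) := if x == 0 then 1 else sin x / x.

Lemma measurable_sinc : measurable_fun setT sinc.
Proof.
apply: measurable_fun_ifT => //.
  by apply: measurable_fun_eqr.
apply: measurable_funM; first exact: measurable_sin.
exact: measurable_fun_inv.
Qed.

(** The decay gained by one averaging: |sinc| <= 1 takes care of the summand 1, and |sin| <= 1
    leaves [h^-1] for the summand |t|. *)
Lemma sinc_bound (h t : R) : 0 < h -> `|sinc (t * h)| * (1 + `|t|) <= 1 + h^-1.
Proof.
move=> h0; rewrite /sinc; case: ifPn => [|th0].
  rewrite mulf_eq0 (gt_eqF h0) orbF => /eqP ->.
  by rewrite normr0 normr1 addr0 mulr1 lerDl invr_ge0 ltW.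
rewrite mulrDr mulr1 normrM normfV lerD//.
  by rewrite ler_pdivrMr ?normr_gt0// mul1r sin_norm.
rewrite normrM (gtr0_norm h0) -mulrA invfM mulrAC mulVf; last first.
  by rewrite normr_eq0; apply: contraNneq th0 => ->; rewrite mul0r.
by rewrite mul1r ler_piMl ?invr_ge0 ?(ltW h0)// sin_max.
Qed.

Lemma avg_cos (h t x : R) :
  avg h (fun x => cos (t * x)) x = sinc (t * h) * cos (t * x).
Proof.
rewrite /avg.
have mc : measurable_fun setT (fun u : measurableTypeR R => cos (t * (x + h * u))).
  apply: (measurableT_comp (@measurable_cos R)); apply: measurable_funM => //.
  by apply: measurable_funD => //; exact: measurable_funM.
have [th0|th0] := eqVneq (t * h) 0.
  rewrite /sinc th0 eqxx mul1r.
  under eq_Rintegral do rewrite mulrDr mulrA th0 mul0r addr0.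
  by rewrite Rintegral_prob_cst.
have ic : (uniform_prob (@gtrN R 1 ltr01)).-integrable setT
    (EFin \o (fun u : R => cos (t * (x + h * u)))).
  by apply: (integrable_prob_bounded _ mc) => u; exact: cos_max.
move: ic mc.
under eq_fun do rewrite mulrDr mulrA.
move: (t * x) (t * h) th0 => {x t h} a b b0 ic mc.
(* The formula for integrals under the uniform law is for nonnegative integrands, hence the added 1;
   [F] is an antiderivative of [f]. *)
pose f u : R := 1 + cos (a + b * u).
pose F u : R := u + sin (a + b * u) / b.
have dF (u : R) : is_derive u 1 F (f u).
  have := is_derive_sin_affine a b u => H.
  by apply: is_derive_eq; rewrite /f !scaler0 /GRing.scale/=; field.
have E : \int[uniform_prob (@gtrN R 1 ltr01)]_u f u =
    1 + \int[uniform_prob (@gtrN R 1 ltr01)]_u cos (a + b * u).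
  rewrite RintegralD//; last first.
    by apply: (integrable_prob_bounded _ (C := 1)) => // w; rewrite normr1.
  by rewrite Rintegral_prob_cst.
rewrite -[LHS](addKr 1) -E /Rintegral integral_uniform; last 2 first.
  by apply/measurable_EFinP; exact: measurable_funD.
  by move=> u; rewrite lee_fin /f; have := cos_geN1 (a + b * u); lra.
rewrite (@continuous_FTC2 _ f F).
- rewrite -EFinB -EFinM/= /F /sinc (negbTE b0) mulr1 mulrN1.
  rewrite sinD sinB.
  by field.
- by rewrite gtrN.
- apply: continuous_subspaceT => u; apply: cvgD; first exact: cvg_cst.
  by apply: continuous_comp; [exact: continuous_affine|exact: continuous_cos].
- split => [u _||].
  + by have [] := dF u.
  + by apply: cvg_at_right_filter; apply: differentiable_continuous; apply/derivable1_diffP; have [] := dF (-1).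
  + by apply: cvg_at_left_filter; apply: differentiable_continuous; apply/derivable1_diffP; have [] := dF 1.
- by move=> u _; rewrite derive1E; have [_ ->] := dF u.
Qed.

(** Averaging multiplies each cosine of frequency t by [sinc (t * h)], so by Fubini it multiplies
    the transform by the same factor. *)
Lemma cos_rep_avg k f g C h : 0 < h -> cos_rep k f g C ->
  cos_rep k.+1 (avg h f) (fun t => g t * sinc (t * h)) (C * (1 + h^-1)).
Proof.
move=> h0 fg; have [mg gC fE] := fg; split.
- apply: measurable_funM => //.
  by apply: (measurableT_comp measurable_sinc); exact: measurable_funM.
- move=> t; rewrite normrM exprS.
  rewrite [leLHS](_ : _ = (`|g t| * (1 + `|t|) ^+ k) * (`|sinc (t * h)| * (1 + `|t|))); last by ring.
  rewrite [leRHS](_ : _ = (C / (1 + t ^+ 2)) * (1 + h^-1)); last by ring.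
  by rewrite ler_pM ?mulr_ge0 ?exprn_ge0 ?addr_ge0// sinc_bound.
move=> x; rewrite /avg.
under eq_Rintegral do rewrite fE.
rewrite (@fubini_cos R _ _ (uniform_prob (@gtrN R 1 ltr01)) (fun u => x + h * u) g) //; last 2 first.
  by apply: measurable_funD => //; exact: measurable_funM.
  exact: cos_rep_integrable fg.
by apply: eq_Rintegral => t _; rewrite -[in RHS]mulrA -avg_cos.
Qed.

End cos_rep.

(** * Smoothed indicators of symmetric intervals *)

Section plateau.
Context {R : realType}.
Notation mu := (@lebesgue_measure R).

(** For 0 <= a < b this is the even trapezoid, equal to 1 on [-a, a], to 0 outside [-b, b] and
    linear in between. It is written with absolute values so that [integral_abs_kernel] yields its
    transform. *)
Definition trap (a b x : R) : R :=
  (`|x + b| + `|x - b| - `|x + a| - `|x - a|) / (2 * (b - a)).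

(** Since cos(t(x+b)) + cos(t(x-b)) = 2 cos(tx) cos(tb), the combination of the four kernels has
    cos(tx) as a factor, and what remains is the transform. *)
Lemma cos_rep_trap (a b : R) : a < b -> cos_rep 0 (trap a b)
  (fun t => (abs_kernel b t - abs_kernel a t) / (abs_mass * (b - a)))
  ((4 + (a ^+ 2 + b ^+ 2) / 2) / (abs_mass * (b - a))).
Proof.
move=> ab.
have c0 := @abs_mass_gt0 R.
have D0 : 0 < abs_mass * (b - a) by rewrite mulr_gt0// subr_gt0.
split.
- apply: measurable_funM => //.
  by apply: measurable_funB; exact: measurable_abs_kernel.
- move=> t; rewrite expr0 mulr1 normrM normfV (gtr0_norm D0).
  rewrite [leRHS]mulrAC ler_pM2r ?invr_gt0//.
  rewrite (le_trans (ler_normB _ _))// (le_trans (lerD (abs_kernel_dom _ _) (abs_kernel_dom _ _)))//.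
  by rewrite -mulrDl ler_pM2r ?invr_gt0 ?ltr_pwDl ?sqr_ge0//; lra.
move=> x; rewrite /trap.
have iK y : mu.-integrable setT (EFin \o abs_kernel y) := integrable_abs_kernel y.
have E : (`|x + b| + `|x - b| - `|x + a| - `|x - a|) * abs_mass =
  \int[mu]_t (abs_kernel (x + b) t + abs_kernel (x - b) t
     - abs_kernel (x + a) t - abs_kernel (x - a) t).
  rewrite RintegralB//; last exact: (integrableB measurableT (integrableD measurableT (iK _) (iK _)) (iK _)).
  rewrite RintegralB//; last exact: (integrableD measurableT (iK _) (iK _)).
  by rewrite RintegralD// !integral_abs_kernel -!mulrDl -!mulrBl.
rewrite (_ : _ / _ = (2 * (abs_mass * (b - a)))^-1 *
   ((`|x + b| + `|x - b| - `|x + a| - `|x - a|) * abs_mass)); last first.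
  by field; rewrite subr_eq0 !gt_eqF.
rewrite E -RintegralZl//; last first.
  exact: (integrableB measurableT (integrableB measurableT (integrableD measurableT (iK _) (iK _)) (iK _)) (iK _)).
apply: eq_Rintegral => t _.
rewrite /abs_kernel !(mulrDr t) !mulrN !cosD !cosN !sinN.
have [->|t0] := eqVneq t 0; first by rewrite expr0n/= invr0; ring.
by field; rewrite t0 subr_eq0 !gt_eqF.
Qed.

Definition plateau k (a b : R) (f : R -> R) :=
  [/\ exists g C, cos_rep k f g C, measurable_fun setT f,
      forall x, 0 <= f x <= 1,
      forall x, `|x| <= a -> f x = 1 &
      forall x, b <= `|x| -> f x = 0].

Lemma plateau_trap (a b : R) : 0 <= a < b -> plateau 0 a b (trap a b).
Proof.
move=> /andP[a0 ab].
have D0 : 0 < 2 * (b - a) by rewrite mulr_gt0// subr_gt0.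
split.
- by do 2 eexists; exact: cos_rep_trap.
- apply: measurable_funM => //.
  by do 3?[apply: measurable_funB|apply: measurable_funD]; apply: (measurableT_comp (@normr_measurable _ _)); apply: measurable_funD.
- move=> x; rewrite /trap divr_ge0 ?(ltW D0)//= ?ler_pdivrMr ?mul1r//.
    have [x0|x0] := leP 0 x.
      rewrite (@ger0_norm _ (x + b)); last lra.
      rewrite (@ger0_norm _ (x + a)); last lra.
      by case: (ler0P (x - b)); case: (ler0P (x - a)); lra.
    rewrite (@ler0_norm _ (x - b)); last lra.
    rewrite (@ler0_norm _ (x - a)); last lra.
    by case: (ler0P (x + b)); case: (ler0P (x + a)); lra.
  have [x0|x0] := leP 0 x.
    rewrite (@ger0_norm _ (x + b)); last lra.
    rewrite (@ger0_norm _ (x + a)); last lra.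
    by case: (ler0P (x - b)); case: (ler0P (x - a)); lra.
  rewrite (@ler0_norm _ (x - b)); last lra.
  rewrite (@ler0_norm _ (x - a)); last lra.
  by case: (ler0P (x + b)); case: (ler0P (x + a)); lra.
- move=> x; rewrite ler_norml => /andP[xa1 xa2]; rewrite /trap.
  apply/eqP; rewrite eq_sym -subr_eq0; apply/eqP.
  rewrite ger0_norm; last lra.
  rewrite ler0_norm; last lra.
  rewrite ger0_norm; last lra.
  rewrite ler0_norm; last lra.
  by field; rewrite subr_eq0 gt_eqF.
- move=> x; rewrite ler_normr /trap => bx.
  apply/eqP; rewrite mulf_eq0; apply/orP; left; apply/eqP.
  by case/orP: bx => bx; [rewrite !ger0_norm; lra|rewrite !ler0_norm; lra].
Qed.

Lemma plateau_avg k (a b h : R) f : 0 < h -> plateau k a b f ->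
  plateau k.+1 (a - h) (b + h) (avg h f).
Proof.
move=> h0 [[g [C fg]] mf f01 fa fb].
have mfu x : measurable_fun setT (fun u : measurableTypeR R => f (x + h * u)).
  by apply: (measurableT_comp mf); apply: measurable_funD => //; exact: measurable_funM.
have fnorm x : `|f x| <= 1 by have /andP[f0 f1] := f01 x; rewrite ger0_norm.
have ae1 : forall (c : R) x, (forall u, `|u| <= 1 -> f (x + h * u) = c) -> avg h f x = c.
  move=> c x H; rewrite /avg /Rintegral.
  rewrite integral_uniform; last 2 first.
    exact/measurable_EFinP.
    by move=> u; rewrite lee_fin; have /andP[] := f01 (x + h * u).
  rewrite (eq_integral (cst c%:E)); last first.
    by move=> u; rewrite inE/= in_itv/= -ler_norml => /H ->.
  rewrite integral_cst//= lebesgue_measure_itv/= lte_fin gtrN// -EFinB -!EFinM/=.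
  by field.
split.
- by do 2 eexists; exact: cos_rep_avg fg.
- pose F (z : measurableTypeR R * measurableTypeR R) : \bar R := (f (z.1 + h * z.2))%:E.
  have mF : measurable_fun setT F.
    apply/measurable_EFinP; apply: (measurableT_comp mf).
    by apply: measurable_funD => //; exact: measurable_funM.
  have F0 z : (0 <= F z)%E by rewrite lee_fin; have /andP[] := f01 (z.1 + h * z.2).
  have := @measurable_fun_fubini_tonelli_F _ _ _ _ _ (uniform_prob (@gtrN R 1 ltr01)) F mF F0.
  exact: (measurableT_comp (fine_measurable _)).
- move=> x; apply/andP; split.
    by apply: Rintegral_ge0 => u _; have /andP[] := f01 (x + h * u).
  by apply: le_trans (ler_norm _) _; exact: norm_Rintegral_prob.
- move=> x xa; apply: ae1 => u u1; apply: fa.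
  rewrite (le_trans (ler_normD _ _))// -lerBrDr (le_trans xa)// lerD2l lerN2.
  by rewrite normrM (gtr0_norm h0) ler_piMr// ltW.
- move=> x xb; apply: ae1 => u u1; apply: fb.
  have : `|h * u| <= h by rewrite normrM (gtr0_norm h0) ler_piMr// ltW.
  have := ler_normB (x + h * u) (h * u); rewrite addrK; lra.
Qed.

Lemma plateau_exists (a b : R) : 0 <= a < b -> exists f, plateau 3 a b f.
Proof.
move=> /andP[a0 ab].
(* Three averagings cost 3h on either side; the trapezoid between a + 3h and b - 3h still has half
   of the gap b - a for its slope. *)
pose h := (b - a) / 12.
have h0 : 0 < h by rewrite divr_gt0// subr_gt0.
have /plateau_trap/(plateau_avg h0)/(plateau_avg h0)/(plateau_avg h0) : 0 <= a + h + h + h < b - h - h - h.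
  by apply/andP; split; rewrite /h in h0 *; lra.
by rewrite !addrK !subrK; eexists; eassumption.
Qed.

End plateau.

(** * From characteristic functions to expectations of test functions *)

Section compare.
Context {R : realType} {d1 d2 : measure_display}
  {T1 : measurableType d1} {T2 : measurableType d2}.
Notation mu := (@lebesgue_measure R).
Variables (m1 : probability T1 R) (m2 : probability T2 R).
Variables (Y1 : T1 -> R) (Y2 : T2 -> R).
Hypothesis mY1 : measurable_fun setT Y1.
Hypothesis mY2 : measurable_fun setT Y2.

Lemma Rintegral_cos_shift {d} {T : measurableType d} (m : probability T R)
  (Y : T -> R) (c t : R) : measurable_fun setT Y ->
  \int[m]_w cos (t * (Y w - c)) =
  cos (t * c) * \int[m]_w cos (t * Y w) + sin (t * c) * \int[m]_w sin (t * Y w).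
Proof.
move=> mY.
have ic : m.-integrable setT (EFin \o (fun w => cos (t * Y w))).
  by apply: integrable_prob_bounded => [|w]; [exact: measurable_cos_comp|exact: cos_max].
have isn : m.-integrable setT (EFin \o (fun w => sin (t * Y w))).
  by apply: integrable_prob_bounded => [|w]; [exact: measurable_sin_comp|exact: sin_max].
rewrite -!RintegralZl// -RintegralD//; last 2 first.
  exact: (integrableZl measurableT _ ic).
  exact: (integrableZl measurableT _ isn).
apply: eq_Rintegral => w _; rewrite mulrBr cosB; ring.
Qed.

(** The shift by [c] mixes the cosine and sine parts, so both differences are assumed small. Decay
    of order 3 in [cos_rep] absorbs the cubic growth of the error and leaves an integrable Cauchy
    weight. *)
Lemma cos_rep_compare f g C (c e : R) : cos_rep 3 f g C ->
  (forall t, `|\int[m1]_w cos (t * Y1 w) - \int[m2]_w cos (t * Y2 w)| +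
     `|\int[m1]_w sin (t * Y1 w) - \int[m2]_w sin (t * Y2 w)| <=
     e * (1 + `|t|) ^+ 3) ->
  `|\int[m1]_w f (Y1 w - c) - \int[m2]_w f (Y2 w - c)| <= (e * C) * cauchy_mass.
Proof.
move=> fg H; have [mg gC fE] := fg.
have mY1c : measurable_fun setT (fun w => Y1 w - c) by exact: measurable_funB.
have mY2c : measurable_fun setT (fun w => Y2 w - c) by exact: measurable_funB.
have ig := cos_rep_integrable fg.
pose A1 t := \int[m1]_w cos (t * (Y1 w - c)).
pose A2 t := \int[m2]_w cos (t * (Y2 w - c)).
have mA1 : measurable_fun setT A1 by exact: measurable_char_cos.
have mA2 : measurable_fun setT A2 by exact: measurable_char_cos.
have A1le t : `|A1 t| <= 1.
  by apply: norm_Rintegral_prob => [|w]; [exact: measurable_cos_comp|exact: cos_max].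
have A2le t : `|A2 t| <= 1.
  by apply: norm_Rintegral_prob => [|w]; [exact: measurable_cos_comp|exact: cos_max].
have iA (A : R -> R) : measurable_fun setT A -> (forall t, `|A t| <= 1) ->
    mu.-integrable setT (EFin \o (fun t => g t * A t)).
  move=> mA Ale; apply: (integrable_cauchy_dom (C := C)); first exact: measurable_funM.
  by move=> t; rewrite normrM (le_trans _ (cos_rep_dom fg t))// ler_piMr.
under eq_Rintegral do rewrite fE.
rewrite fubini_cos//.
under [X in _ - X]eq_Rintegral do rewrite fE.
rewrite fubini_cos// -RintegralB//; [|exact: iA mA1 _|exact: iA mA2 _].
apply: norm_Rintegral_cauchy_dom.
  by apply: measurable_funB; apply: measurable_funM.
move=> t; rewrite -mulrBr normrM.
apply: (@le_trans _ _ (`|g t| * (e * (1 + `|t|) ^+ 3))).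
  rewrite ler_wpM2l// -/(A1 t) -/(A2 t) /A1 /A2 !Rintegral_cos_shift//.
  apply: le_trans (H t).
  rewrite (_ : _ + _ - _ = cos (t * c) * (\int[m1]_w cos (t * Y1 w) - \int[m2]_w cos (t * Y2 w))
    + sin (t * c) * (\int[m1]_w sin (t * Y1 w) - \int[m2]_w sin (t * Y2 w))); last by ring.
  rewrite (le_trans (ler_normD _ _))// !normrM lerD//.
    by rewrite ler_piMl// cos_max.
  by rewrite ler_piMl// sin_max.
have e0 : 0 <= e.
  have := le_trans (addr_ge0 (normr_ge0 _) (normr_ge0 _)) (H 0).
  by rewrite normr0 addr0 expr1n mulr1.
by rewrite mulrCA -[leRHS]mulrA ler_wpM2l.
Qed.

End compare.

(** * Characteristic function and tails of the standard Gaussian law *)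

Section gaussian.
Context {R : realType}.
Notation mu := (@lebesgue_measure R).
Notation N := (@normal_prob R 0 1).
Notation p := (@normal_pdf R 0 1).

Lemma std_normal_pdfE x : p x = normal_peak 1 * expR (- (x ^+ 2 / 2)).
Proof.
rewrite /normal_pdf oner_eq0 /normal_fun subr0 expr1n.
by rewrite mulNr.
Qed.

Let mp : measurable_fun setT p := @measurable_normal_pdf R 0 1.
Let ip : mu.-integrable setT (EFin \o p) := integrable_normal_pdf 0 1.

Lemma Rintegral_normal_pdf : \int[mu]_x p x = 1.
Proof. by rewrite /Rintegral integral_normal_pdf. Qed.

(** The Radon-Nikodym derivative of the Gaussian law agrees almost everywhere with [normal_pdf], as
    both have the same integral over every measurable set. *)
Lemma Rintegral_normal_prob (f : R -> R) (C : R) : measurable_fun setT f ->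
  (forall x, `|f x| <= C) -> \int[N]_x f x = \int[mu]_x (f x * p x).
Proof.
move=> mf fC; rewrite /Rintegral; congr fine.
have iN := @integrable_prob_bounded R _ (measurableTypeR R) N f C mf fC.
have ND := @normal_prob_dominates R 0 1.
rewrite -(Radon_Nikodym_change_of_variables ND)//=.
apply: ae_eq_integral => //.
- apply: emeasurable_funM; first exact/measurable_EFinP.
  by apply: (measurable_int mu); exact: Radon_Nikodym_integrable.
- by apply/measurable_EFinP; exact: measurable_funM.
under [X in ae_eq _ _ _ X]eq_fun do rewrite EFinM.
apply: ae_eqe_mul2l => /=.
rewrite Radon_NikodymE//=.
case: cid => /= h [h1 h2 h3].
apply: (integral_ae_eq measurableT h2); first exact/measurable_EFinP.
by move=> E _ mE; rewrite -h3.
Qed.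

(** Square 1 + x^2/4 <= exp(x^2/4) and use 1 + x^2 <= 4 (1 + x^2/4). *)
Lemma expR_gauss_ub (x : R) : (1 + x ^+ 2) ^+ 2 * expR (- (x ^+ 2 / 2)) <= 16.
Proof.
rewrite expRN ler_pdivrMr ?expR_gt0//.
have x2 := sqr_ge0 x.
have h : 1 + x ^+ 2 / 4 <= expR (x ^+ 2 / 4) by exact: expR_ge1Dx.
have -> : expR (x ^+ 2 / 2) = expR (x ^+ 2 / 4) ^+ 2.
  by rewrite -expRM_natl; congr expR; field.
apply: (@le_trans _ _ (16 * (1 + x ^+ 2 / 4) ^+ 2)).
  by nra.
by rewrite ler_pM2l// lerXn2r// nnegrE ?expR_ge0// addr_ge0// divr_ge0.
Qed.

(** The factor 1 + |x| covers the first moment that appears on differentiating under the integral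
    sign. The constant is 2 * 16, the 2 coming from 1 + |x| <= 2 (1 + x^2). *)
Lemma normal_pdf_cauchy_dom (x : R) :
  (1 + `|x|) * p x <= 32 * normal_peak 1 / (1 + x ^+ 2).
Proof.
have x2 := sqr_ge0 x.
rewrite ler_pdivlMr ?ltr_pwDl// std_normal_pdfE.
have k0 := normal_peak_ge0 (1 : R).
rewrite [leLHS](_ : _ = normal_peak 1 * ((1 + `|x|) * (1 + x ^+ 2) * expR (- (x ^+ 2 / 2)))); last by ring.
rewrite mulrC ler_wpM2r//.
apply: le_trans (_ : 2 * 16 <= _); last by lra.
apply: le_trans (ler_wpM2l _ (expR_gauss_ub x)); last by [].
rewrite mulrA ler_wpM2r ?expR_ge0// expr2 mulrA ler_wpM2r ?addr_ge0//.
rewrite -expr2 -(real_normK (num_real x)); have := sqr_ge0 (`|x| - 1); nra.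
Qed.

(* H' = - t H, by integrating by parts; the phase phi treats cos and sin at
   once. *)
Section char_fun.
Variable phi : R.

Let k (t x : R) := cos (t * x - phi) * p x.
Let dk (t x : R) := - (x * sin (t * x - phi) * p x).
Let H (t : R) := \int[mu]_x k t x.

Let mcos t : measurable_fun setT (fun x : R => cos (t * x - phi)).
Proof.
apply: (measurableT_comp (@measurable_cos R)).
by apply: measurable_funB => //; exact: measurable_funM.
Qed.

Let msin t : measurable_fun setT (fun x : R => sin (t * x - phi)).
Proof.
apply: (measurableT_comp (@measurable_sin R)).
by apply: measurable_funB => //; exact: measurable_funM.
Qed.

Let p_ge0 x : 0 <= p x. Proof. exact: normal_pdf_ge0. Qed.

Let pdom (h : R -> R) : measurable_fun setT h ->
  (forall x, `|h x| <= (1 + `|x|) * p x) -> mu.-integrable setT (EFin \o h).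
Proof.
move=> mh hp; apply: (integrable_cauchy_dom mh (C := 32 * normal_peak 1)) => x.
exact: le_trans (hp x) (normal_pdf_cauchy_dom x).
Qed.

Let ik t : mu.-integrable setT (EFin \o k t).
Proof.
apply: pdom; first exact: measurable_funM.
move=> x; rewrite normrM (ger0_norm (p_ge0 x)) ler_wpM2r//.
by rewrite (le_trans (cos_max _))// lerDl.
Qed.

Let ixp : mu.-integrable setT (EFin \o (fun x => `|x| * p x)).
Proof.
apply: pdom; first by apply: measurable_funM => //; exact: normr_measurable.
by move=> x; rewrite normrM normr_id (ger0_norm (p_ge0 x)) ler_wpM2r// lerDr.
Qed.

Let idk t : mu.-integrable setT (EFin \o dk t).
Proof.
apply: pdom.
  by apply: measurableT_comp => //; apply: measurable_funM => //; apply: measurable_funM.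
move=> x; rewrite normrN !normrM (ger0_norm (p_ge0 x)) ler_wpM2r//.
by rewrite (le_trans (ler_piMr _ (sin_max _)))// lerDr.
Qed.

Let is_derive_k (t x : R) : is_derive t 1 (k ^~ x) (dk t x).
Proof.
have h : is_derive t 1 (fun t : R => t * x - phi) x.
  by apply: is_derive_eq; rewrite /GRing.scale/=; ring.
have := @is_derive1_comp R (@cos R) (fun t : R => t * x - phi) t _ _ (is_derive_cos _) h.
move=> {}h.
rewrite /k /dk.
by apply: is_derive_eq; rewrite /GRing.scale/=; ring.
Qed.

Let is_derive_H (t : R) : is_derive t 1 H (\int[mu]_x dk t x).
Proof.
have D1 s x : partial1of2 k s x = dk s x.
  by rewrite partial1of2E; have [_ ->] := is_derive_k s x.
have tI : t \in `]t - 1, t + 1[%R by rewrite in_itv/=; apply/andP; split; lra.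
have A1 : forall s x, `](t - 1), (t + 1)[%classic s -> [set: R] x -> derivable (k ^~ x) s 1.
  by move=> s x _ _; have [] := is_derive_k s x.
have A2 : forall s x, `](t - 1), (t + 1)[%classic s -> [set: R] x -> `|partial1of2 k s x| <= `|x| * p x.
  move=> s x _ _; rewrite D1 normrN !normrM (ger0_norm (p_ge0 x)) ler_wpM2r//.
  by rewrite ler_piMr// sin_max.
have G0 x : 0 <= `|x| * p x by rewrite mulr_ge0.
apply: DeriveDef.
  exact: (derivable_under_integral measurableT tI (fun s _ => ik s) A1 G0 ixp A2).
rewrite -derive1E (differentiation_under_integral measurableT tI (fun s _ => ik s) A1 G0 ixp A2).
by apply: eq_Rintegral => x _; rewrite D1.
Qed.

Let Gp (t x : R) := sin (t * x - phi) * p x.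

Let is_derive_Gp (t x : R) : is_derive x 1 (Gp t) (t * k t x + dk t x).
Proof.
have h : is_derive x 1 (fun x : R => t * x - phi) t.
  by apply: is_derive_eq; rewrite /GRing.scale/=; ring.
have {}h := @is_derive1_comp R (@sin R) (fun x : R => t * x - phi) x _ _ (is_derive_sin _) h.
have g : is_derive x 1 (fun x : R => - (x ^+ 2 / 2)) (- x).
  by apply: is_derive_eq; rewrite /GRing.scale/=; field.
have {}g := @is_derive1_comp R (@expR R) (fun x : R => - (x ^+ 2 / 2)) x _ _ (is_derive_expR _) g.
have -> : Gp t = (fun x => normal_peak 1 * (sin (t * x - phi) * expR (- (x ^+ 2 / 2)))).
  by apply/funext => y; rewrite /Gp std_normal_pdfE mulrCA.
rewrite /k /dk !std_normal_pdfE.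
by apply: is_derive_eq; rewrite /GRing.scale/=; ring.
Qed.

Let iGp' (t : R) : mu.-integrable setT (EFin \o (fun x => t * k t x + dk t x)).
Proof. exact: (integrableD measurableT (integrableZl measurableT t (ik t)) (idk t)). Qed.

Let Gp_ub (t x : R) : `|Gp t x| <= 32 * normal_peak 1 / (1 + x ^+ 2).
Proof.
apply: le_trans (normal_pdf_cauchy_dom x).
rewrite normrM (ger0_norm (p_ge0 x)) ler_wpM2r// (le_trans (sin_max _))//.
by rewrite lerDl.
Qed.

Let Gp_FTC (t : R) (n : nat) :
  (\int[mu]_(x in `[(- n.+1%:R)%R, (n.+1%:R : R)%R]) (t * k t x + dk t x)%:E =
  (Gp t n.+1%:R - Gp t (- n.+1%:R))%:E)%E.
Proof.
have cG (x : R) : Gp t y @[y --> x] --> Gp t x.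
  by apply: differentiable_continuous; apply/derivable1_diffP; have [] := is_derive_Gp t x.
rewrite (@continuous_FTC2 _ _ (Gp t)) ?EFinB//.
- by rewrite gtrN.
- apply: continuous_subspaceT => x; rewrite /k /dk.
  have cp : {for x, continuous p} by apply: continuous_normal_pdf; rewrite oner_eq0.
  have ca : {for x, continuous (fun x : R => t * x - phi)}.
    by apply: cvgB; [apply: cvgMr|exact: cvg_cst].
  apply: cvgD; first apply: cvgMr; last apply: cvgN.
    by apply: cvgM => //; apply: continuous_comp => //; exact: continuous_cos.
  apply: cvgM => //; apply: cvgM => //.
  by apply: continuous_comp => //; exact: continuous_sin.
- split => [x _||].
  + by have [] := is_derive_Gp t x.
  + by apply: cvg_at_right_filter; exact: cG.
  + by apply: cvg_at_left_filter; exact: cG.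
- by move=> x _; rewrite derive1E; have [_ ->] := is_derive_Gp t x.
Qed.

(** The integrand is the derivative of [Gp t], which vanishes at both ends of the line. Dominated
    convergence over growing intervals compares the whole integral with the boundary terms. *)
Let integral_Gp' (t : R) : \int[mu]_x (t * k t x + dk t x) = 0.
Proof.
(* The index is shifted by one because the fundamental theorem of calculus is applied on a
   nondegenerate interval. *)
pose D (n : nat) : set R := `[(- n.+1%:R)%R, (n.+1%:R : R)%R]%classic.
pose f_ (n : nat) : R -> \bar R := (EFin \o (fun x => t * k t x + dk t x)) \_ (D n).
have mD n : measurable (D n) by exact: measurable_itv.
have mG := measurable_int mu (iGp' t).
have c1 : (\int[mu]_x f_ n x)%E @[n --> \oo] -->
    (\int[mu]_x (t * k t x + dk t x)%:E)%E.
  apply: (@dominated_cvg _ _ _ mu setT measurableT f_ _ (fun x => `|(t * k t x + dk t x)%:E|%E)) => //.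
  - move=> n; have [H1 _] := measurable_restrictT (EFin \o (fun x => t * k t x + dk t x)) (mD n).
    apply: H1; exact: (measurable_funS measurableT (@subsetT _ _) mG).
  - move=> x _; apply: cvg_near_cst.
    exists (Num.truncn `|x|) => // n /= xn.
    rewrite /f_ patchE ifT// inE /D/= in_itv/= -ler_norml.
    rewrite (le_trans (ltW (truncnS_gt _)))// ler_nat ltnS.
    exact: xn.
  - exact: (integrable_abse (iGp' t)).
  - move=> n x _; rewrite /f_ patchE; case: ifPn => // _; rewrite abse0.
    exact: abse_ge0.
have c2 : (\int[mu]_x f_ n x)%E @[n --> \oo] --> 0%E.
  have -> : (fun n => \int[mu]_x f_ n x)%E =
      (fun n => (Gp t n.+1%:R - Gp t (- n.+1%:R))%:E).
    by apply/funext => n; rewrite -Gp_FTC /f_ -integral_mkcond.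
  apply: cvg_EFin; first by near=> n.
  rewrite /comp/=.
  apply/norm_cvg0P.
  apply: (@squeeze_cvgr _ _ _ _ (cst 0) (fun n => 64 * normal_peak 1 * harmonic n)).
  - apply/nearW => n /=; rewrite normr_ge0/=.
    rewrite (le_trans (ler_normB _ _))// (le_trans (lerD (Gp_ub _ _) (Gp_ub _ _)))//.
    rewrite sqrrN -mulrDl.
    rewrite (_ : _ + _ = 64 * normal_peak 1); last by ring.
    rewrite ler_wpM2l ?mulr_ge0 ?normal_peak_ge0// /harmonic/=.
    rewrite lef_pV2 ?posrE ?ltr0n ?ltr_pwDl ?sqr_ge0//.
    rewrite -[leLHS]add0r lerD// expr2 ler_peMl// ler1n//.
  - exact: cvg_cst.
  - rewrite -[X in _ --> X](mulr0 (64 * normal_peak 1)).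
    by apply: cvgMr; exact: cvg_harmonic.
have := cvg_unique _ c1 c2 => /(_ (@ereal_hausdorff _)) E.
by rewrite /Rintegral E.
Unshelve. all: by end_near.
Qed.

Let H_ode (t : R) : \int[mu]_x dk t x = - (t * H t).
Proof.
have := integral_Gp' t; rewrite RintegralD//; last exact: (integrableZl measurableT t (ik t)).
by rewrite RintegralZl// => /eqP; rewrite addrC addr_eq0 => /eqP.
Qed.

Lemma gauss_char_shift (t : R) :
  \int[mu]_x (cos (t * x - phi) * p x) = cos phi * expR (- (t ^+ 2 / 2)).
Proof.
(* The integrating factor of H' = - t H: [K] is constant, and its value at 0 is cos phi. *)
pose K (s : R) := H s * expR (s ^+ 2 / 2).
have dK (s : R) : is_derive s 1 K 0.
  have h1 := is_derive_H s; rewrite H_ode in h1.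
  have g : is_derive s 1 (fun x : R => x ^+ 2 / 2) s.
    by apply: is_derive_eq; rewrite /GRing.scale/=; field.
  have {}g := @is_derive1_comp R (@expR R) (fun x : R => x ^+ 2 / 2) s _ _ (is_derive_expR _) g.
  rewrite /K; apply: is_derive_eq; rewrite /GRing.scale/=; ring.
have : K t = K 0 by exact: is_derive_0_is_cst.
rewrite /K expr0n/= mul0r expR0 mulr1 => E.
have H0 : H 0 = cos phi.
  rewrite /H /k.
  under eq_Rintegral do rewrite mul0r sub0r cosN.
  by rewrite RintegralZl// Rintegral_normal_pdf mulr1.
by rewrite expRN -H0 -E mulfK// gt_eqF// expR_gt0.
Qed.

End char_fun.

Lemma normal_cos (t : R) : \int[N]_x cos (t * x) = expR (- (t ^+ 2 / 2)).
Proof.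
rewrite (Rintegral_normal_prob (C := 1)); last 2 first.
  by apply: (measurableT_comp (@measurable_cos R)); exact: measurable_funM.
  by move=> x; exact: cos_max.
have := gauss_char_shift 0 t; rewrite cos0 mul1r => <-.
by apply: eq_Rintegral => x _; rewrite subr0.
Qed.

Lemma normal_sin (t : R) : \int[N]_x sin (t * x) = 0.
Proof.
rewrite (Rintegral_normal_prob (C := 1)); last 2 first.
  by apply: (measurableT_comp (@measurable_sin R)); exact: measurable_funM.
  by move=> x; exact: sin_max.
(* The phase pi/2 turns the cosine into a sine, while the factor cos phi on the right vanishes. *)
have := gauss_char_shift (pi / 2) t; rewrite cos_pihalf mul0r => E.
rewrite -[RHS]E; apply: eq_Rintegral => x _; by rewrite cosB cos_pihalf sin_pihalf mulr0 add0r mulr1.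
Qed.

(** If |x| >= y >= 0 then x^2 >= y^2 + (|x| - y)^2, so the density at x is at most exp(-y^2/2) times
    the Gaussian density centred at y or at -y. Each of these has total mass 1, whence the factor
    2. *)
Lemma normal_tail_le (y : R) : 0 <= y ->
  (N [set x : R | (y <= `|x|)%R] <= (2 * expR (- (y ^+ 2 / 2)))%:E)%E.
Proof.
move=> y0; rewrite /normal_prob.
have mS : measurable [set x : R | y <= `|x|].
  rewrite (_ : [set _ | _] = setT `&` (Num.norm : R -> R) @^-1` `[y, +oo[%classic); last first.
    by rewrite setTI; apply/seteqP; split => x /=; rewrite in_itv/= andbT.
  exact: normr_measurable.
apply: (@le_trans _ _ (\int[mu]_x (expR (- (y ^+ 2 / 2)) * (normal_pdf y 1 x + normal_pdf (- y) 1 x))%:E)%E).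
  rewrite integral_mkcond; apply: ge0_le_integral => //.
  - by move=> x _; apply: erestrict_ge0 => z _; rewrite lee_fin normal_pdf_ge0.
  - apply/(measurable_restrictT _ _).1 => //; apply/measurable_funTS/measurable_EFinP.
    exact: measurable_normal_pdf.
  - by apply/measurable_EFinP/measurable_funM => //; apply: measurable_funD; exact: measurable_normal_pdf.
  move=> x _; rewrite patchE; case: ifPn => [|_]; last first.
    by rewrite lee_fin mulr_ge0 ?expR_ge0// addr_ge0// normal_pdf_ge0.
  rewrite inE/= lee_fin => yx.
  rewrite std_normal_pdfE /normal_pdf oner_eq0 /normal_fun expr1n -mulrDr.
  rewrite mulrCA ler_wpM2l ?normal_peak_ge0// mulrDr -!expRD.
  have [x0|x0] := leP 0 x.
    rewrite (ger0_norm x0) in yx.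
    rewrite -[leLHS]addr0 lerD ?expR_ge0// ler_expR.
    by nra.
  rewrite (ltr0_norm x0) in yx.
  rewrite -[leLHS]add0r lerD ?expR_ge0// ler_expR.
  by nra.
under eq_integral do rewrite EFinM EFinD.
rewrite integralZl//; last first.
  by apply: integrableD => //; exact: integrable_normal_pdf.
rewrite integralD//; [|exact: integrable_normal_pdf..].
by rewrite !integral_normal_pdf -EFinD -EFinM lee_fin; lra.
Qed.

Lemma normal_itv_ge (u v : R) : 0 <= u <= v ->
  (((v - u) * normal_peak 1 * expR (- (v ^+ 2 / 2)))%:E <= N `[u, v]%classic)%E.
Proof.
move=> /andP[u0 uv]; rewrite /normal_prob.
apply: (@le_trans _ _ (\int[mu]_(x in `[u, v]) (normal_peak 1 * expR (- (v ^+ 2 / 2)))%:E)%E).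
  rewrite integral_cst//= lebesgue_measure_itv/= lte_fin.
  case: ifPn => [_|]; first by rewrite -EFinB -EFinM lee_fin; lra.
  by rewrite -leNgt mule0 lee_fin => vu; rewrite (_ : v - u = 0) ?mul0r//; lra.
apply: ge0_le_integral => //.
- by move=> x _; rewrite lee_fin mulr_ge0 ?normal_peak_ge0 ?expR_ge0.
- by apply/measurable_EFinP/measurable_funTS; exact: measurable_normal_pdf.
move=> x; rewrite /= in_itv/= => /andP[ux xv]; rewrite lee_fin std_normal_pdfE.
by rewrite ler_wpM2l ?normal_peak_ge0// ler_expR lerN2; nra.
Qed.

End gaussian.

Section complex_exp.
Context {R : realType}.
Local Open Scope complex_scope.

Lemma cexp_iE (r : R) : cexp ('i * r%:C) = cos r +i* sin r.
Proof.
by rewrite /cexp; simpc; rewrite /= expR0; simpc.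
Qed.

Lemma cexp_scaleE (t a b : R) : cexp (t%:C * (a +i* b)) =
  (expR (t * a) * cos (t * b)) +i* (expR (t * a) * sin (t * b)).
Proof. by rewrite /cexp; simpc; rewrite /=; simpc. Qed.

End complex_exp.

(** * The exponent of X against the Gaussian one, and the resulting tail bounds *)

Section levy_char.
Context {R : realType}.
Variables (gamma : R) (Pi : {measure set R -> \bar R}).
Hypothesis hPi2 : (\int[Pi]_x (x ^+ 2)%:E < +oo)%E.
Notation D := (`[-1, 1]%classic : set R).

Definition levy_re (t : R) := \int[Pi]_(x in D) (cos (t * x) - 1).
Definition levy_im (t : R) := gamma * t + \int[Pi]_(x in D) (sin (t * x) - t * x).

Lemma levy_exponentE (t : R) :
  levy_exponent gamma 0 Pi t = (levy_re t +i* levy_im t)%C.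
Proof.
rewrite /levy_exponent /cintegral mul0r mul0r.
under eq_Rintegral do rewrite cexp_iE.
under [X in _ + (_ +i* X)%C]eq_Rintegral do rewrite cexp_iE.
rewrite /levy_re /levy_im; simpc.
congr (_ +i* _)%C.
  by apply: eq_Rintegral => x _; simpc.
congr (_ + _).
by apply: eq_Rintegral => x _; simpc.
Qed.

Lemma char_funE {d : measure_display} {T : measurableType d}
  (P : probability T R) (Y : T -> R) (t : R) :
  char_fun P Y t = ((\int[P]_w cos (t * Y w)) +i* (\int[P]_w sin (t * Y w)))%C.
Proof.
rewrite /char_fun /cintegral.
by congr (_ +i* _)%C; apply: eq_Rintegral => w _; rewrite cexp_iE.
Qed.

Lemma integrable_sqr : Pi.-integrable setT (fun x : R => (x ^+ 2)%:E).
Proof.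
apply/integrableP; split; first by apply/measurable_EFinP; exact: measurable_funX.
by under eq_integral do rewrite gee0_abs ?lee_fin ?sqr_ge0//.
Qed.

Lemma integrable_sqr_dom (E : set R) (h : R -> R) (C : R) : measurable E ->
  measurable_fun setT h -> (forall x, `|h x| <= C * x ^+ 2) ->
  Pi.-integrable E (EFin \o h).
Proof.
move=> mE mh hC.
apply: (@le_integrable _ _ _ Pi E _ _ (fun x => (C%:E * (x ^+ 2)%:E)%E)) => //.
- by apply/measurable_EFinP; exact: measurable_funTS.
- by move=> x _; rewrite -EFinM !abse_EFin lee_fin (le_trans (hC x))// ler_norm.
- apply: integrableZl => //.
  by apply: (integrableS measurableT) => //; exact: integrable_sqr.
Qed.

Lemma integrable_cosB1 (t : R) (E : set R) : measurable E ->
  Pi.-integrable E (EFin \o (fun x => cos (t * x) - 1)).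
Proof.
move=> mE; apply: (integrable_sqr_dom (C := t ^+ 2 / 2) mE).
  apply: measurable_funB => //; apply: (measurableT_comp (@measurable_cos R)).
  exact: measurable_funM.
move=> x; apply: le_trans (norm_cos_sub1_le_sqr _) _.
by rewrite exprMn mulrAC.
Qed.

Lemma integrable_sinB (t : R) (E : set R) : measurable E ->
  Pi.-integrable E (EFin \o (fun x => sin (t * x) - t * x)).
Proof.
move=> mE; apply: (integrable_sqr_dom (C := 2 * t ^+ 2) mE).
  apply: measurable_funB; last exact: measurable_funM.
  apply: (measurableT_comp (@measurable_sin R)); exact: measurable_funM.
move=> x; rewrite -mulrA -exprMn.
rewrite -(real_normK (num_real (t * x))).
have n0 := normr_ge0 (t * x).
have [n1|n1] := leP `|t * x| 1.
  apply: le_trans (norm_sin_sub_le3 _) _.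
  by rewrite exprS; nra.
apply: le_trans (norm_sin_sub_le _) _.
by rewrite ler_pM2l// expr2 ler_peMr// ltW.
Qed.

(* u^2 * jump_weight u is u^3, the size of the Taylor remainder of cos and sin,
   for the small jumps u = |y| / s <= 1, and u for the large ones. *)
Definition jump_weight (u : R) := if u <= 1 then u else u^-1.

Lemma jump_weight_ge0 u : 0 <= u -> 0 <= jump_weight u.
Proof. by rewrite /jump_weight; case: ifP => // _ u0; rewrite invr_ge0. Qed.

Lemma jump_weight_le1 u : 0 <= u -> jump_weight u <= 1.
Proof.
rewrite /jump_weight; case: ifPn => // + u0.
by rewrite -ltNge => u1; rewrite invf_le1 ?(ltW u1)// (lt_trans _ u1).
Qed.

Lemma measurable_jump_weight : measurable_fun setT jump_weight.
Proof.
apply: measurable_fun_ifT => //; last exact: measurable_fun_inv.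
exact: measurable_fun_ler.
Qed.

Definition Jfun (s : R) := \int[Pi]_(y in D) (y ^+ 2 * jump_weight (`|y| / s)).

Definition Verr (s : R) := `|gamma| * s + Jfun s.

Lemma measurable_Jfun_integrand (s : R) : measurable_fun setT
  (fun y : R => y ^+ 2 * jump_weight (`|y| / s)).
Proof.
apply: measurable_funM; first exact: measurable_funX.
apply: (measurableT_comp measurable_jump_weight).
by apply: measurable_funM => //; exact: normr_measurable.
Qed.

Lemma integrable_Jfun (s : R) (E : set R) : 0 < s -> measurable E ->
  Pi.-integrable E (EFin \o (fun y => y ^+ 2 * jump_weight (`|y| / s))).
Proof.
move=> s0 mE; apply: (integrable_sqr_dom (C := 1) mE).
  exact: measurable_Jfun_integrand.
move=> y; have u0 : 0 <= `|y| / s by rewrite divr_ge0// ltW.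
rewrite ger0_norm; last exact: mulr_ge0 (sqr_ge0 _) (jump_weight_ge0 u0).
by rewrite mul1r ler_piMr ?sqr_ge0// jump_weight_le1.
Qed.

Lemma Jfun_ge0 (s : R) : 0 < s -> 0 <= Jfun s.
Proof.
move=> s0; apply: Rintegral_ge0 => y _; rewrite mulr_ge0 ?sqr_ge0//.
by rewrite jump_weight_ge0// divr_ge0// ltW.
Qed.

Lemma Verr_ge0 (s : R) : 0 < s -> 0 <= Verr s.
Proof. by move=> s0; rewrite addr_ge0 ?Jfun_ge0// mulr_ge0// ltW. Qed.

Lemma measurable_norm_le (s : R) : measurable [set y : R | `|y| <= s].
Proof.
rewrite (_ : [set _ | _] = setT `&` (Num.norm : R -> R) @^-1` `]-oo, s]%classic).
  exact: normr_measurable.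
by rewrite setTI; apply/seteqP; split => x /=; rewrite in_itv.
Qed.

(** Brings V(s) to the domain [-1, 1] of the integral in the exponent, so that the two can be
    compared jump by jump; the condition s <= 1 in later bounds comes from here. *)
Lemma Vfun_D (s : R) : s <= 1 ->
  Vfun Pi s = \int[Pi]_(y in D) (if `|y| <= s then y ^+ 2 else 0).
Proof.
move=> s1; rewrite /Vfun Rintegral_mkcond [RHS]Rintegral_mkcond.
apply: eq_Rintegral => y _; rewrite !patchE.
case: ifPn; rewrite ?inE ?notin_setE/= => ys.
  rewrite ifT ?ys// inE/= in_itv/= -ler_norml.
  exact: le_trans ys s1.
by case: ifPn => // _; move/negP: ys => /negbTE ->.
Qed.

Lemma integrable_V (s : R) (E : set R) : measurable E ->
  Pi.-integrable E (EFin \o (fun y : R => if `|y| <= s then y ^+ 2 else 0)).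
Proof.
move=> mE; apply: (integrable_sqr_dom (C := 1) mE).
  apply: measurable_fun_ifT => //.
  apply: measurable_fun_ler => //; exact: normr_measurable.
move=> y; rewrite mul1r; case: ifP => _; first by rewrite ger0_norm ?sqr_ge0.
by rewrite normr0 sqr_ge0.
Qed.

Lemma Vfun_ge0 (s : R) : 0 <= Vfun Pi s.
Proof. by apply: Rintegral_ge0 => y _; rewrite sqr_ge0. Qed.

(** Contribution of one jump to the difference of exponents, with z = t y / s and time s^2. A small
    jump leaves the Taylor remainder s^2 |z|^3 = |t|^3 y^2 (|y| / s). A large one is absent from
    V(s) and costs s^2 |z| = |t| y^2 (s / |y|). *)
Lemma cos_jump_le (s t y : R) : 0 < s ->
  `|s ^+ 2 * (cos (t / s * y) - 1) + t ^+ 2 / 2 * (if `|y| <= s then y ^+ 2 else 0)| <=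
  (`|t| + `|t| ^+ 3) * (y ^+ 2 * jump_weight (`|y| / s)).
Proof.
move=> s0; set z := t / s * y.
have nz : `|z| = `|t| * `|y| / s.
  by rewrite /z !normrM normfV (gtr0_norm s0); ring.
have y0 := normr_ge0 y; have t0 := normr_ge0 t.
rewrite -(real_normK (num_real y)).
rewrite /jump_weight ler_pdivrMr// mul1r.
case: ifPn => ys.
  rewrite (_ : _ + _ = s ^+ 2 * (cos z - 1 + z ^+ 2 / 2)); last first.
    rewrite [RHS]mulrDr; congr (_ + _).
    rewrite -(real_normK (num_real z)) nz -(real_normK (num_real t)).
    by field; rewrite gt_eqF.
  rewrite normrM ger0_norm ?sqr_ge0//.
  apply: le_trans (ler_wpM2l (sqr_ge0 _) (norm_cos_taylor2_le z)) _.
  rewrite nz [leLHS](_ : _ = `|t| ^+ 3 * (`|y| ^+ 2 * (`|y| / s))); last first.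
    by field; rewrite gt_eqF.
  rewrite ler_wpM2r ?lerDr// mulr_ge0 ?sqr_ge0// divr_ge0// ltW//.
rewrite mulr0 addr0 normrM ger0_norm ?sqr_ge0//.
apply: le_trans (ler_wpM2l (sqr_ge0 _) (norm_cos_sub1_le z)) _.
rewrite -ltNge in ys.
have y1 : 0 < `|y| by exact: lt_trans ys.
rewrite nz invf_div [leLHS](_ : _ = `|t| * (`|y| ^+ 2 * (s / `|y|))); last first.
  by field; rewrite !gt_eqF.
by rewrite ler_wpM2r ?lerDl ?exprn_ge0// mulr_ge0 ?sqr_ge0// divr_ge0// ltW.
Qed.

Lemma sin_jump_le (s t y : R) : 0 < s ->
  `|s ^+ 2 * (sin (t / s * y) - t / s * y)| <=
  (2 * `|t| + `|t| ^+ 3) * (y ^+ 2 * jump_weight (`|y| / s)).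
Proof.
move=> s0; set z := t / s * y.
have nz : `|z| = `|t| * `|y| / s.
  by rewrite /z !normrM normfV (gtr0_norm s0); ring.
have y0 := normr_ge0 y; have t0 := normr_ge0 t.
rewrite -(real_normK (num_real y)).
rewrite /jump_weight ler_pdivrMr// mul1r normrM ger0_norm ?sqr_ge0//.
case: ifPn => ys.
  apply: le_trans (ler_wpM2l (sqr_ge0 _) (norm_sin_sub_le3 z)) _.
  rewrite nz [leLHS](_ : _ = `|t| ^+ 3 * (`|y| ^+ 2 * (`|y| / s))); last first.
    by field; rewrite gt_eqF.
  by rewrite ler_wpM2r ?lerDr ?mulr_ge0 ?sqr_ge0 ?invr_ge0 ?(ltW s0).
apply: le_trans (ler_wpM2l (sqr_ge0 _) (norm_sin_sub_le z)) _.
rewrite -ltNge in ys.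
have y1 : 0 < `|y| by exact: lt_trans ys.
rewrite nz invf_div [leLHS](_ : _ = 2 * `|t| * (`|y| ^+ 2 * (s / `|y|))); last first.
  by field; rewrite !gt_eqF.
by rewrite ler_wpM2r ?lerDl ?exprn_ge0// mulr_ge0 ?sqr_ge0// divr_ge0// ltW.
Qed.

Lemma levy_re_le (s t : R) : 0 < s <= 1 ->
  `|s ^+ 2 * levy_re (t / s) + t ^+ 2 / 2 * Vfun Pi s| <= (`|t| + `|t| ^+ 3) * Jfun s.
Proof.
move=> /andP[s0 s1]; rewrite Vfun_D// /levy_re.
have mD : measurable D by exact: measurable_itv.
have i1 := integrable_cosB1 (t / s) mD.
have i2 := integrable_V s mD.
have i3 := integrable_Jfun s0 mD.
rewrite -(RintegralZl _ mD i1) -(RintegralZl _ mD i2) /Jfun -(RintegralZl _ mD i3) -RintegralD//; last 2 first.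
  exact: (integrableZl mD _ i1).
  exact: (integrableZl mD _ i2).
have i12 : Pi.-integrable D (EFin \o (fun x => s ^+ 2 * (cos (t / s * x) - 1) +
    t ^+ 2 / 2 * (if `|x| <= s then x ^+ 2 else 0))).
  exact: (integrableD mD (integrableZl mD (s ^+ 2) i1) (integrableZl mD (t ^+ 2 / 2) i2)).
apply: le_trans (le_normr_Rintegral mD i12) _.
apply: le_Rintegral => //.
- exact: integrable_norm.
- exact: (integrableZl mD _ i3).
- by move=> y _; exact: cos_jump_le.
Qed.

Lemma levy_im_le (s t : R) : 0 < s <= 1 ->
  `|s ^+ 2 * levy_im (t / s)| <= `|t| * (`|gamma| * s) + (2 * `|t| + `|t| ^+ 3) * Jfun s.
Proof.
move=> /andP[s0 s1]; rewrite /levy_im.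
have mD : measurable D by exact: measurable_itv.
have i1 := integrable_sinB (t / s) mD.
have i3 := integrable_Jfun s0 mD.
rewrite mulrDr; apply: le_trans (ler_normD _ _) _; apply: lerD.
  rewrite (_ : s ^+ 2 * _ = t * (gamma * s)); last by field; rewrite gt_eqF.
  by rewrite !normrM (gtr0_norm s0).
rewrite -(RintegralZl _ mD i1) /Jfun -(RintegralZl _ mD i3).
have i1' : Pi.-integrable D (EFin \o (fun x => s ^+ 2 * (sin (t / s * x) - t / s * x))).
  exact: (integrableZl mD _ i1).
apply: le_trans (le_normr_Rintegral mD i1') _.
apply: le_Rintegral => //.
- exact: integrable_norm.
- exact: (integrableZl mD _ i3).
- by move=> y _; exact: sin_jump_le.
Qed.

Lemma levy_re_le0 (t : R) : levy_re t <= 0.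
Proof.
have mD : measurable D by exact: measurable_itv.
have : 0 <= \int[Pi]_(x in D) (-1 * (cos (t * x) - 1)).
  by apply: Rintegral_ge0 => x _; rewrite mulN1r oppr_ge0 subr_le0 cos_le1.
by rewrite (RintegralZl _ mD (integrable_cosB1 t mD)) mulN1r oppr_ge0.
Qed.

Lemma expR_lip (a b : R) : a <= 0 -> b <= 0 -> `|expR a - expR b| <= `|a - b|.
Proof.
wlog ab : a b / a <= b => [hw|].
  have [ab|/ltW ab] := leP a b; first exact: hw.
  by move=> a0 b0; rewrite distrC [leRHS]distrC; exact: hw.
move=> a0 b0; rewrite distrC [leRHS]distrC !ger0_norm ?subr_ge0 ?ler_expR//.
have -> : expR b - expR a = expR b * (1 - expR (a - b)).
  by rewrite mulrBr mulr1 -expRD addrCA subrr addr0.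
have e1 : expR b <= 1 by rewrite -expR0 ler_expR.
have e0 := expR_ge0 b.
have := @expR_ge1Dx R (a - b).
have : expR (a - b) <= 1 by rewrite -expR0 ler_expR subr_le0.
move: (expR (a - b)) => e h1 h2.
by apply: (@le_trans _ _ (1 - e)); [rewrite ler_piMl// subr_ge0|lra].
Qed.

(** Both exponents have nonpositive real part, where the exponential is 1-Lipschitz and bounded by
    1; the imaginary part B is charged once to the cosine and once to the sine. *)
Lemma cf_compare (A B W : R) : A <= 0 -> 0 <= W ->
  `|expR A * cos B - expR (- W)| + `|expR A * sin B - 0| <= `|A + W| + 2 * `|B|.
Proof.
move=> A0 W0.
have eA : expR A <= 1 by rewrite -expR0 ler_expR.
have h1 : `|expR A * cos B - expR (- W)| <= `|A + W| + `|B|.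
  rewrite (_ : _ - _ = (expR A - expR (- W)) + expR A * (cos B - 1)); last by ring.
  rewrite (le_trans (ler_normD _ _))// lerD//.
    by rewrite -[in leRHS](opprK W) expR_lip// oppr_le0.
  rewrite normrM ger0_norm ?expR_ge0//.
  by rewrite (le_trans (ler_piMl _ eA))// norm_cos_sub1_le.
have h2 : `|expR A * sin B - 0| <= `|B|.
  rewrite subr0 normrM ger0_norm ?expR_ge0//.
  by rewrite (le_trans (ler_piMl _ eA))// sin_norm.
lra.
Qed.

Lemma Vfun_le (s s' : R) : s <= s' <= 1 -> Vfun Pi s <= Vfun Pi s'.
Proof.
move=> /andP[ss' s'1]; rewrite !Vfun_D//; last exact: le_trans s'1.
have mD : measurable D by exact: measurable_itv.
apply: le_Rintegral => //; [exact: integrable_V|exact: integrable_V|move=> y _].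
case: ifPn => ys; first by rewrite (le_trans ys ss').
by case: ifPn => _ //; rewrite sqr_ge0.
Qed.

Definition Gfun (a s : R) : R :=
  if Vfun Pi s == 0 then 0 else expR (- (a ^+ 2 / (2 * Vfun Pi s))).

Lemma Gfun_ge0 a s : 0 <= Gfun a s.
Proof. by rewrite /Gfun; case: ifP => // _; exact: expR_ge0. Qed.

Section process.
Context {d : measure_display} {T : measurableType d} (P : probability T R).
Variable X : R -> {RV P >-> R}.
Hypothesis htriplet : has_triplet X gamma 0 Pi.

Lemma X_char (t u : R) : 0 <= t ->
  \int[P]_w cos (u * X t w) = expR (t * levy_re u) * cos (t * levy_im u) /\
  \int[P]_w sin (u * X t w) = expR (t * levy_re u) * sin (t * levy_im u).
Proof.
move=> t0; have := htriplet u t0.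
by rewrite char_funE levy_exponentE cexp_scaleE => -[].
Qed.

(** The exponent of X_{s^2} / s at u is s^2 times the Levy exponent at u / s; its real part is close
    to - u^2 V(s) / 2 and its imaginary part is close to 0. *)
Lemma X_char_compare (s u : R) : 0 < s <= 1 ->
  `|\int[P]_w cos (u * (X (s ^+ 2) w / s)) -
     \int[@normal_prob R 0 1]_x cos (u * (Num.sqrt (Vfun Pi s) * x))| +
  `|\int[P]_w sin (u * (X (s ^+ 2) w / s)) -
     \int[@normal_prob R 0 1]_x sin (u * (Num.sqrt (Vfun Pi s) * x))| <=
  (7 * Verr s) * (1 + `|u|) ^+ 3.
Proof.
move=> s01; have /andP[s0 s1] := s01.
have [c1 c2] := X_char (u / s) (sqr_ge0 s).
under eq_Rintegral do rewrite [_ / s]mulrC mulrA.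
under [X in _ + `|X - _|]eq_Rintegral do rewrite [_ / s]mulrC mulrA.
under [X in `|_ - X| + _]eq_Rintegral do rewrite mulrA.
under [X in _ + `|_ - X|]eq_Rintegral do rewrite mulrA.
rewrite normal_cos normal_sin c1 c2 exprMn sqr_sqrtr ?Vfun_ge0//.
have W0 : 0 <= u ^+ 2 * Vfun Pi s / 2 by rewrite divr_ge0// mulr_ge0 ?sqr_ge0 ?Vfun_ge0.
have A0 : s ^+ 2 * levy_re (u / s) <= 0 by rewrite mulr_ge0_le0 ?sqr_ge0 ?levy_re_le0.
apply: le_trans (cf_compare _ A0 W0) _.
have := levy_re_le u s01; have := levy_im_le u s01.
rewrite (_ : u ^+ 2 / 2 * Vfun Pi s = u ^+ 2 * Vfun Pi s / 2); last by ring.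
move: `|s ^+ 2 * levy_re (u / s) + u ^+ 2 * Vfun Pi s / 2| `|s ^+ 2 * levy_im (u / s)| => a b.
rewrite /Verr; have J0 := Jfun_ge0 s0; have g0 : 0 <= `|gamma| * s by rewrite mulr_ge0// ltW.
move: (Jfun s) (`|gamma| * s) J0 g0 => J g J0 g0.
have v0 := normr_ge0 u; move: `|u| v0 => v v0 h1 h2.
have v2 : 0 <= v ^+ 2 by exact: sqr_ge0.
have v3 : 0 <= v ^+ 3 by exact: exprn_ge0.
(* The errors add up to at most (1 + v)^3 (2 g + 3 J), so the constant 7 is generous. *)
have e3 : (1 + v) ^+ 3 = 1 + 3 * v + 3 * v ^+ 2 + v ^+ 3 by ring.
have k1 : v <= (1 + v) ^+ 3 by rewrite e3; lra.
have k2 : v + v ^+ 3 <= (1 + v) ^+ 3 by rewrite e3; lra.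
have k3 : 2 * v + v ^+ 3 <= (1 + v) ^+ 3 by rewrite e3; lra.
have := ler_wpM2r g0 k1; have := ler_wpM2r J0 k2; have := ler_wpM2r J0 k3.
have q0 : 0 <= (1 + v) ^+ 3 by rewrite exprn_ge0// addr_ge0.
have := mulr_ge0 q0 g0; have := mulr_ge0 q0 J0; lra.
Qed.

Lemma prob_ge_Rintegral {d'} {T' : measurableType d'} (m : probability T' R)
  (S : set T') (h : T' -> R) (C : R) : measurable S -> measurable_fun setT h ->
  (forall w, `|h w| <= C) -> (forall w, h w <= \1_S w) ->
  ((\int[m]_w h w)%:E <= m S)%E.
Proof.
move=> mS mh hC hS.
have iS : m.-integrable setT (EFin \o (\1_S : T' -> R)) by exact: integrable_indic.
have -> : m S = (\int[m]_w (\1_S w : R))%:E.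
  by rewrite /Rintegral integral_indic// setIT fineK// fin_num_measure.
rewrite lee_fin; apply: le_Rintegral => //.
exact: (integrable_prob_bounded _ mh hC).
Qed.

Lemma prob_le_Rintegral {d'} {T' : measurableType d'} (m : probability T' R)
  (S : set T') (h : T' -> R) (C : R) : measurable S -> measurable_fun setT h ->
  (forall w, `|h w| <= C) -> (forall w, \1_S w <= h w) ->
  (m S <= (\int[m]_w h w)%:E)%E.
Proof.
move=> mS mh hC hS.
have iS : m.-integrable setT (EFin \o (\1_S : T' -> R)) by exact: integrable_indic.
have -> : m S = (\int[m]_w (\1_S w : R))%:E.
  by rewrite /Rintegral integral_indic// setIT fineK// fin_num_measure.
rewrite lee_fin; apply: le_Rintegral => //.
exact: (integrable_prob_bounded _ mh hC).
Qed.

Lemma measurable_X_ge (e b t : R) : measurable [set w | b <= e * X t w].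
Proof.
rewrite (_ : [set _ | _] = setT `&` (fun w => e * X t w) @^-1` `[b, +oo[%classic).
  exact: measurable_funM.
by rewrite setTI; apply/seteqP; split => x /=; rewrite in_itv/= andbT.
Qed.

Lemma measurable_normX_ge (b t : R) : measurable [set w | b <= `|X t w|].
Proof.
rewrite (_ : [set _ | _] = setT `&` (fun w => `|X t w|) @^-1` `[b, +oo[%classic).
  exact: (measurableT_comp (@normr_measurable _ _)).
by rewrite setTI; apply/seteqP; split => x /=; rewrite in_itv/= andbT.
Qed.

Lemma cos_rep_C_ge0 k f g (C : R) : cos_rep k f g C -> 0 <= C.
Proof.
move=> fg; have := le_trans (normr_ge0 _) (cos_rep_dom fg 0).
by rewrite expr0n/= addr0 divr1.
Qed.

(** Take a plateau [f] equal to 1 up to [a] and to 0 from [a + delta] on. Then 1 - f dominates the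
    event for X, and under the Gaussian law it is dominated by the tail beyond [a]. *)
Lemma upper_tail (a delta : R) : 0 <= a -> 0 < delta ->
  exists2 C : R, 0 <= C & forall s : R, 0 < s <= 1 ->
  (P [set w | ((a + delta) * s <= `|X (s ^+ 2) w|)%R] <=
   (2 * Gfun a s + C * Verr s)%:E)%E.
Proof.
move=> a0 d0.
have ad : 0 <= a < a + delta by rewrite a0 ltrDl.
have [f [[g [C fg]] mf f01 fa fb]] := plateau_exists ad.
have C0 := cos_rep_C_ge0 fg.
have K0 : 0 <= @cauchy_mass R by apply: Rintegral_ge0 => x _; rewrite invr_ge0 addr_ge0 ?sqr_ge0.
exists (7 * C * @cauchy_mass R); first by rewrite !mulr_ge0.
move=> s s01; have /andP[s0 s1] := s01.
pose Y1 w := X (s ^+ 2) w / s.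
pose Y2 (x : measurableTypeR R) := Num.sqrt (Vfun Pi s) * x.
have mY1 : measurable_fun setT Y1 by exact: measurable_funM.
have mY2 : measurable_fun setT Y2 by exact: measurable_funM.
have H := @cos_rep_compare R _ _ _ _ P (@normal_prob R 0 1) Y1 Y2 mY1 mY2 f g C 0 (7 * Verr s) fg
  (fun u => X_char_compare u s01).
have fn x : `|f x| <= 1 by have /andP[f0 f1] := f01 x; rewrite ger0_norm.
have fn1 x : `|1 - f x| <= 1 by have /andP[f0 f1] := f01 x; rewrite ger0_norm; lra.
have mf1 : measurable_fun setT (fun w => f (Y1 w - 0)).
  by apply: (measurableT_comp mf); exact: measurable_funB.
have mf2 : measurable_fun setT (fun x => f (Y2 x - 0)).
  by apply: (measurableT_comp mf); exact: measurable_funB.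
have if1 := @integrable_prob_bounded R _ _ P _ 1 mf1 (fun w => fn _).
have if2 := @integrable_prob_bounded R _ _ (@normal_prob R 0 1) _ 1 mf2 (fun w => fn _).
apply: (@le_trans _ _ (\int[P]_w (1 - f (Y1 w - 0)))%:E).
  apply: (@prob_le_Rintegral _ _ P _ _ 1) => //.
  - exact: measurable_normX_ge.
  - exact: measurable_funB.
  - move=> w; rewrite indicE; case: (boolP (w \in _)) => [|_]; last first.
      by have /andP[_ f1] := f01 (Y1 w - 0); rewrite subr_ge0.
    rewrite inE/= => aw; rewrite fb ?subr0// /Y1 normrM normfV (gtr0_norm s0).
    by rewrite ler_pdivlMr.
rewrite lee_fin.
have ic1 : P.-integrable setT (EFin \o cst (1 : R)).
  by apply: (@integrable_prob_bounded R _ _ P _ 1) => // w; rewrite normr1.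
have ic2 : (@normal_prob R 0 1).-integrable setT (EFin \o cst (1 : R)).
  by apply: (@integrable_prob_bounded R _ _ (@normal_prob R 0 1) _ 1) => // w; rewrite normr1.
have E1 : \int[P]_w (1 - f (Y1 w - 0)) = 1 - \int[P]_w f (Y1 w - 0).
  by rewrite RintegralB// Rintegral_prob_cst.
have E2 : \int[@normal_prob R 0 1]_w (1 - f (Y2 w - 0)) = 1 - \int[@normal_prob R 0 1]_w f (Y2 w - 0).
  by rewrite RintegralB// Rintegral_prob_cst.
have : \int[@normal_prob R 0 1]_w (1 - f (Y2 w - 0)) <= 2 * Gfun a s.
  (* If V(s) = 0 the comparison law is the point mass at 0, where 1 - f vanishes; this agrees with
     the convention G = 0. *)
  rewrite /Gfun; case: ifPn => [/eqP V0|V0].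
    under eq_Rintegral do rewrite subr0 /Y2 V0 sqrtr0 mul0r fa ?normr0// subrr.
    by rewrite Rintegral_prob_cst mulr0.
  have Vp : 0 < Vfun Pi s by rewrite lt_def V0 Vfun_ge0.
  have sV : 0 < Num.sqrt (Vfun Pi s) by rewrite sqrtr_gt0.
  rewrite -lee_fin.
  have y0 : 0 <= a / Num.sqrt (Vfun Pi s) by rewrite divr_ge0// ltW.
  have := normal_tail_le y0.
  rewrite exprMn exprVn sqr_sqrtr ?Vfun_ge0//.
  rewrite (_ : a ^+ 2 / Vfun Pi s / 2 = a ^+ 2 / (2 * Vfun Pi s)); last by field.
  apply: le_trans.
  apply: (@prob_ge_Rintegral _ _ (@normal_prob R 0 1) _ _ 1) => //.
  - have -> : [set x : R | a / Num.sqrt (Vfun Pi s) <= `|x|] =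
      setT `&` (Num.norm : R -> R) @^-1` `[(a / Num.sqrt (Vfun Pi s)), +oo[%classic.
      by rewrite setTI; apply/seteqP; split => x /=; rewrite in_itv/= andbT.
    exact: normr_measurable.
  - exact: measurable_funB.
  - move=> x; rewrite indicE; case: (boolP (x \in _)) => [_|].
      by rewrite [true%:R](_ : _ = 1)// lerBlDr lerDl; have /andP[] := f01 (Y2 x - 0).
    rewrite notin_setE/= => /negP; rewrite -ltNge => xa.
    rewrite fa ?subrr// subr0 /Y2 normrM (gtr0_norm sV) mulrC.
    by rewrite -ler_pdivlMr// ltW.
rewrite E1 E2 => h; move: H; rewrite ler_norml => /andP[H _].
lra.
Qed.

(** The test function is centred at b + delta/2. Its support, of half-width delta/2, lies above b;
    its flat part, of half-width delta/4, reaches up to b + 3 delta/4, where the Gaussian density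
    still exceeds the one at b + delta. *)
Lemma lower_tail (b delta e : R) : 0 <= b -> 0 < delta -> `|e| = 1 ->
  exists c C : R, [/\ 0 < c, 0 <= C & forall s : R, 0 < s <= 1 ->
  ((c * Gfun (b + delta) s - C * Verr s)%:E <=
   P [set w | (b * s <= e * X (s ^+ 2) w)%R])%E].
Proof.
move=> b0 d0 e1.
have ad : 0 <= delta / 4 < delta / 2 by apply/andP; split; lra.
have [f [[g [C fg]] mf f01 fa fb]] := plateau_exists ad.
have C0 := cos_rep_C_ge0 fg.
have K0 : 0 <= @cauchy_mass R by apply: Rintegral_ge0 => x _; rewrite invr_ge0 addr_ge0 ?sqr_ge0.
(* Bounds sqrt(V(s)) for all s <= 1, so that the flat part, divided by sqrt(V(s)), keeps a length of
   at least delta / (2 M). The added 1 makes [M] positive. *)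
pose M := Num.sqrt (Vfun Pi 1 + 1).
have M0 : 0 < M by rewrite sqrtr_gt0 ltr_wpDl ?Vfun_ge0.
have p0 : 0 < @normal_peak R 1 by rewrite normal_peak_gt0 ?oner_eq0.
pose c := delta / 2 / M * normal_peak 1.
have cp : 0 < c by rewrite mulr_gt0// divr_gt0// divr_gt0.
exists c, (7 * C * @cauchy_mass R); split.
  exact: cp.
  by rewrite !mulr_ge0.
move=> s s01; have /andP[s0 s1] := s01.
pose c0 := b + delta / 2.
pose Y1 w := e * (X (s ^+ 2) w / s).
pose Y2 (x : measurableTypeR R) := Num.sqrt (Vfun Pi s) * x.
have mY1 : measurable_fun setT Y1 by apply: measurable_funM => //; exact: measurable_funM.
have mY2 : measurable_fun setT Y2 by exact: measurable_funM.
(* A sign [e] amounts to replacing u by e u: Gaussian cosine integrals are even in u, and Gaussian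
   sine integrals are 0. *)
have cmp u : `|\int[P]_w cos (u * Y1 w) - \int[@normal_prob R 0 1]_x cos (u * Y2 x)| +
  `|\int[P]_w sin (u * Y1 w) - \int[@normal_prob R 0 1]_x sin (u * Y2 x)| <=
  (7 * Verr s) * (1 + `|u|) ^+ 3.
  have H := X_char_compare (e * u) s01.
  have := H; rewrite normrM e1 mul1r; apply: le_trans.
  rewrite /Y1 /Y2.
  under eq_Rintegral do rewrite mulrCA mulrA.
  under [X in _ + `|X - _|]eq_Rintegral do rewrite mulrCA mulrA.
  have cE x : cos (e * u * x) = cos (u * x).
    by rewrite -cos_norm -[RHS]cos_norm !normrM e1 mul1r.
  under [X in _ <= `|_ - X| + _]eq_Rintegral do rewrite cE.
  rewrite lerD2l.
  under [X in `|_ - X| <= _]eq_Rintegral do rewrite mulrA.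
  under [X in _ <= `|_ - X|]eq_Rintegral do rewrite mulrA.
  by rewrite !normal_sin.
have H := @cos_rep_compare R _ _ _ _ P (@normal_prob R 0 1) Y1 Y2 mY1 mY2 f g C c0 (7 * Verr s) fg cmp.
have fn x : `|f x| <= 1 by have /andP[f0 f1] := f01 x; rewrite ger0_norm.
have mf1 : measurable_fun setT (fun w => f (Y1 w - c0)).
  by apply: (measurableT_comp mf); exact: measurable_funB.
have mf2 : measurable_fun setT (fun x => f (Y2 x - c0)).
  by apply: (measurableT_comp mf); exact: measurable_funB.
apply: (@le_trans _ _ (\int[P]_w f (Y1 w - c0))%:E); last first.
  apply: (@prob_ge_Rintegral _ _ P _ _ 1) => //; first exact: measurable_X_ge.
  move=> w; rewrite indicE; case: (boolP (w \in _)) => [_|].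
    by have /andP[_] := f01 (Y1 w - c0).
  rewrite notin_setE/= => /negP; rewrite -ltNge => ws.
  rewrite fb// ler_normr; apply/orP; right.
  have : Y1 w < b by rewrite /Y1 mulrA ltr_pdivrMr.
  by rewrite /c0; lra.
rewrite lee_fin.
have : c * Gfun (b + delta) s <= \int[@normal_prob R 0 1]_w f (Y2 w - c0).
  rewrite /Gfun; case: ifPn => [/eqP V0|V0].
    rewrite mulr0; apply: Rintegral_ge0 => x _.
    by have /andP[] := f01 (Y2 x - c0).
  have Vp : 0 < Vfun Pi s by rewrite lt_def V0 Vfun_ge0.
  have sV : 0 < Num.sqrt (Vfun Pi s) by rewrite sqrtr_gt0.
  have sVM : Num.sqrt (Vfun Pi s) <= M.
    rewrite /M ler_sqrt.
      have s11 : (s <= 1) && ((1 : R) <= 1) by rewrite s1 lexx.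
      by apply: le_trans (Vfun_le s11) _; rewrite lerDl.
    by rewrite addr_ge0 ?Vfun_ge0.
  pose u := (b + delta / 4) / Num.sqrt (Vfun Pi s).
  pose v := (b + 3 * delta / 4) / Num.sqrt (Vfun Pi s).
  have uv : 0 <= u <= v.
    rewrite /u /v ler_pM2r ?invr_gt0//; apply/andP; split; last lra.
    by rewrite divr_ge0 ?(ltW sV)// addr_ge0// divr_ge0// ltW.
  rewrite -lee_fin.
  apply: (@le_trans _ _ (@normal_prob R 0 1 `[u, v]%classic)).
    apply: le_trans (normal_itv_ge uv); rewrite lee_fin.
    apply: ler_pM; [exact: ltW cp|exact: expR_ge0| |].
      rewrite ler_wpM2r ?(ltW p0)// /u /v -mulrBl.
      rewrite (_ : b + 3 * delta / 4 - (b + delta / 4) = delta / 2); last by field.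
      by rewrite ler_pM2l ?lef_pV2 ?posrE// divr_gt0.
    rewrite ler_expR lerN2 /v exprMn exprVn sqr_sqrtr ?Vfun_ge0//.
    rewrite (_ : _ / _ / 2 = (b + 3 * delta / 4) ^+ 2 / (2 * Vfun Pi s)); last by field.
    rewrite ler_pM2r ?invr_gt0 ?mulr_gt0// lerXn2r ?nnegrE//; lra.
  rewrite /Rintegral fineK; last first.
    have if2 := @integrable_prob_bounded R _ _ (@normal_prob R 0 1) _ 1 mf2 (fun w => fn _).
    exact: (integrable_fin_num measurableT if2).
  rewrite -[leLHS]mul1e -integral_cst// integral_mkcond.
  apply: ge0_le_integral => //.
  - by move=> x _; apply: erestrict_ge0 => y _; rewrite lee_fin.
  - by apply/(measurable_restrictT _ _).1 => //; exact: measurable_cst.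
  - by apply/measurable_EFinP.
  move=> x _; rewrite patchE; case: ifPn => [|_]; last first.
    by rewrite lee_fin; have /andP[] := f01 (Y2 x - c0).
  rewrite inE/= in_itv/= => /andP[ux xv]; rewrite lee_fin fa//.
  move: ux xv; rewrite /u /v ler_pdivrMr// ler_pdivlMr// => ux xv.
  by rewrite /Y2 /c0 mulrC ler_norml; apply/andP; split; lra.
move=> h; move: H; rewrite ler_norml => /andP[H _].
lra.
Qed.

End process.
End levy_char.

(** * V, J and G near 0, and their sums over geometric scales *)

Section small_times.
Context {R : realType}.
Variables (gamma : R) (Pi : {measure set R -> \bar R}).
Hypothesis hPi2 : (\int[Pi]_x (x ^+ 2)%:E < +oo)%E.
Notation D := (`[-1, 1]%classic : set R).
Notation V := (Vfun Pi).
Notation G := (Gfun Pi).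
Notation J := (Jfun Pi).
Notation Er := (Verr gamma Pi).
Notation mu := (@lebesgue_measure R).

Lemma Vfun_setT (s : R) : V s = \int[Pi]_y (if `|y| <= s then y ^+ 2 else 0).
Proof.
rewrite /Vfun Rintegral_mkcond; apply: eq_Rintegral => y _; rewrite patchE.
rewrite (_ : (y \in _) = (`|y| <= s)); last by apply/idP/idP; rewrite inE.
by case: ifP.
Qed.

Lemma Vfun_homo : {homo V : s s' / s <= s'}.
Proof.
move=> s s' ss'; rewrite !Vfun_setT.
apply: le_Rintegral => //; [exact: integrable_V|exact: integrable_V|move=> y _].
case: ifPn => ys; first by rewrite (le_trans ys ss').
by case: ifPn => _ //; rewrite sqr_ge0.
Qed.

Lemma Gfun_homo (a : R) : {homo G a : s s' / s <= s'}.
Proof.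
move=> s s' ss'; rewrite /Gfun; have Vss := Vfun_homo ss'.
case: ifPn => [_|Vs]; first by case: ifPn => // _; exact: expR_ge0.
have V0 : 0 < V s by rewrite lt_def Vs Vfun_ge0.
have V0' : 0 < V s' by exact: lt_le_trans Vss.
rewrite ifF ?gt_eqF// ler_expR lerN2 ler_wpM2l ?sqr_ge0//.
by rewrite lef_pV2 ?posrE ?mulr_gt0// ler_pM2l.
Qed.

Lemma Gfun_le1 (a s : R) : G a s <= 1.
Proof.
rewrite /Gfun; case: ifPn => // _.
by rewrite -expR0 ler_expR oppr_le0 divr_ge0 ?sqr_ge0// mulr_ge0// Vfun_ge0.
Qed.

(** From exp x >= x at x = a^2 / (2 V(s)). It makes G vanish together with V, which is what
    convergence in probability needs. *)
Lemma Gfun_le_V (a s : R) : 0 < a -> G a s <= 2 * V s / a ^+ 2.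
Proof.
move=> a0; rewrite /Gfun; case: ifPn => [/eqP ->|Vs]; first by rewrite mulr0 mul0r.
have V0 : 0 < V s by rewrite lt_def Vs Vfun_ge0.
rewrite expRN -[leRHS]invrK lef_pV2 ?posrE ?expR_gt0 ?invr_gt0 ?divr_gt0 ?mulr_gt0 ?exprn_gt0//.
rewrite invf_div; apply: le_trans (expR_ge1Dx _); by rewrite lerDr.
Qed.

(* Makes the sum of [jump_weight] over a geometric progression telescope. *)
Let psi (x : R) : R := if x <= 1 then x else 2 - x^-1.

Let psi_ge0 x : 0 <= x -> 0 <= psi x.
Proof.
move=> x0; rewrite /psi; case: ifPn => // ; rewrite -ltNge => x1.
have : x^-1 <= 1 by rewrite invf_le1 ?(ltW x1)// (lt_trans _ x1).
lra.
Qed.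

Let psi_le2 x : psi x <= 2.
Proof.
rewrite /psi; case: ifPn => x1; first lra.
rewrite -ltNge in x1.
have : 0 <= x^-1 by rewrite invr_ge0; lra.
lra.
Qed.

Let jump_weight_psi (q x : R) : 0 < q < 1 -> 0 <= x ->
  jump_weight x * (1 - q) <= psi (x / q) - psi x.
Proof.
move=> /andP[q0 q1] x0; rewrite /jump_weight /psi ler_pdivrMr// mul1r.
case: ifPn => x1; last first.
  rewrite -ltNge in x1; rewrite ifF; last by apply/negP => xq; lra.
  by rewrite invf_div le_eqVlt; apply/orP; left; apply/eqP; field; rewrite gt_eqF// (lt_trans _ x1).
case: ifPn => xq.
  rewrite -subr_ge0 (_ : _ - _ = x * (1 - q) ^+ 2 / q); last by field; rewrite gt_eqF.
  apply: divr_ge0; last exact: ltW.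
  by apply: mulr_ge0 => //; exact: sqr_ge0.
rewrite -ltNge in xq.
have x0' : 0 < x by exact: lt_trans xq.
(* The mixed case q < x <= 1: here q (1 + x) <= 2 q < 2 x, so both factors of the numerator below
   are nonnegative. *)
rewrite invf_div -subr_ge0.
rewrite (_ : _ - _ = ((1 - x) * (2 * x - q * (1 + x))) / x); last by field; rewrite gt_eqF.
rewrite divr_ge0// mulr_ge0 ?subr_ge0//.
nra.
Qed.

(** Each term times 1 - q is at most an increment of [psi] along the progression; the bound is
    uniform in x because [psi] stays in [0, 2]. This is the bounded number of scales contributed by
    one jump. *)
Lemma sum_jump_weight_le (q x : R) (N : nat) : 0 < q < 1 -> 0 <= x ->
  \sum_(n < N) jump_weight (x / q ^+ n) <= 2 / (1 - q).
Proof.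
move=> q01 x0; have /andP[q0 q1] := q01.
rewrite ler_pdivlMr ?subr_gt0//.
have xn n : 0 <= x / q ^+ n by rewrite divr_ge0// exprn_ge0// ltW.
apply: (@le_trans _ _ (psi (x / q ^+ N) - psi x)); last first.
  by have := psi_le2 (x / q ^+ N); have := psi_ge0 x0; lra.
elim: N => [|N IH]; first by rewrite big_ord0 mul0r expr0 divr1 subrr.
rewrite big_ord_recr/= mulrDl.
have := jump_weight_psi q01 (xn N).
rewrite (_ : x / q ^+ N / q = x / q ^+ N.+1); last first.
  by rewrite exprSr invfM mulrA.
lra.
Qed.

Lemma sum_geometric_le (q : R) (N : nat) : 0 < q < 1 ->
  \sum_(n < N) q ^+ n <= (1 - q)^-1.
Proof.
move=> /andP[q0 q1]; rewrite -[leRHS]mul1r ler_pdivlMr ?subr_gt0//.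
suff -> : (\sum_(n < N) q ^+ n) * (1 - q) = 1 - q ^+ N.
  by rewrite gerBl exprn_ge0// ltW.
elim: N => [|N IH]; first by rewrite big_ord0 mul0r expr0 subrr.
by rewrite big_ord_recr/= mulrDl IH exprSr; ring.
Qed.

Lemma sum_Jfun (u : nat -> R) (N : nat) : (forall n, 0 < u n) ->
  \sum_(n < N) J (u n) =
  \int[Pi]_(y in D) \sum_(n < N) (y ^+ 2 * jump_weight (`|y| / u n)).
Proof.
move=> u0; have mD : measurable D by exact: measurable_itv.
suff : \sum_(n < N) J (u n) =
    \int[Pi]_(y in D) \sum_(n < N) (y ^+ 2 * jump_weight (`|y| / u n)) /\
  Pi.-integrable D (EFin \o (fun y => \sum_(n < N) (y ^+ 2 * jump_weight (`|y| / u n)))).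
  by case.
elim: N => [|N [IH1 IH2]].
  rewrite big_ord0; split.
    under eq_Rintegral do rewrite big_ord0.
    by rewrite /Rintegral integral0.
  rewrite (_ : _ \o _ = cst 0%E); first exact: integrable0.
  by apply/funext => y; rewrite /= big_ord0.
rewrite big_ord_recr/= IH1.
have iN := integrable_Jfun hPi2 (u0 N) mD.
have E : (fun y : R => \sum_(n < N.+1) (y ^+ 2 * jump_weight (`|y| / u n))) =
    (fun y => \sum_(n < N) (y ^+ 2 * jump_weight (`|y| / u n)) + y ^+ 2 * jump_weight (`|y| / u N)).
  by apply/funext => y; rewrite big_ord_recr.
rewrite E; split; last exact: (integrableD mD IH2 iN).
by rewrite [RHS](RintegralD mD IH2 iN).
Qed.

Lemma sum_Verr_ub (q k : R) : 0 < q < 1 -> 0 < k ->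
  exists M : R, forall N : nat, \sum_(n < N) Er (k * q ^+ n) <= M.
Proof.
move=> q01 k0; have /andP[q0 q1] := q01.
have mD : measurable D by exact: measurable_itv.
exists (`|gamma| * (k / (1 - q)) + (2 / (1 - q)) * \int[Pi]_(y in D) y ^+ 2) => N.
have u0 n : 0 < k * q ^+ n by rewrite mulr_gt0// exprn_gt0.
rewrite big_split/= lerD//.
  by rewrite -mulr_sumr ler_wpM2l// -mulr_sumr ler_pM2l// sum_geometric_le.
rewrite (@sum_Jfun (fun n => k * q ^+ n))//.
have i2 : Pi.-integrable D (EFin \o (fun y : R => y ^+ 2)).
  by apply: (integrableS measurableT) => //; exact: integrable_sqr.
rewrite -(RintegralZl _ mD i2).
apply: le_Rintegral => //.
- apply: (integrable_sqr_dom hPi2 (C := 2 / (1 - q)) mD).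
    by apply: measurable_sum => n; exact: measurable_Jfun_integrand.
  move=> y; rewrite -mulr_sumr normrM ger0_norm ?sqr_ge0// mulrC ler_wpM2r ?sqr_ge0//.
  have H n : `|y| / (k * q ^+ n) = (`|y| / k) / q ^+ n by rewrite invfM mulrA.
  under eq_bigr do rewrite H.
  rewrite ger0_norm; last first.
    apply: sumr_ge0 => n _; rewrite jump_weight_ge0// !divr_ge0// ?exprn_ge0 ?ltW//.
  by rewrite sum_jump_weight_le// divr_ge0// ltW.
- exact: (integrableZl mD _ i2).
move=> y _; rewrite -mulr_sumr mulrC ler_wpM2r ?sqr_ge0//.
have H n : `|y| / (k * q ^+ n) = (`|y| / k) / q ^+ n by rewrite invfM mulrA.
under eq_bigr do rewrite H.
by rewrite sum_jump_weight_le// divr_ge0// ltW.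
Qed.

Lemma Vfun_cvg0 : V s @[s --> 0^'+] --> (0 : R).
Proof.
apply/cvg_at_rightP => u [u0 ul].
under eq_fun do rewrite Vfun_setT.
suff : \int[Pi]_y (if `|y| <= u n then y ^+ 2 else 0) @[n --> \oo] --> \int[Pi]_y (0 : R).
  by rewrite /Rintegral integral0.
apply: fine_cvg; rewrite fineK; last by rewrite integral0.
apply: (@dominated_cvg _ _ _ Pi setT measurableT _ _ (fun y => (y ^+ 2)%:E)) => //.
- by move=> n; apply: (measurable_int Pi); exact: integrable_V.
- move=> y _; apply: cvg_near_cst.
  have [->|y0] := eqVneq y 0.
    by apply: nearW => n; case: ifP => // _; rewrite expr0n.
  have ny : 0 < `|y| by rewrite normr_gt0.
  have : \forall n \near \oo, u n < `|y| by apply: (cvgr_lt (0:R)).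
  apply: filterS => n un.
  by rewrite ifF// leNgt un.
- exact: integrable_sqr.
- move=> n y _; rewrite lee_fin; case: ifP => _; first by rewrite ger0_norm ?sqr_ge0.
  by rewrite normr0 sqr_ge0.
Qed.

(** Dominated convergence under y^2: for fixed y other than 0 and small s, the weight is s / |y|. *)
Lemma Jfun_cvg0 : J s @[s --> 0^'+] --> (0 : R).
Proof.
have mD : measurable D by exact: measurable_itv.
apply/cvg_at_rightP => u [u0 ul].
suff : J (u n) @[n --> \oo] --> \int[Pi]_(y in D) (0 : R).
  by rewrite /Rintegral integral0.
apply: fine_cvg; rewrite fineK; last by rewrite integral0.
apply: (@dominated_cvg _ _ _ Pi D mD _ _ (fun y => (y ^+ 2)%:E)) => //.
- by move=> n; apply: (measurable_int Pi); exact: integrable_Jfun.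
- move=> y _.
  have [->|y0] := eqVneq y 0.
    by apply: cvg_near_cst; apply: nearW => n; rewrite expr0n/= mul0r.
  have ny : 0 < `|y| by rewrite normr_gt0.
  apply: cvg_EFin; first by near=> n.
  apply: (@cvg_trans _ ((fun n => y ^+ 2 * (u n / `|y|)) @ \oo)).
    apply: near_eq_cvg.
    have : \forall n \near \oo, u n < `|y| by apply: (cvgr_lt (0:R)).
    apply: filterS => n un /=; rewrite /jump_weight ifF ?invf_div//.
    by rewrite ler_pdivrMr// mul1r leNgt un.
  suff : y ^+ 2 * (u n / `|y|) @[n --> \oo] --> y ^+ 2 * (0 / `|y|) by rewrite mul0r mulr0.
  by apply: cvgMr; apply: cvgMl.
- by apply: (integrableS measurableT) => //; exact: integrable_sqr.
- move=> n y _; rewrite lee_fin.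
  have w0 : 0 <= `|y| / u n by rewrite divr_ge0// ltW.
  rewrite ger0_norm; last by rewrite mulr_ge0 ?sqr_ge0 ?jump_weight_ge0.
  by rewrite ler_piMr ?sqr_ge0// jump_weight_le1.
Unshelve. all: by end_near. Qed.

Lemma Verr_cvg0 : Er s @[s --> 0^'+] --> (0 : R).
Proof.
rewrite -[X in _ --> X]addr0; apply: cvgD; last exact: Jfun_cvg0.
rewrite -[X in _ --> X](mulr0 `|gamma|); apply: cvgMr.
by apply: cvg_at_right_filter; exact: cvg_id.
Qed.

Lemma measurable_I_integrand (a : R) :
  measurable_fun setT (fun x : R => x^-1 * G a x).
Proof.
apply: measurable_funM; first exact: measurable_fun_inv.
by apply: nondecreasing_measurable => //; exact: Gfun_homo.
Qed.

Let h (a x : R) : \bar R := (x^-1 * G a x)%:E.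

Let mh (a : R) (E : set R) : measurable_fun E (h a).
Proof. by apply: measurable_funTS; apply/measurable_EFinP; exact: measurable_I_integrand. Qed.

Let h_ge0 (a x : R) : 0 < x -> (0 <= h a x)%E.
Proof. by move=> x0; rewrite lee_fin mulr_ge0 ?Gfun_ge0// invr_ge0 ltW. Qed.

(** On a geometric interval 1/x decreases while [G a] increases. Each factor is bounded by its value
    at its own extremal endpoint, and the length q^n (1 - q) turns the power of q into a
    constant. *)
Let piece (a q : R) (n : nat) : 0 < q < 1 ->
  (((1 - q) * G a (q ^+ n.+1))%:E <= \int[mu]_(x in `](q ^+ n.+1)%R, (q ^+ n)%R]) h a x)%E /\
  (\int[mu]_(x in `](q ^+ n.+1)%R, (q ^+ n)%R]) h a x <= ((q^-1 - 1) * G a (q ^+ n))%:E)%E.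
Proof.
move=> /andP[q0 q1].
have qn m : 0 < q ^+ m by rewrite exprn_gt0.
have len : mu `]q ^+ n.+1, q ^+ n]%classic = (q ^+ n * (1 - q))%:E.
  rewrite lebesgue_measure_itv/= lte_fin exprSr gtr_pMr// q1 -EFinB.
  by congr EFin; ring.
split.
  apply: (@le_trans _ _ (\int[mu]_(x in `](q ^+ n.+1)%R, (q ^+ n)%R]) ((q ^+ n)^-1 * G a (q ^+ n.+1))%:E)%E).
    rewrite integral_cst//= len -EFinM lee_fin le_eqVlt; apply/orP; left; apply/eqP.
    by field; rewrite gt_eqF.
  apply: ge0_le_integral => //.
  - by move=> x _; rewrite lee_fin mulr_ge0 ?Gfun_ge0// invr_ge0 ltW.
  - exact: mh.
  move=> x; rewrite /= in_itv/= => /andP[x1 x2]; rewrite lee_fin.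
  have x0 : 0 < x by exact: lt_trans x1.
  apply: ler_pM; rewrite ?Gfun_ge0 ?invr_ge0 ?(ltW (qn _))//.
    by rewrite lef_pV2 ?posrE.
  by rewrite Gfun_homo// ltW.
apply: (@le_trans _ _ (\int[mu]_(x in `](q ^+ n.+1)%R, (q ^+ n)%R]) ((q ^+ n.+1)^-1 * G a (q ^+ n))%:E)%E).
  apply: ge0_le_integral => //.
  - by move=> x; rewrite /= in_itv/= => /andP[x1 x2]; apply: h_ge0; exact: lt_trans x1.
  - exact: mh.
  move=> x; rewrite /= in_itv/= => /andP[x1 x2]; rewrite lee_fin.
  have x0 : 0 < x by exact: lt_trans x1.
  by rewrite ler_pM ?Gfun_ge0 ?invr_ge0 ?(ltW x0)// ?Gfun_homo// lef_pV2 ?posrE// ltW.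
rewrite integral_cst//= len -EFinM lee_fin le_eqVlt; apply/orP; left; apply/eqP.
by rewrite exprSr; field; rewrite !gt_eqF.
Qed.

Let pieces (a q : R) (N : nat) : 0 < q < 1 ->
  (\int[mu]_(x in `](q ^+ N)%R, 1%R]) h a x =
   \sum_(n < N) \int[mu]_(x in `](q ^+ n.+1)%R, (q ^+ n)%R]) h a x)%E.
Proof.
move=> /andP[q0 q1].
have qn m : 0 < q ^+ m by rewrite exprn_gt0.
elim: N => [|N IH]; first by rewrite big_ord0 expr0 set_itvoc0 integral_set0.
rewrite big_ord_recr/= -IH addeC.
have -> : `]q ^+ N.+1, 1]%classic = `]q ^+ N.+1, q ^+ N] `|` `]q ^+ N, 1] :> set R.
  rewrite -(@itv_bndbnd_setU _ _ _ (BRight (q ^+ N)))//= bnd_simp.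
    by rewrite exprSr ler_piMr// ltW.
  by rewrite exprn_ile1// ltW.
rewrite ge0_integral_setU//.
- exact: mh.
- move=> x [|] /=; rewrite in_itv/= => /andP[x1 _]; apply: h_ge0.
    exact: lt_trans x1.
  exact: lt_trans x1.
- apply/disj_setPS => x [/=]; rewrite !in_itv/= => /andP[_ x1] /andP[x2 _].
  by have := lt_le_trans x2 x1; rewrite ltxx.
Qed.

Lemma IfunE (a : R) : Ifun Pi a = (\int[mu]_(x in `]0%R, 1%R]) h a x)%E.
Proof. by []. Qed.

Lemma sum_Gfun_ub (a q : R) : 0 < q < 1 -> (Ifun Pi a < +oo)%E ->
  exists M : R, forall N : nat, \sum_(n < N) G a (q ^+ n) <= M.
Proof.
move=> q01; rewrite IfunE => Ioo; have /andP[q0 q1] := q01.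
have I0 : (0 <= \int[mu]_(x in `]0%R, 1%R]) h a x)%E.
  by apply: integral_ge0 => x; rewrite /= in_itv/= => /andP[x0 _]; exact: h_ge0.
(* The integral controls only the scales q^{n+1}; the term at scale 1 is paid for by G <= 1. *)
exists (1 + (1 - q)^-1 * fine (\int[mu]_(x in `]0%R, 1%R]) h a x)%E) => N.
apply: (@le_trans _ _ (\sum_(n < N.+1) G a (q ^+ n))).
  by rewrite big_ord_recr/= lerDl Gfun_ge0.
rewrite big_ord_recl lerD ?Gfun_le1//= mulrC ler_pdivlMr ?subr_gt0//.
rewrite -lee_fin fineK; last by rewrite ge0_fin_numE.
apply: (@le_trans _ _ (\int[mu]_(x in `](q ^+ N)%R, 1%R]) h a x)%E).
  rewrite pieces// mulr_suml -sumEFin; apply: lee_sum => n _.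
  by have [+ _] := piece a n q01; rewrite mulrC.
apply: ge0_subset_integral => //.
- exact: mh.
- by move=> x; rewrite /= in_itv/= => /andP[x0 _]; exact: h_ge0.
- move=> x; rewrite /= !in_itv/= => /andP[x0 ->]; rewrite andbT.
  by apply: lt_trans x0; rewrite exprn_gt0.
Qed.

(** The factor [k] is the one relating increments to scales. As q <= k, the scale k q^n is at least
    q^{n+1}, so monotonicity of G reduces to k = 1 up to a shift of the index. *)
Lemma sum_Gfun_lb (a q k : R) : 0 < q < 1 -> q <= k -> (Ifun Pi a = +oo)%E ->
  forall M : R, exists N : nat, M < \sum_(n < N) G a (k * q ^+ n).
Proof.
move=> q01 qk Ioo M; have /andP[q0 q1] := q01.
have qn m : 0 < q ^+ m by rewrite exprn_gt0.
apply: contrapT => /forallNP H.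
have {}H N : \sum_(n < N) G a (k * q ^+ n) <= M by rewrite leNgt; apply/negP/H.
have H1 N : \sum_(n < N) G a (q ^+ n) <= 1 + M.
  apply: (@le_trans _ _ (\sum_(n < N.+1) G a (q ^+ n))).
    by rewrite big_ord_recr/= lerDl Gfun_ge0.
  rewrite big_ord_recl lerD ?Gfun_le1//=; apply: le_trans (H N).
  apply: ler_sum => n _; apply: Gfun_homo; rewrite /bump/= add1n exprS.
  by rewrite ler_wpM2r// ltW.
have H2 N : (\int[mu]_(x in `](q ^+ N)%R, 1%R]) h a x <= ((q^-1 - 1) * (1 + M))%:E)%E.
  rewrite pieces//; apply: (@le_trans _ _ (\sum_(n < N) ((q^-1 - 1) * G a (q ^+ n))%:E)%E).
    by apply: lee_sum => n _; have [] := piece a n q01.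
  rewrite sumEFin lee_fin -mulr_sumr ler_wpM2l// subr_ge0 invf_ge1// ltW//.
(* Monotone convergence along the intervals (q^N, 1] would make I(a) finite if the sums stayed
   bounded. *)
have c := @ge0_nondecreasing_set_cvg_integral _ _ _ (fun N => `]q ^+ N, 1]%classic : set (measurableTypeR R)) (h a) mu.
have : (\int[mu]_(x in `](q ^+ N)%R, 1%R]) h a x)%E @[N --> \oo] -->
  (\int[mu]_(x in \bigcup_N `](q ^+ N)%R, 1%R]%classic) h a x)%E.
  apply: c.
  - move=> m n mn; apply/subsetPset => x /=; rewrite !in_itv/= => /andP[x1 ->].
    rewrite andbT; apply: le_lt_trans x1.
    by rewrite ler_wiXn2l// ltW.
  - by move=> N; exact: measurable_itv.
  - by move=> N; exact: mh.
  - by move=> N x; rewrite /= in_itv/= => /andP[x1 _]; apply: h_ge0; exact: lt_trans x1.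
have -> : \bigcup_N `](q ^+ N)%R, 1%R]%classic = `]0%R, 1%R]%classic :> set R.
  apply/seteqP; split => x.
    by move=> [N _]; rewrite /= !in_itv/= => /andP[x1 ->]; rewrite andbT; exact: lt_trans x1.
  rewrite /= in_itv/= => /andP[x0 x1].
  have : \forall n \near \oo, q ^+ n < x.
    have cq : (fun n => q ^+ n) @ \oo --> (0 : R).
      by apply: cvg_expr; rewrite ger0_norm// ltW.
    by apply: (cvgr_lt (0 : R)).
  move=> [N _ /(_ N (leqnn N))/= Nx]; exists N => //.
  by rewrite /= in_itv/= Nx.
rewrite -IfunE Ioo => cI.
have := lime_le (cvgP _ cI) (nearW _ H2) => /(_ _ _).
by rewrite (cvg_lim _ cI)// leye_eq.
Qed.

End small_times.

(** * Extending independence from cylinders to a generated sigma-algebra *)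

Section independence.
Context {R : realType} {d : measure_display} {T : measurableType d}.
Variables (P : probability T R) (Y : nat -> T -> R) (k : nat) (F : set T).
Hypothesis mY : forall i, measurable_fun setT (Y i).
Hypothesis mF : measurable F.

(** Events of the shape handled by [levy_indep]; they are stable under intersection and generate the
    past of the first [k] variables. *)
Definition rectangles : set (set T) := [set A | exists B : nat -> set R,
  (forall i, measurable (B i)) /\
  A = [set w | forall i, (i < k)%N -> B i (Y i w)]].

Lemma measurable_rectangles A : rectangles A -> measurable A.
Proof.
move=> [B [mB ->]].
rewrite (_ : [set _ | _] = \bigcap_(i in [set i | (i < k)%N]) (Y i @^-1` B i)).
  apply: bigcap_measurableType => i _.
  by rewrite -[X in measurable X]setTI; exact: mY.
by apply/seteqP; split => w /= h i; exact: h.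
Qed.

Lemma setI_closed_rectangles : setI_closed rectangles.
Proof.
move=> _ _ [B [mB ->]] [C [mC ->]]; exists (fun i => B i `&` C i); split.
  by move=> i; exact: measurableI.
apply/seteqP; split => w /=.
  by move=> [hB hC] i ik; split; [exact: hB|exact: hC].
by move=> h; split => i /h [].
Qed.

Lemma rectangles_setT : rectangles setT.
Proof.
exists (fun=> setT); split; first by move=> i; exact: measurableT.
by apply/seteqP; split.
Qed.

Hypothesis indF : forall A, rectangles A -> (P (A `&` F) = P A * P F)%E.

(** Uniqueness of measures on a pi-system: the finite measures A -> P(A and F) and A -> P(F) P(A)
    agree on rectangles, setT included. *)
Lemma independent_g_sigma (E : set T) : <<s rectangles >> E ->
  (P (E `&` F) = P E * P F)%E.
Proof.
move=> sE.
pose H := [set X | rectangles X /\ X `<=` setT].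
have HE : H = rectangles.
  by apply/seteqP; split => X /=; [case|].
have r0 : 0 <= fine (P F) by rewrite fine_ge0.
pose m1 : {measure set T -> \bar R} := mrestr P mF.
pose m2 : {measure set T -> \bar R} := mscale (NngNum r0) P.
have m12 A : rectangles A -> m1 A = m2 A.
  move=> rA; have -> : m2 A = ((fine (P F))%:E * P A)%E by [].
  by rewrite fineK ?fin_num_measure// muleC -indF.
have := @g_sigma_algebra_measure_unique_trace d R T rectangles setT measurableT.
rewrite -/H HE => /(_ _ setI_closed_rectangles m1 m2).
move=> /(_ measurable_rectangles (m12 _ rectangles_setT) m12) U.
have m1oo : (m1 setT < +oo)%E.
  have -> : m1 setT = P (setT `&` F) by [].
  by rewrite setTI (le_lt_trans (probability_le1 _ _))// ltry.
have := U m1oo (fun X _ => @subsetT _ X) E sE.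
have -> : m2 E = ((fine (P F))%:E * P E)%E by [].
by rewrite fineK ?fin_num_measure// muleC => <-.
Qed.

Lemma rectangles_measurable_fun (i : nat) : (i < k)%N ->
  measurable_fun (setT : set (g_sigma_algebraType rectangles)) (Y i).
Proof.
move=> ik _ B mB; rewrite setTI; apply: sub_gen_smallest.
exists (fun j => if j == i then B else setT); split.
  by move=> j; case: ifP => // _; exact: measurableT.
apply/seteqP; split => w /=.
  by move=> Bw j jk; case: eqP => // ->.
by move=> /(_ i ik); rewrite eqxx.
Qed.

End independence.

(** * A maximal inequality for partial sums *)

Section ottaviani.
Context {R : realType} {d : measure_display} {T : measurableType d}.
Variables (P : probability T R) (Y : nat -> T -> R) (K : nat).
Hypothesis mY : forall i, measurable_fun setT (Y i).

Let S (n : nat) (w : T) : R := \sum_(i < n) Y i w.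

Let mS n : measurable_fun setT (S n).
Proof. by apply: measurable_sum => i; exact: mY. Qed.

Variables (c delta : R).

Let F (n : nat) : set T := [set w | `|S K w - S n w| <= delta].

Let mnorm_le (f : T -> R) (b : R) : measurable_fun setT f ->
  measurable [set w | `|f w| <= b].
Proof.
move=> mf; rewrite (_ : [set _ | _] = setT `&` (fun w => `|f w|) @^-1` `]-oo, b]%classic).
  by apply: (measurableT_comp (@normr_measurable _ _)).
by rewrite setTI; apply/seteqP; split => x /=; rewrite in_itv.
Qed.

Let mnorm_gt (f : T -> R) (b : R) : measurable_fun setT f ->
  measurable [set w | b < `|f w|].
Proof.
move=> mf; rewrite (_ : [set _ | _] = ~` [set w | `|f w| <= b]).
  by apply: measurableC; exact: mnorm_le.
by apply/seteqP; split => w /=; rewrite ltNge => /negP.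
Qed.

Let mF n : measurable (F n).
Proof. by apply: mnorm_le; exact: measurable_funB. Qed.

Hypothesis indF : forall n, (n <= K)%N -> forall A, rectangles Y n A ->
  (P (A `&` F n) = P A * P (F n))%E.
Hypothesis PF : forall n, (n <= K)%N -> ((2^-1)%:E <= P (F n))%E.

Let E (n : nat) : set T :=
  [set w | (forall j, (j < n)%N -> `|S j w| <= c + delta) /\ c + delta < `|S n w|].

Let sE n : <<s rectangles Y n >> (E n).
Proof.
pose T' := g_sigma_algebraType (rectangles Y n).
have mS' j : (j <= n)%N -> measurable_fun (setT : set T') (S j).
  move=> jn; apply: measurable_sum => i; apply: rectangles_measurable_fun.
  by rewrite (leq_trans _ jn).
have mN j : (j <= n)%N -> measurable ([set w | `|S j w| <= c + delta] : set T').
  move=> jn.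
  rewrite (_ : [set _ | _] = setT `&` (fun w => `|S j w|) @^-1` `]-oo, c + delta]%classic).
    apply: (measurableT_comp (@normr_measurable _ _)) => //; exact: mS'.
  by rewrite setTI; apply/seteqP; split => x /=; rewrite in_itv.
rewrite -[X in _ X]/((E n) : set T') (_ : E n =
  (\bigcap_(j in [set j | (j < n)%N]) [set w | `|S j w| <= c + delta]) `&`
  ~` [set w | `|S n w| <= c + delta]).
  have : measurable ((\bigcap_(j in [set j | (j < n)%N]) [set w | `|S j w| <= c + delta]) `&`
    ~` [set w | `|S n w| <= c + delta] : set T').
    apply: measurableI; last by apply: measurableC; exact: mN.
    by apply: bigcap_measurableType => j /= jn; apply: mN; exact: ltnW.
  by [].
apply/seteqP; split => w /= [h1 h2]; split => //.
  by rewrite leNgt h2.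
by rewrite ltNge; apply/negP.
Qed.

Let mE n : measurable (E n).
Proof.
rewrite (_ : E n = (\bigcap_(j in [set j | (j < n)%N]) [set w | `|S j w| <= c + delta]) `&`
  [set w | c + delta < `|S n w|]); last by [].
apply: measurableI; last exact: mnorm_gt.
by apply: bigcap_measurableType => j _; exact: mnorm_le.
Qed.

Let tE : trivIset setT E.
Proof.
apply/trivIsetP => i j _ _; wlog ij : i j / (i < j)%N => [hw|_].
  move=> nij; case: (ltngtP i j) nij => [ij|ji|->]; last by [].
    by move=> _; apply: hw => //; rewrite ltn_eqF.
  by move=> _; rewrite setIC; apply: hw => //; rewrite ltn_eqF.
apply/seteqP; split => // w [[_ h1] [h2 _]].
by have := h2 _ ij; rewrite leNgt h1.
Qed.

(** [E n] says that the level c + delta is first exceeded at index n. It belongs to the past, so it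
    is independent of [F n], whose probability is at least 1/2. The events [E n] are disjoint, and
    [E n] together with [F n] forces |S K| > c. *)
Lemma ottaviani : (P [set w | exists2 n, (n <= K)%N & (c + delta < `|S n w|)%R] <=
  2%:E * P [set w | (c < `|S K w|)%R])%E.
Proof.
have -> : [set w | exists2 n, (n <= K)%N & (c + delta < `|S n w|)%R] =
    \big[setU/set0]_(n < K.+1) E n.
  apply/seteqP; split => w.
    move=> [n nK wn].
    have ex : exists n, c + delta < `|S n w| by exists n.
    pose m := ex_minn ex.
    have [mw mmin] : c + delta < `|S m w| /\ (forall j, c + delta < `|S j w| -> (m <= j)%N).
      by rewrite /m; case: ex_minnP.
    rewrite -bigcup_mkord; exists m; first by rewrite /= ltnS (leq_trans (mmin _ wn)).
    split => // j jm; rewrite leNgt; apply/negP => /mmin.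
    by rewrite leqNgt jm.
  rewrite -bigcup_mkord => -[n /= nK [_ wn]]; by exists n.
rewrite measure_semi_additive_ord//; last 2 first.
  by apply/trivIsetP => i j _ _ ij; have /trivIsetP := tE; apply.
  by apply: bigsetU_measurable => n _; exact: mE.
apply: (@le_trans _ _ (2%:E * \sum_(n < K.+1) P (E n `&` F n))%E).
  rewrite ge0_sume_distrr//.
  apply: lee_sum => n _.
  have nK : (n <= K)%N by rewrite -ltnS.
  rewrite (independent_g_sigma mY (mF n) (indF nK) (@sE n)).
  rewrite muleCA -[leLHS]mule1 lee_wpmul2l//.
  rewrite -[leLHS](_ : 2%:E * (2^-1)%:E = 1)%E; last by rewrite -EFinM divff.
  by rewrite lee_wpmul2l// PF.
rewrite lee_wpmul2l//.
have tEF : trivIset setT (fun n => E n `&` F n).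
  by apply: trivIset_setIr.
have mEF (n : 'I_K.+1) : measurable (E n `&` F n) by exact: measurableI.
rewrite -(measure_semi_additive_ord P mEF)//; last 2 first.
- by apply/trivIsetP => i j _ _ ij; have /trivIsetP := tEF; apply.
- by apply: bigsetU_measurable => n _; exact: measurableI.
rewrite le_measure ?inE//.
- by apply: bigsetU_measurable => n _; exact: measurableI.
- exact: mnorm_gt.
move=> w; rewrite -(bigcup_mkord _ (fun n => E n `&` F n)) => -[n /= nK [[_ wE] wF]].
have := ler_normB (S n w) (S n w - S K w).
rewrite opprB addrCA subrr addr0.
rewrite /F/= in wF; rewrite distrC in wF.
have := ler_normD (S n w - S K w) (S K w); rewrite subrK.
lra.
Qed.

End ottaviani.

(* Splitting according to the first index n >= N at which A n occurs, the
   independence of B n from the past gives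
   P(some A n and B n both occur) >= inf P(B n) * P(some A n occurs). *)
Section borel_cantelli_converse.
Context {R : realType} {d : measure_display} {T : measurableType d}.
Variables (P : probability T R) (A B : nat -> set T).
Hypothesis mA : forall n, measurable (A n).
Hypothesis mB : forall n, measurable (B n).

Definition avoid (N n : nat) : set T := \bigcap_(j in [set j | (N <= j < n)%N]) ~` A j.

Hypothesis indA : forall N n, (N <= n)%N ->
  (P (avoid N n `&` A n) = P (avoid N n) * P (A n))%E.
Hypothesis indB : forall N n, (N <= n)%N ->
  (P (avoid N n `&` A n `&` B n) = P (avoid N n `&` A n) * P (B n))%E.
Hypothesis sumA : forall M : R, exists n, (M%:E < \sum_(i < n) P (A i))%E.
Hypothesis limB : forall e : R, 0 < e -> exists N, forall n, (N <= n)%N -> ((1 - e)%:E <= P (B n))%E.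

Lemma measurable_avoid N n : measurable (avoid N n).
Proof. by apply: bigcap_measurableType => j _; exact: measurableC. Qed.

Let a n := fine (P (A n)).
Let PA n : P (A n) = (a n)%:E.
Proof. by rewrite /a fineK// fin_num_measure. Qed.

Lemma avoidS N n : (N <= n)%N -> avoid N n.+1 = avoid N n `\` A n.
Proof.
move=> Nn; apply/seteqP; split => w /=.
  move=> h; split; last by apply: h; rewrite /= Nn ltnS leqnn.
  by move=> j /= /andP[Nj jn]; apply: h; rewrite /= Nj ltnW.
move=> [h wn] j /= /andP[Nj]; rewrite ltnS leq_eqVlt => /predU1P[->//|jn].
by apply: h; rewrite /= Nj.
Qed.

Lemma avoidnn N : avoid N N = setT.
Proof.
by apply/seteqP; split => // w _ j /= /andP[/leq_ltn_trans h /h]; rewrite ltnn.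
Qed.

Let r N n := fine (P (avoid N n)).
Let Pr N n : P (avoid N n) = (r N n)%:E.
Proof. by rewrite /r fineK// fin_num_measure//; exact: measurable_avoid. Qed.

Let rS N n : (N <= n)%N -> r N n.+1 = r N n * (1 - a n).
Proof.
move=> Nn; apply: EFin_inj; rewrite -Pr avoidS//.
transitivity (P (avoid N n) - P (avoid N n `&` A n))%E.
  apply: measureD => //; first exact: measurable_avoid.
  by rewrite [X in (X < _)%E]Pr ltry.
by rewrite indA// Pr PA -EFinM -EFinB; congr EFin; ring.
Qed.

Let r_ub N k : r N (N + k) <= expR (- \sum_(i < k) a (N + i)).
Proof.
elim: k => [|k IH].
  by rewrite addn0 big_ord0 oppr0 expR0 /r avoidnn probability_setT.
rewrite addnS rS ?leq_addr// big_ord_recr/= opprD expRD.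
have r0 : 0 <= r N (N + k) by rewrite fine_ge0.
have a1 : a (N + k) <= 1.
  by rewrite -lee_fin -PA probability_le1.
apply: ler_pM => //; first by rewrite subr_ge0.
exact: expR_ge1Dx.
Qed.

Let hit N n := \big[setU/set0]_(i < n) (avoid N (N + i) `&` A (N + i) `&` B (N + i)).

Let P_hit N n (e : R) : 0 <= e <= 1 -> (forall n, (N <= n)%N -> ((1 - e)%:E <= P (B n))%E) ->
  (((1 - e) * (1 - r N (N + n)))%:E <= P (hit N n))%E.
Proof.
move=> /andP[e0 e1] hB.
have mH i : measurable (avoid N (N + i) `&` A (N + i) `&` B (N + i)).
  by apply: measurableI => //; apply: measurableI => //; exact: measurable_avoid.
have tH : trivIset setT (fun i => avoid N (N + i) `&` A (N + i) `&` B (N + i)).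
  apply/trivIsetP => i j _ _; wlog ij : i j / (i < j)%N => [hw|_].
    case: (ltngtP i j) => [ij|ji|->]; last by [].
      by move=> _; apply: hw => //; rewrite ltn_eqF.
    by move=> _; rewrite setIC; apply: hw => //; rewrite ltn_eqF.
  apply/seteqP; split => // w [[[_ wi] _] [[wj _] _]].
  by apply: (wj (N + i)%N) => //=; rewrite leq_addr ltn_add2l.
have mH' (i : 'I_n) := mH i.
rewrite /hit (measure_semi_additive_ord P mH'); last 2 first.
- by apply/trivIsetP => i j _ _ ij; have /trivIsetP := tH; apply.
- by apply: bigsetU_measurable => i _.
(* Each product is the drop of [r N] from N + i to N + i + 1, so the sum telescopes. *)
have : 1 - r N (N + n) = \sum_(i < n) (r N (N + i) * a (N + i)).
  elim: n {mH'} => [|k IH].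
    by rewrite big_ord0 addn0 /r avoidnn probability_setT subrr.
  by rewrite big_ord_recr/= -IH addnS rS ?leq_addr//; ring.
move=> ->; rewrite mulr_sumr -sumEFin; apply: lee_sum => i _.
suff : (((1 - e) * (r N (N + i) * a (N + i)))%:E <=
   P (avoid N (N + i) `&` A (N + i) `&` B (N + i)))%E by [].
rewrite indB ?leq_addr// indA ?leq_addr// Pr PA mulrC EFinM -[X in (_ <= X * _)%E]EFinM.
by apply: lee_wpmul2l; [rewrite lee_fin mulr_ge0// fine_ge0|rewrite hB// leq_addr].
Qed.

Lemma io_prob1 N : P (\bigcup_(n >= N) (A n `&` B n)) = 1%E.
Proof.
have mU : measurable (\bigcup_(n >= N) (A n `&` B n)).
  by apply: bigcup_measurable => n _; exact: measurableI.
apply/eqP; rewrite eq_le probability_le1//=.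
apply/lee_addgt0Pr => e0 e0_gt0.
(* With r <= e, the product (1 - e)(1 - r) misses 1 by at most 2 e <= e0; the cap at 1 keeps 1 - e
   nonnegative. *)
pose e := Num.min (e0 / 2) 1.
have e_gt0 : 0 < e by rewrite lt_min divr_gt0//=.
have e_le1 : e <= 1 by rewrite ge_min lexx orbT.
have e_le : e <= e0 / 2 by rewrite ge_min lexx.
have [N1 hN1] := limB e_gt0.
pose N2 := maxn N N1.
have hB n : (N2 <= n)%N -> ((1 - e)%:E <= P (B n))%E.
  by move=> Nn; apply: hN1; apply: leq_trans Nn; exact: leq_maxr.
(* The first N2 probabilities add up to at most N2, so the later ones exceed - ln e and the
   probability of avoiding all of them is at most e. *)
have [n hn] := sumA (N2%:R - ln e).
have nN2 : (N2 < n)%N.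
  rewrite ltnNge; apply/negP => nN.
  have : (\sum_(i < n) P (A i) <= (N2%:R)%:E)%E.
    apply: (@le_trans _ _ (\sum_(i < n) 1%:E)%E).
      by apply: lee_sum => i _; exact: probability_le1.
    by rewrite sumEFin sumr_const card_ord lee_fin ler_nat.
  move=> /(lt_le_trans hn); rewrite lte_fin ltNge lerDl oppr_ge0.
  by rewrite ln_le0.
have : \sum_(i < n - N2) a (N2 + i) >= - ln e.
  have nE := subnKC (ltnW nN2); rewrite -nE in hn.
  move: hn; under eq_bigr do rewrite PA.
  rewrite sumEFin lte_fin big_split_ord/=.
  have : \sum_(i < N2) a i <= N2%:R.
    rewrite -[X in _ <= X%:R]card_ord -sumr_const; apply: ler_sum => i _.
    by rewrite -lee_fin -PA probability_le1.
  lra.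
move=> hs.
have r_le : r N2 n <= e.
  rewrite -(subnKC (ltnW nN2)); apply: le_trans (r_ub _ _) _.
  by rewrite -[leRHS]lnK ?posrE// ler_expR lerNl.
have e01 : 0 <= e <= 1 by rewrite (ltW e_gt0).
have := P_hit (n - N2) e01 hB.
rewrite subnKC ?(ltnW nN2)// => hh.
apply: (@le_trans _ _ (((1 - e) * (1 - r N2 n)) + e0)%:E).
  have r0 : 0 <= r N2 n by rewrite fine_ge0.
  rewrite lee_fin; nra.
rewrite EFinD leeD2r//; apply: le_trans hh _.
rewrite le_measure ?inE//.
  apply: bigsetU_measurable => i _.
  by apply: measurableI => //; apply: measurableI => //; exact: measurable_avoid.
rewrite /hit => w.
rewrite -(bigcup_mkord _ (fun i => avoid N2 (N2 + i) `&` A (N2 + i) `&` B (N2 + i))) => -[i _ [[_ wA] wB]].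
exists (N2 + i)%N; last by split.
by rewrite /= (leq_trans (leq_maxl N N1))// leq_addr.
Qed.

End borel_cantelli_converse.

(** * Increments of X and suprema over time intervals *)

Section levy_process.
Context {R : realType} {d : measure_display} {T : measurableType d}.
Variables (P : probability T R) (X : R -> {RV P >-> R}).
Variables (gamma : R) (Pi : {measure set R -> \bar R}).
Hypothesis hX : levy_process X.
Hypothesis hPi2 : (\int[Pi]_x (x ^+ 2)%:E < +oo)%E.
Hypothesis htriplet : has_triplet X gamma 0 Pi.

(** The process starts at 0 only almost surely, so [X t] and [X t - X 0] are exchanged up to a null
    set. *)
Lemma prob_ae_le (A B : set T) : measurable A -> measurable B ->
  {ae P, forall w, A w -> B w} -> (P A <= P B)%E.
Proof.
move=> mA mB [N [mN N0 sN]].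
apply: (@le_trans _ _ (P (B `|` N))).
  rewrite le_measure ?inE//; first exact: measurableU.
  move=> w Aw; have [Bw|Bw] := pselect (B w); [by left|right].
  by apply: sN => /= h; exact: Bw (h Aw).
have h := measureU2 P mB mN.
apply: (le_trans h); rewrite [X in (_ + X <= _)%E](_ : _ = 0%E); first by rewrite adde0.
exact: N0.
Qed.

Lemma prob_ae_eq (A B : set T) : measurable A -> measurable B ->
  {ae P, forall w, A w <-> B w} -> P A = P B.
Proof.
move=> mA mB AB; apply/eqP; rewrite eq_le !prob_ae_le//.
  by apply: filterS AB => w [].
by apply: filterS AB => w [].
Qed.

Lemma measurable_incr (s t : R) (B : set R) : measurable B ->
  measurable [set w | B (X t w - X s w)].
Proof.
move=> mB; rewrite -[X in measurable X]setTI.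
exact: (measurable_funB (measurable_funPT (X t)) (measurable_funPT (X s))).
Qed.

Lemma incr_law (s t : R) (B : set R) : 0 <= s -> s <= t -> measurable B ->
  P [set w | B (X t w - X s w)] = P [set w | B (X (t - s) w)].
Proof.
move=> s0 st mB.
have := levy_stationary hX s0 (_ : 0 <= t - s) mB.
rewrite subr_ge0 addrC subrK => -> //.
apply: prob_ae_eq; first exact: measurable_incr.
  by rewrite -[X in measurable X]setTI; exact: measurable_funPT.
by apply: filterS (levy_start hX) => w /= ->; rewrite subr0.
Qed.

(** X_{s^2} / s tends to 0 in probability: the bound from [upper_tail] is dominated by multiples of
    V(s) and Verr(s). It is used both for Ottaviani's inequality and to control the value of X
    before a large increment. *)
Lemma small_prob (delta e : R) : 0 < delta -> 0 < e ->
  exists2 eta : R, 0 < eta <= 1 & forall s : R, 0 < s <= eta ->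
  (P [set w | (delta * s <= `|X (s ^+ 2) w|)%R] <= e%:E)%E.
Proof.
move=> d0 e0.
have a0 : 0 < delta / 2 by rewrite divr_gt0.
have [C C0 H] := upper_tail hPi2 htriplet (ltW a0) a0.
pose f (s : R) := 2 * (2 * Vfun Pi s / (delta / 2) ^+ 2) + C * Verr gamma Pi s.
have cf : f s @[s --> 0^'+] --> (0 : R).
  suff : f s @[s --> 0^'+] --> 2 * (2 * 0 / (delta / 2) ^+ 2) + C * 0 by rewrite !mulr0 mul0r mulr0 addr0.
  apply: cvgD; last by apply: cvgMr; exact: (Verr_cvg0 gamma hPi2).
  by apply: cvgMr; apply: cvgMl; apply: cvgMr; exact: (Vfun_cvg0 hPi2).
have : \forall s \near 0^'+, f s < e by apply: (cvgr_lt (0 : R)).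
move=> [r /= r0 hr].
exists (Num.min (r / 2) 1).
  by rewrite lt_min ge_min lexx orbT divr_gt0// ltr01.
move=> s /andP[s0]; rewrite le_min => /andP[sr s1].
have := H s; rewrite s0 s1 => /(_ isT).
have -> : delta / 2 + delta / 2 = delta by field.
move=> /le_trans; apply; rewrite lee_fin.
have /ltW : f s < e.
  apply: hr => //=; rewrite sub0r normrN gtr0_norm//.
  by apply: le_lt_trans sr _; rewrite gtr_pMr// invf_lt1 ?ltr1n.
apply: le_trans; rewrite lerD2r ler_wpM2l//.
exact: Gfun_le_V.
Qed.

Lemma prob_compl_ge (A : set T) (e : R) : measurable A -> (P A <= e%:E)%E ->
  ((1 - e)%:E <= P (~` A))%E.
Proof.
move=> mA PA; rewrite probability_setC// EFinB leeB//.
Qed.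

Lemma measurable_norm_gt (b : R) : measurable [set y : R | b < `|y| ].
Proof.
rewrite (_ : [set _ | _] = ~` [set y : R | `|y| <= b]).
  by apply: measurableC; exact: measurable_norm_le.
by apply/seteqP; split => y /=; rewrite ltNge => /negP.
Qed.

Let grid (t : R) (m i : nat) : R := t * i%:R / (2 ^ m)%:R.

Let grid_mono t m : 0 <= t -> {homo grid t m : i j / (i <= j)%N >-> i <= j}.
Proof.
move=> t0 i j ij; rewrite /grid ler_wpM2r ?invr_ge0//.
by rewrite ler_wpM2l// ler_nat.
Qed.

Let dyadic_event (t b : R) (m : nat) : set T :=
  [set w | exists2 n, (n <= 2 ^ m)%N & b < `|X (grid t m n) w - X 0 w| ].

Let measurable_dyadic_event t b m : measurable (dyadic_event t b m).
Proof.
rewrite (_ : dyadic_event t b m = \bigcup_(n in [set n | (n <= 2 ^ m)%N])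
    [set w | b < `|X (grid t m n) w - X 0 w| ]).
  apply: bigcup_measurable => n _.
  exact: (@measurable_incr 0 (grid t m n) _ (measurable_norm_gt b)).
by apply/seteqP; split => w [n nm wn]; exists n.
Qed.

Lemma measurable_normX_gt (b t : R) : measurable [set w | b < `|X t w| ].
Proof.
rewrite -[X in measurable X]setTI.
exact: (measurable_funPT (X t) _ _ (measurable_norm_gt b)).
Qed.

Lemma dyadic_ottaviani (t c delta : R) (m : nat) : 0 < t -> 0 < delta ->
  (forall h, 0 < h <= t -> (P [set w | (delta < `|X h w|)%R] <= (2^-1)%:E)%E) ->
  (P (dyadic_event t (c + delta) m) <= 2%:E * P [set w | (c < `|X t w|)%R])%E.
Proof.
move=> t0 d0 hh.
pose Y i w := X (grid t m i.+1) w - X (grid t m i) w.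
have mY i : measurable_fun setT (Y i) by exact: measurable_funB.
have SE n w : \sum_(i < n) Y i w = X (grid t m n) w - X 0 w.
  rewrite -(big_mkord xpredT (fun i => Y i w)) /Y (telescope_sumr (fun i => X (grid t m i) w))//.
  by rewrite /grid mulr0 mul0r.
have gK : grid t m (2 ^ m) = t by rewrite /grid mulfK// pnatr_eq0 -lt0n expn_gt0.
have mle : measurable [set y : R | `|y| <= delta].
  exact: measurable_norm_le.
have FE n : [set w | `|\sum_(i < 2 ^ m) Y i w - \sum_(i < n) Y i w| <= delta] =
    [set w | `|X t w - X (grid t m n) w| <= delta].
  by apply/seteqP; split => w /=; rewrite !SE gK opprB addrA subrK.
have gm := grid_mono m (ltW t0).
have indF n : (n <= 2 ^ m)%N -> forall A, rectangles Y n A ->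
    P (A `&` [set w | `|\sum_(i < 2 ^ m) Y i w - \sum_(i < n) Y i w| <= delta]) =
    (P A * P [set w | (`|\sum_(i < 2 ^ m) Y i w - \sum_(i < n) Y i w| <= delta)%R])%E.
  move=> nK _ [B [mB ->]]; rewrite FE.
  (* The grid up to index n, then a single jump to t: the last of the n + 1 increments along [tau]
     is X t minus X at grid point n. *)
  pose tau i := if (i <= n)%N then grid t m i else t.
  pose B' i := if (i < n)%N then B i else [set y : R | `|y| <= delta].
  have tau_mono : {homo tau : i j / (i <= j)%N >-> i <= j}.
    move=> i j ij; rewrite /tau; case: ifPn => ni; case: ifPn => nj //.
    - exact: gm.
    - by rewrite -[leRHS]gK; apply: gm; exact: leq_trans ni nK.
    - by move: ni; rewrite (leq_trans ij nj).
  have tau0 : 0 <= tau 0%N by rewrite /tau/= /grid mulr0 mul0r.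
  have mB' i : measurable (B' i) by rewrite /B'; case: ifP.
  have h1 := levy_indep hX n tau0 tau_mono mB'.
  have h2 := levy_indep hX n.+1 tau0 tau_mono mB'.
  rewrite big_ord_recr/= in h2.
  have e1 : [set w | forall i, (i < n)%N -> B i (Y i w)] =
      [set w | forall i, (i < n)%N -> B' i (X (tau i.+1) w - X (tau i) w)].
    apply/seteqP; split => w /= h i ni; have := h i ni;
      by rewrite /B' /tau ni (ltnW ni) /Y.
  have e2 : [set w | `|X t w - X (grid t m n) w| <= delta] =
      [set w | B' n (X (tau n.+1) w - X (tau n) w)].
    by rewrite /B' /tau ltnn leqnn.
  rewrite e1 e2 [X in (_ = X * _)%E]h1 -h2; congr (P _).
  apply/seteqP; split => w /=.
    by move=> [ha hb] i; rewrite ltnS leq_eqVlt => /predU1P[->|/ha].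
  by move=> h; split; [move=> i ni; apply: h; exact: ltnW|exact: h].
have PF n : (n <= 2 ^ m)%N ->
    ((2^-1)%:E <= P [set w | (`|\sum_(i < 2 ^ m) Y i w - \sum_(i < n) Y i w| <= delta)%R])%E.
  move=> nK; rewrite FE.
  have gt : grid t m n <= t by rewrite -[leRHS]gK; exact: gm.
  have g0 : 0 <= grid t m n by rewrite /grid divr_ge0// mulr_ge0// ltW.
  rewrite (@incr_law _ _ [set y : R | `|y| <= delta])//.
  (* If the grid point is t itself, the remaining increment has the law of [X 0], and [hh], which
     speaks of h > 0, is replaced by the initial condition. *)
  move: gt; rewrite le_eqVlt => /predU1P[->|gt].
    rewrite subrr (@prob_ae_eq _ setT).
    - by rewrite probability_setT lee_fin invf_le1// ler1n.
    - by rewrite -[X in measurable X]setTI; exact: (measurable_funPT (X 0)).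
    - exact: measurableT.
    - by apply: filterS (levy_start hX) => w /= ->; rewrite normr0 ltW.
  have h01 : 0 < t - grid t m n <= t by rewrite subr_gt0 gt gerBl.
  have := prob_compl_ge _ (hh _ h01).
  rewrite (_ : 1 - 2^-1 = 2^-1 :> R); last by field.
  have -> : ~` [set w | delta < `|X (t - grid t m n) w| ] =
     [set w | `|X (t - grid t m n) w| <= delta].
    by apply/seteqP; split => w /=; rewrite leNgt => /negP.
  apply; rewrite -[X in measurable X]setTI.
  exact: (measurable_funPT (X (t - grid t m n)) _ _ (measurable_norm_gt delta)).
have := ottaviani mY c indF PF.
have -> : [set w | exists2 n, (n <= 2 ^ m)%N & c + delta < `|\sum_(i < n) Y i w| ] =
    dyadic_event t (c + delta) m.
  by apply/seteqP; split => w [n nK]; rewrite ?SE => wn; exists n; rewrite ?SE.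
move=> /le_trans; apply.
rewrite lee_wpmul2l//.
apply: prob_ae_le.
- rewrite (_ : [set _ | _] = [set w | c < `|X t w - X 0 w| ]).
    exact: (@measurable_incr 0 t _ (measurable_norm_gt c)).
  by apply/seteqP; split => w /=; rewrite SE gK.
- exact: measurable_normX_gt.
by apply: filterS (levy_start hX) => w /= X0; rewrite SE gK X0 subr0.
Qed.

(** The dyadic events increase with the level of refinement, so their union inherits the bound.
    Right-continuity transfers a strict excess at time s to dyadic times just after s. The union is
    a measurable set which almost surely catches every excess. *)
Lemma sup_bound (t c delta : R) : 0 < t -> 0 < delta ->
  (forall h, 0 < h <= t -> (P [set w | (delta < `|X h w|)%R] <= (2^-1)%:E)%E) ->
  exists E : set T, [/\ measurable E,
    (P E <= 2%:E * P [set w | (c < `|X t w|)%R])%E &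
    {ae P, forall w, forall s, 0 < s <= t -> c + delta < `|X s w| -> E w}].
Proof.
move=> t0 d0 hh.
exists (\bigcup_m dyadic_event t (c + delta) m); split.
- by apply: bigcup_measurable => m _.
- have nd : nondecreasing_seq (dyadic_event t (c + delta)).
    apply/nondecreasing_seqP => m; apply/subsetPset => w [n nm wn].
    exists (n * 2)%N; first by rewrite expnSr leq_mul2r nm orbT.
    suff -> : grid t m.+1 (n * 2) = grid t m n by [].
    rewrite /grid expnSr !natrM; field.
    by rewrite pnatr_eq0 expn_eq0.
  have := nondecreasing_cvg_mu (fun m => measurable_dyadic_event t (c + delta) m)
    (bigcup_measurable (fun m _ => measurable_dyadic_event t (c + delta) m)) nd.
  move=> /(_ R P) cv; rewrite -(cvg_lim _ cv)//.
  apply: lime_le; first by apply/cvg_ex; eexists; exact: cv.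
  by apply: nearW => m; exact: dyadic_ottaviani.
apply: filterS2 (levy_start hX) (levy_cadlag hX) => w X0 [rc _] s /andP[s0].
(* The endpoint s = t has no grid points to its right, but it is itself the last point of the
   coarsest grid. *)
rewrite le_eqVlt => /predU1P[->|st] hs.
  by exists 0%N => //; exists 1%N => //; rewrite X0 subr0 /grid mulr1 expn0 divr1.
have cn : `|X u w| @[u --> s^'+] --> `|X s w| by apply: cvg_norm; exact: rc (ltW s0).
have : \forall u \near s^'+, c + delta < `|X u w| by apply: (cvgr_gt (`|X s w|)).
move=> [r /= r0 hr].
(* Since 2^m > m > t / r, the mesh of the grid is smaller than [r]; the index [n] chosen below is
   that of the first grid point strictly after s. *)
pose m := (Num.truncn (t / r)).+1.
have p0 : 0 < (2 ^ m)%:R :> R by rewrite ltr0n expn_gt0.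
have tm : t / (2 ^ m)%:R < r.
  have /andP[_ h] : (Num.truncn (t / r))%:R <= t / r < m%:R.
    by apply: truncn_itv; rewrite divr_ge0// ltW.
  rewrite ltr_pdivrMr// mulrC -ltr_pdivrMr//; apply: lt_trans h _.
  by rewrite ltr_nat ltn_expl.
pose n := (Num.truncn (s * (2 ^ m)%:R / t)).+1.
have /andP[h1 h2] : (Num.truncn (s * (2 ^ m)%:R / t))%:R <= s * (2 ^ m)%:R / t < n%:R.
  by apply: truncn_itv; rewrite divr_ge0// ?mulr_ge0// ltW.
exists m => //; exists n.
  rewrite /n -(ltr_nat R); apply: le_lt_trans h1 _.
  by rewrite ltr_pdivrMr// mulrC ltr_pM2l.
have g1 : s < grid t m n.
  by rewrite /grid ltr_pdivlMr// [X in _ < X]mulrC -ltr_pdivrMr.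
have g2 : grid t m n <= s + t / (2 ^ m)%:R.
  rewrite /grid /n -natr1 mulrDr mulr1 mulrDl lerD2r ler_pdivrMr//.
  by rewrite mulrC -ler_pdivlMr.
rewrite X0 subr0; apply: hr => //=.
by rewrite ltr0_norm ?subr_lt0// opprB ltrBlDl (le_lt_trans g2)// ltrD2l.
Qed.

End levy_process.

Lemma exists_expr_lt {R : realType} (q x : R) : 0 < q < 1 -> 0 < x ->
  exists n : nat, q ^+ n < x.
Proof.
move=> /andP[q0 q1] x0.
have cq : q ^+ n @[n --> \oo] --> (0 : R) by apply: cvg_expr; rewrite ger0_norm// ltW.
have [N _ hN] : \forall n \near \oo, q ^+ n < x by apply: (cvgr_lt (0 : R)).
by exists N; apply: hN => /=.
Qed.

Lemma geometric_bracket {R : realType} (q x : R) (N : nat) : 0 < q < 1 ->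
  0 < x <= q ^+ N -> exists2 n, (N <= n)%N & q ^+ n.+1 < x <= q ^+ n.
Proof.
move=> q01 /andP[x0 xN]; have /andP[q0 q1] := q01.
have h : exists n, q ^+ n < x by exact: exists_expr_lt.
case: (ex_minnP h) => -[|m] hm hmin.
  have : q ^+ N <= 1 by rewrite exprn_ile1// ltW.
  move: hm; rewrite expr0; lra.
exists m; last first.
  rewrite hm/= leNgt; apply/negP => /hmin; by rewrite ltnn.
rewrite leqNgt; apply/negP => mN.
have : q ^+ N <= q ^+ m.+1 by rewrite ler_wiXn2l// ltW.
lra.
Qed.

(** * Almost sure bounds at small times *)

Section limsup_bounds.
Context {R : realType} {d : measure_display} {T : measurableType d}.
Variables (P : probability T R) (X : R -> {RV P >-> R}).
Variables (gamma : R) (Pi : {measure set R -> \bar R}).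
Hypothesis hX : levy_process X.
Hypothesis hPi2 : (\int[Pi]_x (x ^+ 2)%:E < +oo)%E.
Hypothesis htriplet : has_triplet X gamma 0 Pi.

Lemma upper_limsup (a e : R) : 0 < a -> (Ifun Pi a < +oo)%E -> 0 < e ->
  {ae P, forall w, \forall s \near 0^'+, `|X s w| <= (a + e) * Num.sqrt s}.
Proof.
move=> a0 Ia e0.
(* [q] is chosen so that the barrier (a + 2 delta) q^n equals (a + e) q^{n+1}, which is below (a +
   e) sqrt s for every s in (q^{2n+2}, q^{2n}]. *)
pose delta := e / 4; pose q := (a + e / 2) / (a + e).
have delta0 : 0 < delta by rewrite divr_gt0.
have ae0 : 0 < a + e by rewrite addr_gt0.
have q01 : 0 < q < 1.
  rewrite /q divr_gt0//=; last by rewrite addr_gt0// divr_gt0.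
  by rewrite ltr_pdivrMr// mul1r; lra.
have /andP[q0 q1] := q01.
have qn n : 0 < q ^+ n by rewrite exprn_gt0.
have qn1 n : q ^+ n <= 1 by rewrite exprn_ile1// ltW.
have half0 : (0 : R) < 2^-1 by rewrite invr_gt0.
have [eta /andP[eta0 eta1] heta] := small_prob hPi2 htriplet delta0 half0.
have [N0 hN0] := exists_expr_lt q01 eta0.
have qN0 n : (N0 <= n)%N -> q ^+ n <= eta.
  by move=> Nn; apply: le_trans (ltW hN0); rewrite ler_wiXn2l// ltW.
have [C C0 hC] := upper_tail hPi2 htriplet (ltW a0) delta0.
have EH n : exists E : set T, [/\ measurable E,
    (P E <= (2 * (2 * Gfun Pi a (q ^+ n) + C * Verr gamma Pi (q ^+ n)))%:E)%E &
    {ae P, forall w, (N0 <= n)%N -> forall s : R, 0 < s <= (q ^+ n) ^+ 2 ->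
       (a + delta) * q ^+ n + delta * q ^+ n < `|X s w| -> E w}].
  (* One event per n is wanted; for n < N0, where the bound 1/2 is not yet at hand, the empty set
     does, the last claim being vacuous. *)
  have [Nn|Nn] := leqP N0 n; last first.
    exists set0; split => //.
    - rewrite measure0 lee_fin mulr_ge0// addr_ge0// mulr_ge0//.
        exact: Gfun_ge0.
      exact: Verr_ge0.
    - by apply: nearW.
  have t0 : 0 < (q ^+ n) ^+ 2 by rewrite exprn_gt0.
  have d0 : 0 < delta * q ^+ n by rewrite mulr_gt0.
  have hh (h : R) : 0 < h <= (q ^+ n) ^+ 2 ->
      (P [set w | (delta * q ^+ n < `|X h w|)%R] <= (2^-1)%:E)%E.
    move=> /andP[h0 hq]; have s0 : 0 < Num.sqrt h by rewrite sqrtr_gt0.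
    have sq : Num.sqrt h <= q ^+ n.
      by rewrite -(ger0_norm (ltW (qn n))) -sqrtr_sqr ler_wsqrtr.
    have := heta (Num.sqrt h); rewrite s0 (le_trans sq (qN0 _ Nn)) => /(_ isT).
    rewrite (sqr_sqrtr (ltW h0)) => hle; apply: (le_trans _ hle); rewrite le_measure ?inE//.
    - exact: measurable_normX_gt.
    - exact: measurable_normX_ge.
    - move=> w /= /ltW; apply: le_trans; by rewrite ler_wpM2l// ltW.
  have [E [mE PE aeE]] := sup_bound hX ((a + delta) * q ^+ n) t0 d0 hh.
  exists E; split => //; last by apply: filterS aeE => w H _.
  apply: (le_trans PE); rewrite EFinM lee_wpmul2l//.
  have := hC (q ^+ n); rewrite qn qn1 => /(_ isT); apply: le_trans.
  rewrite le_measure ?inE//.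
  - exact: measurable_normX_gt.
  - exact: measurable_normX_ge.
  - by move=> w /= /ltW.
have [E hE] := choice EH.
have mE n : measurable (E n) by have [] := hE n.
have [M1 hM1] := sum_Gfun_ub hPi2 q01 Ia.
have [M2 hM2] := sum_Verr_ub gamma hPi2 q01 ltr01.
have sumE : (\sum_(n <oo) P (E n) < +oo)%E.
  apply: (@le_lt_trans _ _ (4 * M1 + 2 * C * M2)%:E); last by rewrite ltry.
  apply: lime_le; first by apply: is_cvg_nneseries.
  apply: nearW => N; rewrite big_mkord.
  apply: (@le_trans _ _ (\sum_(n < N)
     (2 * (2 * Gfun Pi a (q ^+ n) + C * Verr gamma Pi (q ^+ n)))%:E)%E).
    by apply: lee_sum => n _; have [] := hE n.
  rewrite sumEFin lee_fin -mulr_sumr big_split/= -!mulr_sumr.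
  have := hM1 N.
  have : C * \sum_(n < N) Verr gamma Pi (q ^+ n) <= C * M2.
    rewrite ler_wpM2l//; have := hM2 N; by under eq_bigr do rewrite mul1r.
  lra.
have L0 := lim_sup_set_cvg0 mE sumE.
have aeL : {ae P, forall w, ~ lim_sup_set E w}.
  exists (lim_sup_set E); split => //.
    apply: bigcap_measurable => // n _; exact: bigcup_measurable.
  by move=> w /= /contrapT.
have aeE : {ae P, forall w, forall n, (N0 <= n)%N -> forall s : R, 0 < s <= (q ^+ n) ^+ 2 ->
    (a + delta) * q ^+ n + delta * q ^+ n < `|X s w| -> E n w}.
  by apply: ae_foralln => n; have [] := hE n.
apply: filterS2 aeL aeE => w hL hEw.
have [N1 hN1] : exists N1, forall n, (N1 <= n)%N -> ~ E n w.
  apply: contrapT => /forallNP h; apply: hL => N _; apply: contrapT => h'.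
  by apply: (h N) => n Nn En; apply: h'; exists n.
pose N := maxn N0 N1.
exists ((q ^+ N) ^+ 2) => /=; first by rewrite exprn_gt0.
move=> s /= hs s0; rewrite sub0r normrN gtr0_norm// in hs.
have ss0 : 0 < Num.sqrt s by rewrite sqrtr_gt0.
have ssN : 0 < Num.sqrt s <= q ^+ N.
  rewrite ss0/= -(ger0_norm (ltW (qn N))) -sqrtr_sqr ler_wsqrtr//; exact: ltW.
have [n Nn /andP[h1 h2]] := geometric_bracket q01 ssN.
have N0n : (N0 <= n)%N by apply: leq_trans Nn; exact: leq_maxl.
have N1n : (N1 <= n)%N by apply: leq_trans Nn; exact: leq_maxr.
have sn : 0 < s <= (q ^+ n) ^+ 2.
  by rewrite s0/= -[leLHS](sqr_sqrtr (ltW s0)) ler_sqr// nnegrE ltW.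
rewrite leNgt; apply/negP => hbig; apply: (hN1 n N1n).
apply: (hEw n N0n s sn); apply: le_lt_trans hbig.
have -> : (a + delta) * q ^+ n + delta * q ^+ n = (a + e) * q ^+ n.+1.
  rewrite exprS /q /delta; field; exact: lt0r_neq0.
by rewrite ler_wpM2l// ltW.
Qed.

(* Here time runs backwards along u, so [levy_indep] is applied to the times
   0 < u (n+1) < u n < ... < u N. *)
Lemma indep_decreasing_incr (u : nat -> R) (S : nat -> set R) (U0 U1 : set R) (N n : nat) :
  (forall k, 0 <= u k) -> {homo u : i j / (i <= j)%N >-> j <= i} ->
  (forall k, measurable (S k)) -> measurable U0 -> measurable U1 -> (N <= n)%N ->
  P ([set w | forall j, (N <= j < n)%N -> S j (X (u j) w - X (u j.+1) w)] `&`
     [set w | U1 (X (u n) w - X (u n.+1) w)%R] `&` [set w | U0 (X (u n.+1) w - X 0 w)%R]) =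
  (P [set w | U0 (X (u n.+1) w - X 0 w)%R] * (P [set w | U1 (X (u n) w - X (u n.+1) w)%R] *
   \prod_(i < n - N) P [set w | S (n - i.+1)%N (X (u (n - i.+1)%N) w - X (u (n - i)%N) w)%R]))%E.
Proof.
move=> u0 u_anti mS mU0 mU1 Nn.
pose tau i := if i is 0%N then 0 else u (n.+2 - i)%N.
pose B i := match i with 0%N => U0 | 1%N => U1 | i'.+2 => S (n - i'.+1)%N end.
have tau0 : 0 <= tau 0%N by [].
have tau_mono : {homo tau : i j / (i <= j)%N >-> i <= j}.
  move=> [|i] [|j]//= ij; apply: u_anti; lia.
have mB i : measurable (B i) by case: i => [|[|i]]; [exact: mU0|exact: mU1|exact: mS].
have h := levy_indep hX (n - N).+2 tau0 tau_mono mB.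
have eB i w : B i.+2 (X (tau i.+3) w - X (tau i.+2) w) =
    S (n - i.+1)%N (X (u (n - i.+1)%N) w - X (u (n - i)%N) w).
  by rewrite /B /tau !subSS.
have e0 w : B 0%N (X (tau 1%N) w - X (tau 0%N) w) = U0 (X (u n.+1) w - X 0 w).
  by rewrite /B /tau subn1.
have e1 w : B 1%N (X (tau 2%N) w - X (tau 1%N) w) = U1 (X (u n) w - X (u n.+1) w).
  by rewrite /B /tau subn1 !subSS subn0.
transitivity (P [set w | forall i, (i < (n - N).+2)%N -> B i (X (tau i.+1) w - X (tau i) w)]).
  congr (P _); apply/seteqP; split => w.
    move=> [[hS h1] h0] [|[|i]] ni.
    - by rewrite e0.
    - by rewrite e1.
    - rewrite eB.
      have -> : (n - i = (n - i.+1).+1)%N by lia.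
      by apply: hS; lia.
  move=> hB; split; first split.
  - move=> j /andP[Nj jn]; have := hB (n - j).+1 _.
    have -> : (n - j = (n - j.+1).+1)%N by lia.
    rewrite eB; have -> : (n - (n - j.+1).+1 = j)%N by lia.
    have -> : (n - (n - j.+1) = j.+1)%N by lia.
    by apply; lia.
  - by have := hB 1%N isT; rewrite e1.
  - by have := hB 0%N isT; rewrite e0.
rewrite h big_ord_recl big_ord_recl; congr (_ * (_ * _))%E.
by congr (P _); apply/funext => w; exact: e1.
Qed.

Lemma lower_limsup (a e sg : R) : 0 < a -> Ifun Pi a = +oo%E -> `|sg| = 1 -> 0 < e < a ->
  {ae P, forall w, forall eta : R, 0 < eta -> exists2 s : R, 0 < s < eta &
    (a - e) * Num.sqrt s <= sg * X s w}.
Proof.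
move=> a0 Ia sg1 /andP[e0 ea].
(* The budget e is spent in three equal parts: on the lower tail bound, on replacing b k by b, and
   on the value of X at time u (n+1). *)
pose delta := e / 3; pose b := a - delta.
have delta0 : 0 < delta by rewrite divr_gt0.
have b0 : 0 < b by rewrite /b /delta; lra.
(* The bound 1/2 gives q <= 1 - q <= k, as [sum_Gfun_lb] requires; the bound delta / b gives b k >=
   b (1 - q) >= b - delta. *)
pose q := Num.min (2^-1) (delta / b).
have q0 : 0 < q by rewrite lt_min invr_gt0 ltr0n/= divr_gt0.
have q2 : q <= 2^-1 by rewrite ge_min lexx.
have q1 : q < 1 by lra.
have bq : b * q <= delta.
  by rewrite mulrC -ler_pdivlMr// ge_min lexx orbT.
have q01 : 0 < q < 1 by rewrite q0.
pose k := Num.sqrt (1 - q ^+ 2).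
have k2 : k ^+ 2 = 1 - q ^+ 2 by rewrite sqr_sqrtr//; nra.
have k0 : 0 <= k by exact: sqrtr_ge0.
have k1 : k <= 1 by nra.
have kq : 1 - q <= k by nra.
have qk : q <= k by lra.
have kgt0 : 0 < k by lra.
have qn n : 0 < q ^+ n by rewrite exprn_gt0.
have qn1 n : q ^+ n <= 1 by rewrite exprn_ile1// ltW.
pose u n := (q ^+ n) ^+ 2.
have u0 n : 0 <= u n by rewrite /u exprn_ge0// ltW.
have uS n : u n - u n.+1 = (k * q ^+ n) ^+ 2.
  transitivity ((1 - q ^+ 2) * (q ^+ n) ^+ 2); first by rewrite /u (exprS q n); ring.
  by rewrite -k2; ring.
have u_anti : {homo u : i j / (i <= j)%N >-> j <= i}.
  move=> i j ij; rewrite ler_sqr ?nnegrE ?(ltW (qn _))//.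
  by rewrite ler_wiXn2l// ltW.
pose SA n := [set y : R | b * (k * q ^+ n) <= sg * y].
pose SB n := [set y : R | - (delta * q ^+ n) <= sg * y].
have mS (c : R) : measurable [set y : R | c <= sg * y].
  have mf : measurable_fun setT (fun y : R => sg * y) by exact: measurable_funM.
  have := mf measurableT _ (measurable_itv `[c, +oo[).
  rewrite setTI; congr measurable; by apply/seteqP; split => y /=; rewrite in_itv/= andbT.
have mSA n : measurable (SA n) by exact: mS.
have mSB n : measurable (SB n) by exact: mS.
pose A n := [set w | SA n (X (u n) w - X (u n.+1) w)].
pose B n := [set w | SB n (X (u n.+1) w - X 0 w)].
have mA n : measurable (A n) by exact: measurable_incr.
have mB n : measurable (B n) by exact: measurable_incr.
have avoidE N n : avoid A N n = [set w | forall j, (N <= j < n)%N ->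
    (~` SA j) (X (u j) w - X (u j.+1) w)].
  by apply/seteqP; split.
have indep N n U0 U1 : (N <= n)%N -> measurable U0 -> measurable U1 ->
    P (avoid A N n `&` [set w | U1 (X (u n) w - X (u n.+1) w)] `&`
       [set w | U0 (X (u n.+1) w - X 0 w)]) =
    (P [set w | U0 (X (u n.+1) w - X 0 w)%R] *
     (P [set w | U1 (X (u n) w - X (u n.+1) w)%R] * P (avoid A N n)))%E.
  move=> Nn mU0 mU1; rewrite avoidE.
  have mSC j : measurable (~` SA j) by apply: measurableC.
  rewrite (indep_decreasing_incr u0 u_anti mSC mU0 mU1 Nn); congr (_ * (_ * _))%E.
  (* A second use with trivial sets for the two most recent factors identifies the product over i as
     the probability of [avoid]. *)
  have := indep_decreasing_incr u0 u_anti mSC measurableT measurableT Nn.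
  rewrite !setIT => ->.
  by rewrite [P setT]probability_setT !mul1e.
have indA N n : (N <= n)%N -> (P (avoid A N n `&` A n) = P (avoid A N n) * P (A n))%E.
  move=> Nn; have := indep N n setT (SA n) Nn measurableT (mSA n).
  rewrite setIT [P [set w | setT _]]probability_setT mul1e => ->.
  by rewrite muleC.
have indB N n : (N <= n)%N ->
    (P (avoid A N n `&` A n `&` B n) = P (avoid A N n `&` A n) * P (B n))%E.
  move=> Nn; rewrite indA// (indep N n (SB n) (SA n))// muleC; congr (_ * _)%E.
  exact: muleC.
have [c [C [c0 C0 hc]]] := lower_tail hPi2 htriplet (ltW b0) delta0 sg1.
have [M2 hM2] := sum_Verr_ub gamma hPi2 q01 kgt0.
have sumA (M : R) : exists n, (M%:E < \sum_(i < n) P (A i))%E.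
  have [n hn] := sum_Gfun_lb hPi2 q01 qk Ia ((M + C * M2) / c).
  exists n; rewrite ltr_pdivrMr// in hn.
  apply: (@lt_le_trans _ _ (\sum_(i < n)
     (c * Gfun Pi a (k * q ^+ i) - C * Verr gamma Pi (k * q ^+ i))%:E)%E).
    rewrite sumEFin lte_fin sumrB -!mulr_sumr.
    have := ler_wpM2l C0 (hM2 n); lra.
  apply: lee_sum => i _.
  rewrite [P (A i)](@incr_law _ _ _ P X hX (u i.+1) (u i) (SA i))//; last exact: u_anti.
  have := hc (k * q ^+ i); rewrite mulr_gt0//= mulr_ile1 ?(ltW (qn _))// => /(_ isT).
  by rewrite subrK uS.
have limB (e1 : R) : 0 < e1 -> exists N, forall n, (N <= n)%N -> ((1 - e1)%:E <= P (B n))%E.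
  move=> e10; have [eta /andP[eta0 _] heta] := small_prob hPi2 htriplet delta0 e10.
  have [N hN] := exists_expr_lt q01 eta0.
  exists N => n Nn.
  have qSn : q ^+ n.+1 <= q ^+ n by rewrite ler_wiXn2l// ltW.
  have qnN : q ^+ n.+1 <= eta.
    by apply: le_trans (ltW hN); rewrite ler_wiXn2l ?(ltW q0) ?(ltW q1)// leqW.
  have := heta (q ^+ n.+1); rewrite qn qnN => /(_ isT).
  have mn := measurable_normX_ge X (delta * q ^+ n.+1) (u n.+1).
  move=> /(prob_compl_ge mn) /le_trans; apply.
  apply: prob_ae_le => //; first exact: measurableC.
  apply: filterS (levy_start hX) => w /= X0 /negP; rewrite -ltNge => hw.
  rewrite /B /SB/= X0 subr0 lerNl.
  apply: (@le_trans _ _ (`|sg * X (u n.+1) w|)); first by rewrite -normrN ler_norm.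
  rewrite normrM sg1 mul1r (le_trans (ltW hw))// ler_wpM2l// ltW//.
have io := io_prob1 mA mB indA indB sumA limB.
have aeio : {ae P, forall w, forall N : nat, exists2 n, (N <= n)%N & A n w /\ B n w}.
  apply: ae_foralln => N.
  have mU : measurable (\bigcup_(n >= N) (A n `&` B n)).
    by apply: bigcup_measurable => n _; exact: measurableI.
  exists (~` \bigcup_(n >= N) (A n `&` B n)); split.
  - exact: measurableC.
  - have h := probability_setC P mU.
    apply: (eq_trans h); rewrite [X in (_ - X)%E](_ : _ = 1%E) ?subee//; exact: io.
  - by move=> w /= hw [n Nn [An Bn]]; apply: hw; exists n.
apply: filterS2 aeio (levy_start hX) => w hio X0 eta eta0.
have seta0 : 0 < Num.sqrt eta by rewrite sqrtr_gt0.
have [N hN] := exists_expr_lt q01 seta0.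
have [n Nn [An Bn]] := hio N.
exists (u n).
  rewrite /u exprn_gt0//= -[ltRHS](sqr_sqrtr (ltW eta0)) ltr_sqr ?nnegrE ?(ltW (qn _)) ?(ltW seta0)//.
  by apply: le_lt_trans hN; rewrite ler_wiXn2l// ltW.
rewrite /u sqrtr_sqr ger0_norm ?(ltW (qn _))//.
move: An Bn; rewrite /A /B /SA /SB /= X0 subr0 -/(u n) => An Bn.
have : (a - e) * q ^+ n <= (b * k - delta) * q ^+ n.
  rewrite ler_wpM2r ?(ltW (qn _))//.
  have : b * (1 - q) <= b * k by rewrite ler_wpM2l// ltW.
  by rewrite /b /delta in bq *; lra.
nra.
Qed.

End limsup_bounds.

(** * Criteria for bounding an upper limit along a filter *)

Section limf_esup_bounds.
Context {R : realType} {T : choiceType} {U : filteredType T} (F : set (set U)).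
Local Open Scope ereal_scope.

Lemma limf_esup_le_near (f : U -> \bar R) (x : \bar R) :
  F [set t | f t <= x] -> limf_esup f F <= x.
Proof.
move=> h; rewrite limf_esupE; apply: (@le_trans _ _ (ereal_sup (f @` [set t | f t <= x]))).
  by apply: ereal_inf_lbound; exists [set t | f t <= x].
by apply: ge_ereal_sup => _ [t ht <-].
Qed.

Lemma limf_esup_ge_frequently (f : U -> \bar R) (x : \bar R) :
  (forall V, F V -> exists2 t, V t & x <= f t) -> x <= limf_esup f F.
Proof.
move=> h; rewrite limf_esupE; apply: le_ereal_inf_tmp => _ [V FV <-].
have [t Vt xt] := h V FV; apply: le_trans xt _.
by apply: ereal_sup_ubound; exists t.
Qed.

Lemma le_limf_esup (f g : U -> \bar R) : (forall t, f t <= g t) ->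
  limf_esup f F <= limf_esup g F.
Proof.
move=> fg; rewrite !limf_esupE; apply: le_ereal_inf_tmp => _ [V FV <-].
apply: (@le_trans _ _ (ereal_sup (f @` V))).
  by apply: ereal_inf_lbound; exists V.
apply: ge_ereal_sup => _ [t Vt <-]; apply: le_trans (fg t) _.
by apply: ereal_sup_ubound; exists t.
Qed.

End limf_esup_bounds.

(** * Identification of the three limits *)

Section levy_lil.
Context {R : realType} {d : measure_display} {T : measurableType d}.
Variables (P : probability T R) (X : R -> {RV P >-> R}).
Variables (gamma : R) (Pi : {measure set R -> \bar R}).
Hypothesis hX : levy_process X.
Hypothesis hPi2 : (\int[Pi]_x (x ^+ 2)%:E < +oo)%E.
Hypothesis htriplet : has_triplet X gamma 0 Pi.

Let L : \bar R := lambdaI Pi.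

Let L_ge0 : (0 <= L)%E.
Proof. by apply: le_ereal_inf_tmp => _ [a [a0 _] <-]; rewrite lee_fin ltW. Qed.

Let near_le (y : R) : (L < y%:E)%E ->
  {ae P, forall w, \forall s \near 0^'+, `|X s w| <= y * Num.sqrt s}.
Proof.
move=> /ereal_inf_lt[_ [a [a0 Ia] <-]]; rewrite lte_fin => ay.
have e0 : 0 < y - a by rewrite subr_gt0.
have := upper_limsup hX hPi2 htriplet a0 Ia e0.
by have -> : a + (y - a) = y by ring.
Qed.

Let Sabs w (t : R) : \bar R := (`|X t w| / Num.sqrt t)%:E.
Let Ssg (sg : R) w (t : R) : \bar R := (sg * X t w / Num.sqrt t)%:E.

Let esup_le (y : R) : (L < y%:E)%E ->
  {ae P, forall w, (limf_esup (Sabs w) 0^'+ <= y%:E)%E}.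
Proof.
move=> /near_le; apply: filterS => w h; apply: limf_esup_le_near.
suff : \forall t \near 0^'+, (Sabs w t <= y%:E)%E by [].
near=> t; rewrite lee_fin ler_pdivrMr; last by rewrite sqrtr_gt0; near: t; exact: nbhs_right_gt.
by near: t.
Unshelve. all: by end_near. Qed.

Let esup_ge (sg y : R) : `|sg| = 1 -> (y%:E < L)%E ->
  {ae P, forall w, (y%:E <= limf_esup (Ssg sg w) 0^'+)%E}.
Proof.
move=> sg1 yL.
(* When L = 0 there is no positive level below L to which [lower_limsup] applies; instead y < 0, and
   the upper bound |X t| <= - y sqrt t is enough. *)
have [L0|L0] := eqVneq L 0%E.
  have y0 : y < 0 by rewrite L0 lte_fin in yL.
  have : (L < (- y)%:E)%E by rewrite L0 lte_fin oppr_gt0.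
  move=> /near_le; apply: filterS => w h; apply: limf_esup_ge_frequently => V FV.
  have : \forall t \near 0^'+, V t /\ (y%:E <= Ssg sg w t)%E.
    near=> t; split; first by near: t.
    rewrite lee_fin ler_pdivlMr; last by rewrite sqrtr_gt0; near: t; exact: nbhs_right_gt.
    have : `|X t w| <= - y * Num.sqrt t by near: t.
    rewrite -[X in X <= _]mul1r -sg1 -normrM => ht.
    have := ler_norm (- (sg * X t w)); rewrite normrN; lra.
  by move=> /filter_ex[t [Vt yt]]; exists t.
have [a ya aL] : exists2 a : R, Num.max y 0 < a & (a%:E < L)%E.
  have : ((Num.max y 0)%:E < L)%E.
    by rewrite EFin_max gt_max yL lt_neqAle eq_sym L0 L_ge0.
  move: L_ge0; case: L => [r| |]//= _.
    rewrite lte_fin => h; exists ((Num.max y 0 + r) / 2); first exact: (midf_lt h).1.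
    by rewrite lte_fin (midf_lt h).2.
  by move=> _; exists (Num.max y 0 + 1); rewrite ?ltrDl// ltry.
have [ya' a0] : y < a /\ 0 < a by move: ya; rewrite gt_max => /andP[].
have Ia : Ifun Pi a = +oo%E.
  apply: contrapT => /eqP; rewrite -ltey => Ia.
  move: aL; rewrite ltNge => /negP; apply.
  by apply: ereal_inf_lbound; exists a.
(* With this loss the level reached is max(y, a/2), hence at least y; the term a/2 keeps it
   positive, that is, the loss below a. *)
have e0 : 0 < a - Num.max y (a / 2) < a.
  rewrite subr_gt0 gt_max ya' ltr_pdivrMr// gtrDl oppr_lt0 lt_max divr_gt0// orbT andbT.
  by rewrite mulr_natr mulr2n ltrDl.
apply: filterS (lower_limsup hX hPi2 htriplet a0 Ia sg1 e0) => w h.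
apply: limf_esup_ge_frequently => V [r /= r0 hV].
have [s /andP[s0 sr] hs] := h r r0.
exists s; first by apply: hV => //=; rewrite sub0r normrN gtr0_norm.
rewrite lee_fin ler_pdivlMr ?sqrtr_gt0//; apply: le_trans hs.
rewrite ler_wpM2r ?sqrtr_ge0// opprB addrC subrK le_max lexx//.
Unshelve. all: by end_near. Qed.

(** The exceptional null set of [esup_le] depends on y, so y descends to L along the countable
    sequence r + 1/(m+1). *)
Let ae_esup_le : {ae P, forall w, (limf_esup (Sabs w) 0^'+ <= L)%E}.
Proof.
move: esup_le L_ge0; case: L => [r| |]// h _; last by apply: nearW => w; rewrite leey.
have : {ae P, forall w, forall m : nat, (limf_esup (Sabs w) 0^'+ <= (r + m.+1%:R^-1)%:E)%E}.
  apply: ae_foralln => m; apply: h; by rewrite lte_fin ltrDl invr_gt0.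
apply: filterS => w hw; apply/lee_addgt0Pr => e e0.
have [m] := ltr_add_invr e0; rewrite add0r => hm.
apply: le_trans (hw m) _; rewrite -EFinD lee_fin lerD2l; exact: ltW.
Qed.

Let ae_esup_ge (sg : R) : `|sg| = 1 ->
  {ae P, forall w, (L <= limf_esup (Ssg sg w) 0^'+)%E}.
Proof.
move=> sg1; have := fun y => @esup_ge sg y sg1.
move: L_ge0; case: L => [r| |]// _ h.
  have : {ae P, forall w, forall m : nat, ((r - m.+1%:R^-1)%:E <= limf_esup (Ssg sg w) 0^'+)%E}.
    apply: ae_foralln => m; apply: h; by rewrite lte_fin ltrBlDr ltrDl invr_gt0.
  apply: filterS => w hw; apply/lee_subgt0Pr => e e0.
  have [m] := ltr_add_invr e0; rewrite add0r => hm.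
  apply: le_trans (hw m); rewrite -EFinB lee_fin lerB//; exact: ltW.
have : {ae P, forall w, forall m : nat, (m%:R%:E <= limf_esup (Ssg sg w) 0^'+)%E}.
  by apply: ae_foralln => m; apply: h; rewrite ltry.
apply: filterS => w hw; rewrite leye_eq; apply/eqP/eqyP => y y0.
apply: le_trans (hw (Num.truncn y).+1); rewrite lee_fin ltW//.
by have /andP[] := truncn_itv (ltW y0).
Qed.

(** A squeeze: for either sign, L is at most the limsup of the signed ratio, which is at most that
    of the absolute ratio, which is at most L. The sign -1 gives the liminf. *)
Lemma small_time_limsup : {ae P, forall w,
    [/\ (- limf_einf (fun t : R => (X t w / Num.sqrt t)%:E) 0^'+)%E = lambdaI Pi,
        limf_esup (fun t : R => (X t w / Num.sqrt t)%:E) 0^'+ = lambdaI Pi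
      & limf_esup (fun t : R => (`|X t w| / Num.sqrt t)%:E) 0^'+ = lambdaI Pi]}.
Proof.
have n1 : `|1 : R| = 1 by rewrite normr1.
have nm1 : `|- 1 : R| = 1 by rewrite normrN1.
have SE sg w : `|sg| = 1 -> (limf_esup (Ssg sg w) 0^'+ <= limf_esup (Sabs w) 0^'+)%E.
  move=> sg1; apply: le_limf_esup => t; rewrite lee_fin ler_wpM2r ?invr_ge0 ?sqrtr_ge0//.
  by rewrite (le_trans (ler_norm _))// normrM sg1 mul1r.
have S1 w : Ssg 1 w = (fun t : R => (X t w / Num.sqrt t)%:E).
  by apply/funext => t; rewrite /Ssg mul1r.
have Sm1 w : Ssg (-1) w = (\- (fun t : R => (X t w / Num.sqrt t)%:E))%E.
  by apply/funext => t; rewrite /Ssg mulN1r mulNr.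
apply: filterS3 ae_esup_le (ae_esup_ge n1) (ae_esup_ge nm1) => w h0 h1 h2.
rewrite -limf_esupN -Sm1 -S1; split; apply/eqP; rewrite eq_le.
- by rewrite h2 (le_trans (SE _ w nm1)).
- by rewrite h1 (le_trans (SE _ w n1)).
- by rewrite h0 (le_trans h1)// SE.
Qed.

End levy_lil.

Theorem theorem2p2 (R : realType) (d : measure_display) (T : measurableType d)
    (P : probability T R) (X : R -> {RV P >-> R})
    (gamma : R) (Pi : {measure set R -> \bar R})
    (hX : levy_process X)
    (hPi : Pi (~` (`[-1, 1] `\ 0)) = 0%E)
    (hPi2 : (\int[Pi]_x (x ^+ 2)%:E < +oo)%E)
    (htriplet : has_triplet X gamma 0 Pi) :
  {ae P, forall w,
    [/\ (- limf_einf (fun t : R => (X t w / Num.sqrt t)%:E) 0^'+)%E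
          = limf_esup (fun t : R => (X t w / Num.sqrt t)%:E) 0^'+,
        limf_esup (fun t : R => (X t w / Num.sqrt t)%:E) 0^'+
          = limf_esup (fun t : R => (`|X t w| / Num.sqrt t)%:E) 0^'+
      & limf_esup (fun t : R => (`|X t w| / Num.sqrt t)%:E) 0^'+
          = lambdaI Pi]}.
Proof.
by apply: filterS (small_time_limsup hX hPi2 htriplet) => w [-> -> ->].
Qed.
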